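(* There exists a sequence of initial data sets $\{(g^{(j)},k^{(j)};\psi_0^{(j)},\psi_1^{(j)})\}_{j=1}^\infty$ for the Einstein--scalar field system on the unit ball $B(0,1)\subset\mathbb R^3$, i.e. a sequence of Riemannian metrics $g^{(j)}$, symmetric $(0,2)$-tensors $k^{(j)}$ and functions $\psi_0^{(j)},\psi_1^{(j)}:B(0,1)\to\mathbb R$ satisfying the constraint equations $$R[g^{(j)}]+(\mathrm{tr}_{g^{(j)}}k^{(j)})^2-\|k^{(j)}\|^2_{g^{(j)}}=\|\nabla\psi_0^{(j)}\|^2_{g^{(j)}}+(\psi_1^{(j)})^2,$$ $$\mathrm{div}_{g^{(j)}}k^{(j)}-\nabla(\mathrm{tr}_{g^{(j)}}k^{(j)})=\psi_1^{(j)}\nabla\psi_0^{(j)},$$ such that $$\|g^{(j)}-e\|_{H^{3/2}(B(0,1))}+\|k^{(j)}\|_{H^{1/2}(B(0,1))}\le2^{-j}\qquad\text{for all }j\in\mathbb N,$$ where $e$ is the Euclidean metric, and such that $(B(0,1),g^{(j)},k^{(j)})$ contains a smooth embedded compact trapped $2$-sphere for all $j\in\mathbb N$.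
   Context: $R[g]$ is the scalar curvature of $g$, and $\nabla$, $\mathrm{div}_g$, $\mathrm{tr}_g$, $\|\cdot\|_g$ are taken with respect to $g$. Trapped surface: let $g$ be a Riemannian metric and $k$ a symmetric covariant $2$-tensor on an open set $\Omega\subseteq\mathbb R^3$, and let $S\subset\Omega$ be a compact, embedded, smooth, connected $2$-surface. Let $N_g$ be the $g$-unit normal of $S$ pointing towards the unbounded component of $\mathbb R^3\setminus S$, $g_S$ the metric induced by $g$ on $S$, and $h_g(X,Y)=\langle\nabla_X N_g,Y\rangle_g$ (for $X,Y$ tangent to $S$) the second fundamental form. $S$ is trapped in $(\Omega,g,k)$ if at every point of $S$ both $\mathrm{tr}_{g_S}(k+h_g)<0$ and $\mathrm{tr}_{g_S}(k-h_g)<0$ (with $k$ restricted to $TS$). Norms: $H^s(\mathbb R^3)$ is the usual inhomogeneous $L^2$-based Sobolev space; for an open set $\Omega\subset\mathbb R^3$, $\|\phi\|_{H^s(\Omega)}$ is the infimum of $\|\overline\phi\|_{H^s(\mathbb R^3)}$ over all $\overline\phi\in H^s(\mathbb R^3)$ with $\overline\phi|_\Omega=\phi$. The norm of a covariant $2$-tensor is the sum of the norms of its components in the standard Cartesian coordinates. *)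

(* Defs.v *)
From HB Require Import structures.
From mathcomp Require Import all_boot all_order all_algebra.
From mathcomp Require Import all_classical all_reals all_analysis.

Set Implicit Arguments.
Unset Strict Implicit.
Unset Printing Implicit Defensive.

Import Order.TTheory GRing.Theory Num.Theory.
Import numFieldNormedType.Exports.

Local Open Scope classical_set_scope.
Local Open Scope ring_scope.

(** * Calculus and Euclidean geometry

    Points and vectors of R^3 are row vectors.  The library norm on 'rV[R]_3 is
    the sup norm: it is used only for the topology and for boundedness; metric
    notions go through [dot]. *)

(* [smooth_on U f]: all iterated directional derivatives of [f] exist and are
   continuous on the open set [U], i.e. f is C^oo on U. *)
Definition iter_derive (R : realType) (V W : normedModType R)
    (vs : seq V) (f : V -> W) : V -> W :=
  foldr (fun v h x => 'D_v h x) f vs.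

Definition smooth_on (R : realType) (V W : normedModType R)
    (U : set V) (f : V -> W) : Prop :=
  forall (vs : seq V) (x : V), U x ->
    {for x, continuous (iter_derive vs f)} /\
    forall v : V, derivable (iter_derive vs f) x v.

Definition dot (R : realType) (u v : 'rV[R]_3) : R :=
  \sum_(i < 3) u 0 i * v 0 i.

Definition unit_ball (R : realType) : set 'rV[R]_3 := [set x | dot x x < 1].

Definition unit_sphere (R : realType) : set 'rV[R]_3 := [set x | dot x x = 1].

Definition partial (R : realType) (i : 'I_3) (f : 'rV[R]_3 -> R)
    (x : 'rV[R]_3) : R :=
  'D_(delta_mx 0 i : 'rV[R]_3) f x.

(** * Riemannian geometry in Cartesian coordinates

    A covariant 2-tensor field is the matrix-valued map of its components. *)

Definition bilin (R : realType) (A : 'M[R]_3) (u v : 'rV[R]_3) : R :=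
  (u *m A *m v^T) 0 0.

Definition symmetric_tensor (R : realType) (U : set 'rV[R]_3)
    (k : 'rV[R]_3 -> 'M[R]_3) : Prop :=
  smooth_on U k /\ forall x, U x -> (k x)^T = k x.

Definition riemannian_metric (R : realType) (U : set 'rV[R]_3)
    (g : 'rV[R]_3 -> 'M[R]_3) : Prop :=
  symmetric_tensor U g /\
  forall x, U x -> forall v : 'rV[R]_3, v != 0 -> 0 < bilin (g x) v v.

(* [christoffel g a b c x] is Gamma^a_{bc}(x). *)
Definition christoffel (R : realType) (g : 'rV[R]_3 -> 'M[R]_3)
    (a b c : 'I_3) (x : 'rV[R]_3) : R :=
  2^-1 * \sum_(d < 3) invmx (g x) a d *
    (partial b (fun y => g y d c) x + partial c (fun y => g y d b) x
     - partial d (fun y => g y b c) x).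

(* R^a_{bcd} = d_c Gamma^a_{db} - d_d Gamma^a_{cb}
               + Gamma^a_{ce} Gamma^e_{db} - Gamma^a_{de} Gamma^e_{cb}, so that
   round spheres have positive curvature. *)
Definition riemann (R : realType) (g : 'rV[R]_3 -> 'M[R]_3)
    (a b c d : 'I_3) (x : 'rV[R]_3) : R :=
  partial c (christoffel g a d b) x - partial d (christoffel g a c b) x
  + \sum_(e < 3) (christoffel g a c e x * christoffel g e d b x
                  - christoffel g a d e x * christoffel g e c b x).

Definition ricci (R : realType) (g : 'rV[R]_3 -> 'M[R]_3)
    (b d : 'I_3) (x : 'rV[R]_3) : R :=
  \sum_(a < 3) riemann g a b a d x.

Definition scalar_curvature (R : realType) (g : 'rV[R]_3 -> 'M[R]_3)
    (x : 'rV[R]_3) : R :=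
  \sum_(b < 3) \sum_(d < 3) invmx (g x) b d * ricci g b d x.

Definition trace_g (R : realType) (g k : 'rV[R]_3 -> 'M[R]_3)
    (x : 'rV[R]_3) : R :=
  \sum_(a < 3) \sum_(b < 3) invmx (g x) a b * k x a b.

Definition tensor_norm2 (R : realType) (g k : 'rV[R]_3 -> 'M[R]_3)
    (x : 'rV[R]_3) : R :=
  \sum_(a < 3) \sum_(b < 3) \sum_(c < 3) \sum_(d < 3)
    invmx (g x) a c * invmx (g x) b d * k x a b * k x c d.

Definition grad_norm2 (R : realType) (g : 'rV[R]_3 -> 'M[R]_3)
    (psi : 'rV[R]_3 -> R) (x : 'rV[R]_3) : R :=
  \sum_(a < 3) \sum_(b < 3)
    invmx (g x) a b * partial a psi x * partial b psi x.

(* (nabla_a k)_{bc} *)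
Definition cov_tensor (R : realType) (g k : 'rV[R]_3 -> 'M[R]_3)
    (a b c : 'I_3) (x : 'rV[R]_3) : R :=
  partial a (fun y => k y b c) x
  - \sum_(d < 3) (christoffel g d a b x * k x d c
                  + christoffel g d a c x * k x b d).

Definition div_g (R : realType) (g k : 'rV[R]_3 -> 'M[R]_3)
    (b : 'I_3) (x : 'rV[R]_3) : R :=
  \sum_(a < 3) \sum_(c < 3) invmx (g x) a c * cov_tensor g k a c b x.

Definition hamiltonian_constraint (R : realType) (U : set 'rV[R]_3)
    (g k : 'rV[R]_3 -> 'M[R]_3) (psi0 psi1 : 'rV[R]_3 -> R) : Prop :=
  forall x, U x ->
    scalar_curvature g x + trace_g g k x ^+ 2 - tensor_norm2 g k x =
    grad_norm2 g psi0 x + psi1 x ^+ 2.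

Definition momentum_constraint (R : realType) (U : set 'rV[R]_3)
    (g k : 'rV[R]_3 -> 'M[R]_3) (psi0 psi1 : 'rV[R]_3 -> R) : Prop :=
  forall x, U x -> forall b : 'I_3,
    div_g g k b x - partial b (trace_g g k) x = psi1 x * partial b psi0 x.

Definition initial_data_set (R : realType) (U : set 'rV[R]_3)
    (g k : 'rV[R]_3 -> 'M[R]_3) (psi0 psi1 : 'rV[R]_3 -> R) : Prop :=
  [/\ riemannian_metric U g,
      symmetric_tensor U k,
      smooth_on U psi0 /\ smooth_on U psi1,
      hamiltonian_constraint U g k psi0 psi1
    & momentum_constraint U g k psi0 psi1].

(** * Embedded surfaces and trapped surfaces *)

(* S is the image of the round sphere under a smooth embedding: an injective
   immersion of a compact manifold is an embedding, and a map is smooth on the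
   sphere iff it extends smoothly to an open neighbourhood of it. *)
Definition embedded_sphere (R : realType) (S : set 'rV[R]_3) : Prop :=
  exists (U : set 'rV[R]_3) (F : 'rV[R]_3 -> 'rV[R]_3),
    [/\ open U /\ @unit_sphere R `<=` U,
        smooth_on U F,
        {in @unit_sphere R &, injective F},
        forall p v, unit_sphere p -> dot p v = 0 -> v != 0 -> 'D_v F p != 0
      & S = F @` @unit_sphere R].

(* v is the velocity at p of a smooth curve contained in S. *)
Definition tangent (R : realType) (S : set 'rV[R]_3) (p v : 'rV[R]_3) : Prop :=
  exists (e : R) (c : R -> 'rV[R]_3),
    [/\ 0 < e,
        smooth_on (ball (0 : R) e) c,
        forall t, ball (0 : R) e t -> S (c t),
        c 0 = p
      & 'D_1 c 0 = v].

(* The rows of X form a basis of the tangent plane of the surface S at p. *)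
Definition tangent_frame (R : realType) (S : set 'rV[R]_3) (p : 'rV[R]_3)
    (X : 'M[R]_(2, 3)) : Prop :=
  row_free X /\ forall a : 'I_2, tangent S p (row a X).

Definition gram (R : realType) (q : 'rV[R]_3 -> 'rV[R]_3 -> R)
    (X : 'M[R]_(2, 3)) : 'M[R]_2 :=
  \matrix_(a, b) q (row a X) (row b X).

(* The trace of the bilinear form q on the plane spanned by the frame X, with
   respect to the restriction of gp to that plane: (g_S)^{ab} q_{ab}. *)
Definition surface_trace (R : realType) (gp : 'M[R]_3)
    (q : 'rV[R]_3 -> 'rV[R]_3 -> R) (X : 'M[R]_(2, 3)) : R :=
  \tr (invmx (gram (bilin gp) X) *m gram q X).

(* The union of the unbounded components of the complement of S (there is
   exactly one when S is compact). *)
Definition exterior (R : realType) (S : set 'rV[R]_3) : set 'rV[R]_3 :=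
  [set x | ~ bounded_set (connected_component (~` S) x)].

(* N restricts on S to the outward g-unit normal.  N is given together with a
   smooth extension to a neighbourhood of S so that it can be differentiated;
   the derivatives of N in directions tangent to S do not depend on it. *)
Definition outward_unit_normal (R : realType) (g : 'rV[R]_3 -> 'M[R]_3)
    (S : set 'rV[R]_3) (N : 'rV[R]_3 -> 'rV[R]_3) : Prop :=
  (exists U : set 'rV[R]_3, [/\ open U, S `<=` U & smooth_on U N]) /\
  forall p, S p ->
    [/\ bilin (g p) (N p) (N p) = 1,
        forall v, tangent S p v -> bilin (g p) (N p) v = 0
      & \forall t \near 0^'+, exterior S (p + t *: N p)].

(* nabla_X N at p *)
Definition cov_vector (R : realType) (g : 'rV[R]_3 -> 'M[R]_3)
    (N : 'rV[R]_3 -> 'rV[R]_3) (p X : 'rV[R]_3) : 'rV[R]_3 :=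
  'D_X N p + \row_(a < 3) \sum_(b < 3) \sum_(c < 3)
    christoffel g a b c p * X 0 b * N p 0 c.

Definition second_form (R : realType) (g : 'rV[R]_3 -> 'M[R]_3)
    (N : 'rV[R]_3 -> 'rV[R]_3) (p X Y : 'rV[R]_3) : R :=
  bilin (g p) (cov_vector g N p X) Y.

(* S is meant to be a compact connected smooth embedded surface. *)
Definition trapped (R : realType) (U : set 'rV[R]_3)
    (g k : 'rV[R]_3 -> 'M[R]_3) (S : set 'rV[R]_3) : Prop :=
  S `<=` U /\
  exists2 N : 'rV[R]_3 -> 'rV[R]_3, outward_unit_normal g S N &
    forall p, S p -> forall X : 'M[R]_(2, 3), tangent_frame S p X ->
      surface_trace (g p)
        (fun u v => bilin (k p) u v + second_form g N p u v) X < 0 /\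
      surface_trace (g p)
        (fun u v => bilin (k p) u v - second_form g N p u v) X < 0.

(** * Sobolev norms

    The library has no Lebesgue measure on row vectors, so integration takes
    place on R * R * R with the product measure. *)

Notation R3 R :=
  (measurableTypeR R * measurableTypeR R * measurableTypeR R)%type.

Definition row3 (R : realType) (x : R3 R) : 'rV[R]_3 :=
  \row_(i < 3) [:: x.1.1; x.1.2; x.2]`_i.

Definition mu3 (R : realType) : {measure set (R3 R) -> \bar R} :=
  ((@lebesgue_measure R \x @lebesgue_measure R) \x @lebesgue_measure R)%E.

Definition dot3 (R : realType) (x y : R3 R) : R := dot (row3 x) (row3 y).

(* Real and imaginary parts of the Fourier transform of u restricted to the
   ball of radius n, with the unitary normalization
   (2 pi)^{-3/2} \int u(x) e^{- i x . xi} dx. *)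
Definition fourier_re (R : realType) (n : nat) (u : R3 R -> R) (xi : R3 R) : R :=
  (2 * pi) `^ (- (3 / 2)) *
  \int[@mu3 R]_(x in [set x | dot3 x x <= n%:R ^+ 2]) (u x * cos (dot3 x xi)).

Definition fourier_im (R : realType) (n : nat) (u : R3 R -> R) (xi : R3 R) : R :=
  - ((2 * pi) `^ (- (3 / 2)) *
  \int[@mu3 R]_(x in [set x | dot3 x x <= n%:R ^+ 2]) (u x * sin (dot3 x xi))).

(* a + i b is the Fourier-Plancherel transform of u in L^2: the limit in L^2 of
   the Fourier transforms of the truncations of u. *)
Definition is_fourier (R : realType) (u a b : R3 R -> R) : Prop :=
  [/\ u \in Lfun (@mu3 R) 2%:E,
      a \in Lfun (@mu3 R) 2%:E,
      b \in Lfun (@mu3 R) 2%:E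
    & (fun n : nat => \int[@mu3 R]_xi
         ((a xi - fourier_re n u xi) ^+ 2
          + (b xi - fourier_im n u xi) ^+ 2)%:E)%E @ \oo --> (0 : \bar R)%E].

(* The L^2 norm of (1 + |xi|^2)^{s/2} (a + i b); it is +oo exactly when the
   function whose transform is a + i b does not belong to H^s. *)
Definition weighted_norm (R : realType) (s : R) (a b : R3 R -> R) : \bar R :=
  ((\int[@mu3 R]_xi
     ((1 + dot3 xi xi) `^ s * (a xi ^+ 2 + b xi ^+ 2))%:E) `^ 2^-1)%E.

(* The H^s(U) norm: the infimum of the H^s(R^3) norms of the extensions. *)
Definition sobolev_norm (R : realType) (s : R) (U : set 'rV[R]_3)
    (f : 'rV[R]_3 -> R) : \bar R :=
  ereal_inf [set r | exists u a b : R3 R -> R,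
    [/\ {ae @mu3 R, forall x, U (row3 x) -> u x = f (row3 x)},
        is_fourier u a b
      & r = weighted_norm s a b]].

Definition tensor_sobolev_norm (R : realType) (s : R) (U : set 'rV[R]_3)
    (k : 'rV[R]_3 -> 'M[R]_3) : \bar R :=
  (\sum_(i < 3) \sum_(j < 3) sobolev_norm s U (fun x => k x i j))%E.

(* Main.v *)
Require Import Defs.
From HB Require Import structures.
From mathcomp Require Import all_boot all_order all_algebra.
From mathcomp Require Import all_classical all_reals all_analysis.
From mathcomp Require Import measurable_realfun.
From mathcomp Require Import ring lra.

Set Implicit Arguments.
Unset Strict Implicit.
Unset Printing Implicit Defensive.

Import Order.TTheory GRing.Theory Num.Theory.
Import numFieldNormedType.Exports.

Local Open Scope classical_set_scope.
Local Open Scope ring_scope.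

(* With [s = |x|^2], take the conformally flat metric [g = V(s) e] where
   [V(s) = 1 - a \sum_(n < N) 2^-n exp (2^n (s - 1))], and [k = - d g],
   [psi0 = 0].  Since [V', V'' <= 0] and [0 < V] on the ball, [R[g] >= 0], so
   [psi1 = sqrt (R[g] + 6 d^2)] is smooth and solves the Hamiltonian constraint;
   the momentum constraint holds because [k] is a constant multiple of [g].
   The sphere [s = 1 - 2^-N] is totally geodesic, hence trapped, as soon as
   [V + s V' = 0] there; each of the [N] exponentials contributes an amount of
   order 1 to [V'], so this happens for some [a] of order [1 / N].

   The exponential at scale [2^n] extends from the ball to a compactly supported
   function whose Fourier transform is [O(2^n / ((1 + r^2) (4^n + r^2)))], and
   the sum over [n < N] is [O(1 / ((1 + r^2) (1 + r) (1 + r / 2^N)))].  Every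
   dyadic shell of frequencies below [2^N] therefore contributes [O(a^2)] to the
   square of the [H^(3/2)] norm of [g - e], which is [O(a sqrt N) = O(N^(-1/2))].
   Finally [d] is chosen small enough for [k].

   The Fourier transform of [h (|x|^2)] is computed by slicing: if [H' = h] and
   [H] vanishes at infinity, the integral of [h (|x|^2)] over a plane at distance
   [t] from the origin is [- pi H (t^2)], which leaves a cosine integral in one
   variable, estimated by integrating by parts four times. *)

(** * Integrals over affine planes *)

(** Why the critical exponent allows this: the two traces on a sphere see only [V] and [V'] there,
    so they need the restriction to a surface of a function in [H^(1/2)]. The trace theorem just
    fails at that exponent, and only logarithmically. Pieces at dyadically separated scales are
    almost orthogonal in [H^(3/2)], so [N] pieces of unit size have norm [sqrt N], whereas their
    radial derivatives near the unit sphere share one sign and add up to order [N].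

    Exponentials are used because [V] then decreases and is concave. All terms of [R[g]] get the
    same sign, and the constraints are solved by an explicit [psi1] without any elliptic equation.
    The same positivity makes the integral of the absolute value of a derivative a difference of
    boundary values in the Fourier estimates.

    The small [k] has two uses: it pushes both traces from [0] to [- 2 d], and its contribution
    [6 d^2] keeps the radicand of [psi1] positive.

    The continuation outside the ball is only once differentiable. That is enough: the antiprofile
    at [t^2] first jumps in its third derivative, which yields the needed tail [O(2^n / r^4)]. *)

Lemma measurable_fst_fst d1 d2 d3 (X : measurableType d1) (Y : measurableType d2)
    (Z : measurableType d3) : measurable_fun setT (fun x : (X * Y) * Z => x.1.1).
Proof. exact: (@measurableT_comp _ _ _ _ _ _ fst). Qed.

Lemma measurable_snd_fst d1 d2 d3 (X : measurableType d1) (Y : measurableType d2)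
    (Z : measurableType d3) : measurable_fun setT (fun x : (X * Y) * Z => x.1.2).
Proof. exact: (@measurableT_comp _ _ _ _ _ _ snd). Qed.

Ltac meas := repeat (first [ by [] | exact: measurable_snd | exact: measurable_fst
  | exact: measurable_fst_fst | exact: measurable_snd_fst
  | exact: measurable_cst | exact: measurable_id | apply: measurable_funX
  | apply: measurable_funB | apply: measurable_funD | apply: measurable_funM ]).

Section Affine.
Context {R : realType}.
Notation leb := (@lebesgue_measure R).

Lemma measurable_affine (a b : R) :
  measurable_fun setT ((fun x => a * x + b) : measurableTypeR R -> measurableTypeR R).
Proof.
apply: measurable_funD; last exact: measurable_cst.
exact: measurable_funM (measurable_cst _) (@measurable_id _ _ _).
Qed.

(** Lebesgue measure is determined by its values on half-open intervals, so the scaled pushforward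
    is compared with it there. A negative [a] moves the open end to the right, whence the two
    cases. *)
Lemma lebesgue_measure_affine (a b : R) (A : set R) : a != 0 -> measurable A ->
  leb A = (`|a|%:E * leb ((fun x => a * x + b)%R @^-1` A))%E.
Proof.
move=> a0 mA.
pose phi : measurableTypeR R -> measurableTypeR R := (fun x => a * x + b)%R.
pose mphi := measurable_affine a b.
pose phi' : {mfun measurableTypeR R >-> measurableTypeR R} :=
  HB.pack phi (isMeasurableFun.Build _ _ _ _ _ mphi).
pose m : {measure set (measurableTypeR R) -> \bar R} :=
  mscale (NngNum (normr_ge0 a)) (pushforward leb phi').
rewrite (@lebesgue_measure_unique _ (m mphi))//= => _ [[u v]] _ <-.
rewrite /m /mscale /= /pushforward.
have [ap|an|] := ltgtP a 0; last by move/eqP; rewrite (negbTE a0).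
- have -> : phi @^-1` `]u, v]%classic = `[(v - b) / a, (u - b) / a[%classic.
    apply/seteqP; split => x /=; rewrite !in_itv/= /phi ler_ndivrMr// ltr_ndivlMr//;
    rewrite -ltrBlDr -lerBrDr ![_ * x]mulrC => /andP[? ?]; apply/andP; split; lra.
  rewrite !lebesgue_measure_itv/= !lte_fin ltr_nM2r ?invr_lt0//.
  rewrite ltrD2r; case: ifP => // _; last by rewrite mule0.
  rewrite -!EFinB -EFinM; congr _%:E; rewrite ltr0_norm//; field => //.
- have -> : phi @^-1` `]u, v]%classic = `](u - b) / a, (v - b) / a]%classic.
    apply/seteqP; split => x /=; rewrite !in_itv/= /phi ler_pdivlMr// ltr_pdivrMr//;
    rewrite -ltrBlDr -lerBrDr ![_ * x]mulrC => /andP[? ?]; apply/andP; split; lra.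
  rewrite !lebesgue_measure_itv/= !lte_fin ltr_pM2r ?invr_gt0//.
  rewrite ltrD2r; case: ifP => // _; last by rewrite mule0.
  rewrite -!EFinB -EFinM; congr _%:E; rewrite gtr0_norm//; field => //.
Qed.

Lemma ge0_integral_affine (a b : R) (f : R -> \bar R) : a != 0 ->
  measurable_fun setT f -> (forall x, (0 <= f x)%E) ->
  (\int[leb]_x f x = `|a|%:E * \int[leb]_x f (a * x + b)%R)%E.
Proof.
move=> a0 mf f0.
pose phi : measurableTypeR R -> measurableTypeR R := (fun x => a * x + b)%R.
pose mphi := measurable_affine a b.
pose phi' : {mfun measurableTypeR R >-> measurableTypeR R} :=
  HB.pack phi (isMeasurableFun.Build _ _ _ _ _ mphi).
pose m : {measure set (measurableTypeR R) -> \bar R} := pushforward leb phi'.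
have <- : (\int[pushforward leb phi]_y f y = \int[leb]_x f (a * x + b)%R)%E.
  by rewrite ge0_integral_pushforward// => y _; exact: f0.
rewrite -(@ge0_integral_mscale _ _ _ (m mphi) _ _ (NngNum (normr_ge0 a)))//.
by apply: eq_measure_integral => A mA _; exact: lebesgue_measure_affine.
Qed.

End Affine.

(* The instance of sigma-finiteness of product measures in the library is only
   found for subprobabilities, whence this alias. *)
Definition leb2 {R : realType} :
    set (measurableTypeR R * measurableTypeR R) -> \bar R :=
  (@lebesgue_measure R \x @lebesgue_measure R)%E.

HB.instance Definition _ (R : realType) := Measure.on (@leb2 R).

Lemma sigma_finite_leb2 (R : realType) : sigma_finite setT (@leb2 R).
Proof.
pose I n : set (measurableTypeR R) := `[- n%:R, n%:R]%classic.
have mI n : measurable (I n) by exact: measurable_itv.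
exists (fun n => I n `*` I n).
  apply/esym; rewrite -subTset => -[x y] _.
  exists (Num.truncn (`|x| + `|y|)).+1 => //=.
  have b : `|x| + `|y| <= (Num.truncn (`|x| + `|y|)).+1%:R by rewrite ltW// truncnS_gt.
  by split; rewrite /I /= in_itv/= -ler_norml; apply: le_trans b; rewrite ?lerDl ?lerDr.
move=> n; split; first exact: measurableX.
rewrite /leb2 [X in (X < _)%E](@product_measure1E _ _ (measurableTypeR R) (measurableTypeR R))//.
rewrite lte_mul_pinfty//= ?lebesgue_measure_itv ?fin_numE//=.
  by case: ifP => //=; rewrite -EFinD.
by case: ifP => //=; rewrite -EFinD ltry.
Qed.

HB.instance Definition _ (R : realType) :=
  @Measure_isSigmaFinite.Build _ _ _ (@leb2 R) (@sigma_finite_leb2 R).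

Section Plane.
Context {R : realType}.
Notation leb := (@lebesgue_measure R).
Implicit Types (h H : R -> R).

Lemma continuous_comp_quad (h : R -> R) (m c : R) : continuous h ->
  continuous (fun x : R => h (m + c * x ^+ 2)).
Proof.
move=> hc x; apply: (@continuous_comp R R R (fun x : R => m + c * x ^+ 2) h); last exact: hc.
apply: cvgD; first exact: cvg_cst.
apply: cvgM; first exact: cvg_cst.
exact: exprn_continuous.
Qed.

Lemma is_derive_comp_quad H (h : R -> R) (m c x : R) :
  (forall s : R, is_derive s 1 H (h s)) ->
  is_derive x 1 (fun x => H (m + c * x ^+ 2)) (2 * c * x * h (m + c * x ^+ 2)).
Proof.
move=> dH.
have d1 : is_derive x 1 (fun x : R => m + c * x ^+ 2) (2 * c * x).
  apply: is_derive_eq; rewrite /GRing.scale /=; ring.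
have := @is_derive1_comp R H (fun x : R => m + c * x ^+ 2) x _ _ (dH _) d1.
rewrite mulrC; apply.
Qed.

Lemma integral_radial_line h H (m c : R) : 0 < c ->
  (forall s, 0 <= h s) -> continuous h -> (forall s : R, is_derive s 1 H (h s)) ->
  (forall s, 4 <= s -> H s = 0) ->
  (\int[leb]_x (`|x| * h (m + c * x ^+ 2))%:E = (- H m / c)%:E)%E.
Proof.
move=> c0 h0 hc dH H0.
have chq := @continuous_comp_quad _ m c hc.
rewrite ge0_symfun_integralT; first last.
- by move=> x /=; rewrite normrN sqrrN.
- by move=> x; apply: cvgM; [exact: norm_continuous|exact: chq].
- by move=> x; rewrite mulr_ge0.
have -> : [set x : R | 0 <= x] = `[0, +oo[%classic.
  by apply/seteqP; split => x /=; rewrite in_itv/= andbT.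
have dF x := @is_derive_comp_quad _ _ m c x dH.
under eq_integral => x xpos.
  have -> : `|x| * h (m + c * x ^+ 2) = x * h (m + c * x ^+ 2).
    by move: xpos; rewrite inE/= in_itv/= andbT => /ger0_norm ->.
  over.
rewrite (@ge0_continuous_FTC2y _ _ (fun x => (2 * c)^-1 * H (m + c * x ^+ 2)) 0 0).
- rewrite /= expr0n/= mulr0 addr0 -EFinB -EFinM; congr _%:E; field; lra.
- by move=> x x0; rewrite mulr_ge0.
- apply: continuous_subspaceT => x; apply: cvgM; [exact: cvg_id|exact: chq].
- apply/cvgrPdist_lt => e e0; near=> x.
  rewrite H0 ?mulr0 ?subrr ?normr0//.
  have x1 : 1 <= x by near: x; exact: nbhs_pinfty_ge.
  have x2 : (4 + `|m|) / c <= x by near: x; apply: nbhs_pinfty_ge; rewrite num_real.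
  have : 4 + `|m| <= c * x by rewrite mulrC -ler_pdivrMr.
  have : - m <= `|m| by rewrite -normrN ler_norm.
  have : c * x <= c * x ^+ 2 by rewrite ler_pM2l// expr2 ler_peMl//; lra.
  lra.
- by move=> x _; apply: derivableM => //; exact: (@ex_derive _ _ _ _ _ _ _ (dF x)).
- apply: cvg_at_right_filter; apply: cvgM; first exact: cvg_cst.
  apply: differentiable_continuous; apply/derivable1_diffP.
  exact: (@ex_derive _ _ _ _ _ _ _ (dF 0)).
- move=> x _; rewrite derive1E.
  have := dF x => dFx.
  rewrite derive_val /GRing.scale/=; field; lra.
Unshelve. all: by end_near. Qed.

Lemma integral_inv_quad (k b : R) : 0 < k -> 0 < b ->
  (\int[leb]_x ((k + b * x ^+ 2)^-1)%:E = (pi / Num.sqrt (k * b))%:E)%E.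
Proof.
move=> k0 b0.
have den x : 0 < k + b * x ^+ 2 by rewrite ltr_pwDl// mulr_ge0 ?sqr_ge0// ltW.
have cden : continuous (fun x : R => (k + b * x ^+ 2)^-1).
  move=> x; apply: cvgV; first by rewrite gt_eqF.
  by apply: cvgD; [exact: cvg_cst|apply: cvgM; [exact: cvg_cst|exact: exprn_continuous]].
rewrite ge0_symfun_integralT//; first last.
- by move=> x /=; rewrite sqrrN.
- by move=> x; rewrite invr_ge0 ltW.
have -> : [set x : R | 0 <= x] = `[0, +oo[%classic.
  by apply/seteqP; split => x /=; rewrite in_itv/= andbT.
(* The primitive is [atan (q x) / (k q)], and [k q = sqrt (k b)]. *)
set q := Num.sqrt (b / k).
have q0 : 0 < q by rewrite sqrtr_gt0 divr_gt0.
have q2 : q ^+ 2 = b / k by rewrite sqr_sqrtr// divr_ge0// ltW.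
have kb : Num.sqrt (k * b) = k * q.
  have -> : k * b = k ^+ 2 * (b / k) by field; lra.
  by rewrite sqrtrM ?sqr_ge0// sqrtr_sqr gtr0_norm.
have dF (x : R) : is_derive x 1 (fun x : R => (k * q)^-1 * atan (q * x)) ((k + b * x ^+ 2)^-1).
  have d1 : is_derive x 1 (fun x : R => q * x) q.
    by apply: is_derive_eq; rewrite /GRing.scale/=; ring.
  have d2 := @is_derive1_comp R (@atan R) _ x _ _ (is_derive1_atan _) d1.
  have d3 : is_derive x 1 (fun x : R => (k * q)^-1 * atan (q * x))
      ((k * q)^-1 * ((1 + (q * x) ^+ 2)^-1 * q)).
    by have := is_deriveZ (k * q)^-1 d2.
  apply: (@is_derive_eq _ _ _ _ _ _ _ _ d3).
  rewrite exprMn q2; have := den x => dx; field.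
  have : k * (1 + b / k * x ^+ 2) = k + b * x ^+ 2 by field; lra.
  move=> E; apply/and3P; split; try lra.
rewrite (@ge0_continuous_FTC2y _ _ (fun x => (k * q)^-1 * atan (q * x)) 0 ((k * q)^-1 * (pi / 2))).
- rewrite mulr0 atan0 mulr0 kb -EFinB -EFinM; congr _%:E; field; lra.
- by move=> x _; rewrite invr_ge0 ltW.
- exact: continuous_subspaceT.
- apply: cvgM; first exact: cvg_cst.
  apply: (@cvg_comp _ _ _ (fun x => q * x) (@atan R) _ (+oo%R)); last exact: cvgy_atan.
  exact: gt0_cvgMry.
- by move=> x _; exact: (@ex_derive _ _ _ _ _ _ _ (dF x)).
- apply: cvg_at_right_filter.
  apply: (@differentiable_continuous R R R (0 : R) (fun x => (k * q)^-1 * atan (q * x))).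
  apply/derivable1_diffP.
  exact: (@ex_derive _ _ _ _ _ _ _ (dF 0)).
- by move=> x _; rewrite derive1E; have := dF x => dFx; rewrite derive_val.
Qed.

End Plane.

Section Slice.
Context {R : realType}.
Notation mR := (measurableTypeR R).
Notation leb := (@lebesgue_measure R).
Variables (h H : R -> R).
Hypothesis h0 : forall s, 0 <= h s.
Hypothesis hc : continuous h.
Hypothesis dH : forall s : R, is_derive s 1 H (h s).
Hypothesis H4 : forall s, 4 <= s -> H s = 0.

Let mh : measurable_fun setT h := continuous_measurable_fun hc.

Let cH : continuous H.
Proof.
move=> x; apply: (@differentiable_continuous R R R x H); apply/derivable1_diffP.
exact: (@ex_derive _ _ _ _ _ _ _ (dH x)).
Qed.

Let mH : measurable_fun setT H := continuous_measurable_fun cH.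

Lemma profile_antideriv_le0 s : H s <= 0.
Proof.
have [s4|s4] := leP 4 s; first by rewrite H4.
have [c _] := MVT s4 (fun x _ => dH x) (continuous_subspaceT cH).
rewrite H4// sub0r => E.
by rewrite -oppr_ge0 E mulr_ge0// subr_ge0 ltW.
Qed.

Lemma plane_integral (m k b : R) : 0 < k -> 0 < b ->
  (\int[leb]_x \int[leb]_y (h (m + k * x ^+ 2 + b * y ^+ 2))%:E =
   (- H m * (pi / Num.sqrt (k * b)))%:E)%E.
Proof.
move=> k0 b0.
pose G (z : mR * mR) := (`|z.1| * h (m + (k + b * z.2 ^+ 2) * z.1 ^+ 2))%:E.
(* The slope substitution [y = u x] plays the role of polar coordinates. *)
have mG : measurable_fun setT G.
  apply/measurable_EFinP; apply: measurable_funM.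
    by apply: measurableT_comp; [exact: normr_measurable|exact: measurable_fst].
  apply: measurableT_comp => //.
  by meas.
have G0 z : (0 <= G z)%E by rewrite lee_fin mulr_ge0.
transitivity (\int[leb]_x \int[leb]_y G (x, y))%E.
  apply: ge0_ae_eq_integral => //.
  - have := @measurable_fun_fubini_tonelli_F _ _ mR mR R leb
      (fun z => (h (m + k * z.1 ^+ 2 + b * z.2 ^+ 2))%:E).
    apply => [|z]; last by rewrite lee_fin.
    apply/measurable_EFinP; apply: measurableT_comp => //.
    by meas.
  - exact: (@measurable_fun_fubini_tonelli_F _ _ mR mR R leb G mG).
  - by move=> x _; apply: integral_ge0 => y _; rewrite lee_fin.
  - by move=> x _; apply: integral_ge0.
  (* The substitution degenerates only on the line [x = 0], which is null. *)
  - exists [set 0]; split; [exact: measurable_set1|exact: lebesgue_measure_set1|].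
    move=> x /= nx; apply: contrapT => x0; apply: nx => _.
    have {}x0 : x != 0 by apply/eqP.
    rewrite (@ge0_integral_affine _ x 0)//=; first last.
    - by move=> y; rewrite lee_fin.
    - apply/measurable_EFinP; apply: measurableT_comp => //.
      by meas.
    rewrite -ge0_integralZl_EFin//; first last.
    - apply/measurable_EFinP; apply: measurableT_comp => //.
      by meas.
    - by move=> y _; rewrite lee_fin.
    apply: eq_integral => y _; rewrite /G/= -EFinM; congr (_ * h _)%:E; ring.
rewrite (fubini_tonelli G)//.
have cpos (y : R) : 0 < k + b * y ^+ 2 by rewrite ltr_pwDl// mulr_ge0 ?sqr_ge0// ltW.
(* From here [y] is the slope: the integral in [x] is [integral_radial_line] with [c = k + b y^2],
   and what remains is an arctangent integral. *)
under eq_integral => y _.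
  rewrite (@integral_radial_line _ h H m _ (cpos y))// EFinM.
  over.
rewrite /= ge0_integralZl_EFin//.
- by rewrite integral_inv_quad.
- by move=> x _; rewrite lee_fin invr_ge0 ltW.
- apply/measurable_EFinP; apply: continuous_measurable_fun => x.
  apply: cvgV; first by rewrite gt_eqF.
  by apply: cvgD; [exact: cvg_cst|apply: cvgM; [exact: cvg_cst|exact: exprn_continuous]].
- by rewrite oppr_ge0 profile_antideriv_le0.
Qed.

(** Completing the square in [y], then in [x], brings the quadratic form to the shape of
    [plane_integral]. Its minimum [p^2 / (1 + a^2 + b^2)] is the squared distance from the origin to
    the plane [a x + b y + z = p]. *)
Lemma plane_integral_shift (p a b : R) :
  (\int[leb]_x \int[leb]_y (h (x ^+ 2 + y ^+ 2 + (p - a * x - b * y) ^+ 2))%:E =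
   (- H (p ^+ 2 / (1 + a ^+ 2 + b ^+ 2)) * (pi / Num.sqrt (1 + a ^+ 2 + b ^+ 2)))%:E)%E.
Proof.
pose be := 1 + b ^+ 2; pose D := 1 + a ^+ 2 + b ^+ 2.
have be0 : 0 < be by rewrite ltr_pwDl// sqr_ge0.
have D0 : 0 < D by rewrite ltr_pwDl ?sqr_ge0// ltr_pwDl// sqr_ge0.
transitivity (\int[leb]_x \int[leb]_y
    (h (x ^+ 2 + (p - a * x) ^+ 2 / be + be * y ^+ 2))%:E)%E.
  apply: eq_integral => x _.
  rewrite (@ge0_integral_affine _ 1 (b * (p - a * x) / be))//; first last.
  - by move=> y; rewrite lee_fin.
  - apply/measurable_EFinP; apply: measurableT_comp => //.
    by meas.
  rewrite normr1 mul1e; apply: eq_integral => y _; congr (h _)%:E.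
  rewrite /be in be0 *; field; lra.
rewrite (@ge0_integral_affine _ 1 (a * p / D))//; first last.
- by move=> x; apply: integral_ge0 => y _; rewrite lee_fin.
- have := @measurable_fun_fubini_tonelli_F _ _ mR mR R leb
      (fun z => (h (z.1 ^+ 2 + (p - a * z.1) ^+ 2 / be + be * z.2 ^+ 2))%:E).
  apply => [|z]; last by rewrite lee_fin.
  apply/measurable_EFinP; apply: measurableT_comp => //.
  by meas.
rewrite normr1 mul1e.
under eq_integral => x _.
  under eq_integral => y _.
    rewrite (_ : _ + be * _ = p ^+ 2 / D + (D / be) * x ^+ 2 + be * y ^+ 2); last first.
      rewrite /D /be in be0 D0 *; field; lra.
    over.
  over.
rewrite plane_integral//; last by rewrite divr_gt0.
by rewrite divfK// gt_eqF.
Qed.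

Notation mu2 := (@leb2 R).

(* The substitution [z = (p - a x - b y) / c] turns the plane wave into a
   function of the single variable [p]. *)
Lemma slice_integral (phi : R -> R) (a b c : R) : c != 0 ->
  measurable_fun setT phi -> (forall t, 0 <= phi t) ->
  (\int[@mu3 R]_x (h (dot3 x x) * phi (a * x.1.1 + b * x.1.2 + c * x.2)%R)%:E =
   \int[leb]_t (pi * - H (t ^+ 2) * phi (Num.sqrt (a ^+ 2 + b ^+ 2 + c ^+ 2) * t)%R)%:E)%E.
Proof.
move=> c0 mphi phi0.
set rho := Num.sqrt _.
have r20 : 0 < a ^+ 2 + b ^+ 2 + c ^+ 2.
  by rewrite ltr_wpDl ?addr_ge0 ?sqr_ge0// lt0r sqrf_eq0 c0 sqr_ge0.
have rho0 : 0 < rho by rewrite sqrtr_gt0.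
have rho2 : rho ^+ 2 = a ^+ 2 + b ^+ 2 + c ^+ 2 by rewrite sqr_sqrtr// ltW.
have dotE (x : R3 R) : dot3 x x = x.1.1 ^+ 2 + x.1.2 ^+ 2 + x.2 ^+ 2.
  by rewrite /dot3 /dot !big_ord_recl big_ord0 /row3 !mxE/= addr0 addrA.
pose q (w : mR * mR) (p : mR) :=
  w.1 ^+ 2 + w.2 ^+ 2 + (p / c - a / c * w.1 - b / c * w.2) ^+ 2.
pose f (x : R3 R) :=
  (h (x.1.1 ^+ 2 + x.1.2 ^+ 2 + x.2 ^+ 2) * phi (a * x.1.1 + b * x.1.2 + c * x.2))%:E.
pose g (x : (mR * mR) * mR) := (h (q x.1 x.2) * phi x.2)%:E.
have mf : measurable_fun setT f.
  by apply/measurable_EFinP; apply: measurable_funM; apply: measurableT_comp => //; meas.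
have mg : measurable_fun setT g.
  apply/measurable_EFinP; apply: measurable_funM; last exact: measurableT_comp.
  by apply: measurableT_comp => //; meas.
have f0 x : (0 <= f x)%E by rewrite lee_fin mulr_ge0.
have g0 x : (0 <= g x)%E by rewrite lee_fin mulr_ge0.
transitivity (\int[@mu3 R]_x f x)%E.
  by apply: eq_integral => x _; rewrite dotE.
rewrite (@fubini_tonelli1 _ _ (mR * mR)%type mR R mu2 leb f mf f0).
transitivity (`|c^-1|%:E * \int[mu2]_w \int[leb]_p g (w, p))%E.
  rewrite -ge0_integralZl_EFin//; first last.
  - exact: (@measurable_fun_fubini_tonelli_F _ _ _ mR R leb g mg).
  - by move=> w _; apply: integral_ge0.
  apply: eq_integral => w _.
  rewrite /fubini_F [LHS](@ge0_integral_affine _ c^-1 (- (a * w.1 + b * w.2) / c)) ?invr_eq0//; last first.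
    exact: measurable_fun_pair2.
  congr (_ * _)%E; apply: eq_integral => p _; rewrite /f /g /q/=.
  congr (h _ * phi _)%:E; field; lra.
rewrite (fubini_tonelli g)//.
transitivity (`|c^-1|%:E * \int[leb]_p
    (pi * `|c| / rho * - H ((p / rho) ^+ 2) * phi p)%:E)%E.
  congr (_ * _)%E; apply: eq_integral => p _.
  pose hq (w : mR * mR) := (h (q w p))%:E.
  have mhq : measurable_fun setT hq.
    apply/measurable_EFinP.
    by apply: measurableT_comp => //; meas.
  transitivity ((phi p)%:E * \int[mu2]_w hq w)%E.
    rewrite -ge0_integralZl_EFin//; last by move=> w _; rewrite lee_fin.
    by apply: eq_integral => w _; rewrite /hq /g/= -EFinM mulrC.
  rewrite (@fubini_tonelli1 _ _ mR mR R leb leb hq mhq); last by move=> w; rewrite lee_fin.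
  rewrite /fubini_F /hq /q/= plane_integral_shift -EFinM; congr _%:E.
  (* The plane [a x + b y + c z = p] lies at distance [|p| / rho] from the origin. *)
  have DE : 1 + (a / c) ^+ 2 + (b / c) ^+ 2 = (rho / c) ^+ 2.
    by rewrite [RHS]exprMn rho2; field.
  rewrite DE sqrtr_sqr normrM (gtr0_norm rho0) normfV.
  have -> : (p / c) ^+ 2 / (rho / c) ^+ 2 = (p / rho) ^+ 2 by field; lra.
  rewrite invfM invrK; ring.
rewrite -ge0_integralZl_EFin//; first last.
- apply/measurable_EFinP; apply: measurable_funM => //; apply: measurable_funM => //.
  by apply: measurableT_comp => //; apply: measurableT_comp => //; meas.
- move=> p _; rewrite lee_fin !mulr_ge0 ?pi_ge0 ?invr_ge0 ?(ltW rho0)//.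
  by rewrite oppr_ge0 profile_antideriv_le0.
(* Setting [p = rho t] makes the signed distance to the origin the variable and cancels the
   remaining [1 / rho]. *)
rewrite [LHS](@ge0_integral_affine _ rho 0) ?gt_eqF//; first last.
- move=> p; rewrite -EFinM lee_fin !mulr_ge0 ?pi_ge0 ?invr_ge0 ?(ltW rho0)//.
  by rewrite oppr_ge0 profile_antideriv_le0.
- under eq_fun do rewrite -EFinM.
  apply/measurable_EFinP; apply: measurable_funM => //; apply: measurable_funM => //.
  apply: measurable_funM => //.
  by apply: measurableT_comp => //; apply: measurableT_comp => //; meas.
rewrite -ge0_integralZl_EFin//; first last.
- under eq_fun do rewrite -EFinM.
  apply/measurable_EFinP; apply: measurable_funM => //; apply: measurable_funM => //; last first.
    by apply: measurableT_comp => //; exact: measurable_affine.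
  apply: measurable_funM => //.
  by apply: measurableT_comp => //; apply: measurableT_comp => //; meas.
- move=> p _; rewrite -EFinM lee_fin !mulr_ge0 ?pi_ge0 ?invr_ge0 ?(ltW rho0)//.
  by rewrite oppr_ge0 profile_antideriv_le0.
apply: eq_integral => t _; rewrite -!EFinM addr0 (mulrC rho t) mulfK ?gt_eqF//.
congr _%:E; rewrite normfV gtr0_norm//.
have : `|c| != 0 by rewrite normr_eq0.
move=> cn0; field; apply/andP; split => //; exact: lt0r_neq0.
Qed.

End Slice.

(** * Smooth functions *)

Section Chain.
Context {R : realType} {V : normedModType R}.

(** Restricting to a line turns directional derivatives into ordinary ones, to which the
    one-variable chain rule applies. *)
Lemma is_derive_lineP (W : normedModType R) (f : V -> W) (x v : V) (d : W) :
  is_derive x v f d <-> is_derive (0 : R) 1 (fun t : R => f (t *: v + x)) d.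
Proof.
have E : 'D_v f x = 'D_1 (fun t : R => f (t *: v + x)) 0.
  rewrite /derive; congr (lim (_ @ 0^')); apply/funext => t /=.
  by rewrite addr0 scale0r add0r [_%:A]mulr1.
split=> -[df dE]; split.
- exact: (derivable1P f x v).1.
- by rewrite -E.
- exact: (derivable1P f x v).2.
- by rewrite E.
Qed.

Lemma is_derive_comp1 (phi : R -> R) (f : V -> R) (x v : V) (df dphi : R) :
  is_derive x v f df -> is_derive (f x) 1 phi dphi ->
  is_derive x v (fun y => phi (f y)) (dphi * df).
Proof.
move=> dfx dp; have df1 := (is_derive_lineP f x v df).1 dfx.
have fx0 : f (0 *: v + x) = f x by rewrite scale0r add0r.
have dp' : is_derive (f ((0 : R) *: v + x)) 1 phi dphi by rewrite fx0.
have d1 := @is_derive1_comp R phi (fun t : R => f (t *: v + x)) 0 dphi df dp' df1.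
have E : 'D_v (fun y => phi (f y)) x = 'D_1 (fun t : R => phi (f (t *: v + x))) 0.
  rewrite /derive; congr (lim (_ @ 0^')); apply/funext => t /=.
  by rewrite addr0 scale0r add0r [_%:A]mulr1.
split; first by apply: (derivable1P _ x v).2; exact: (@ex_derive _ _ _ _ _ _ _ d1).
by rewrite E; exact: (@derive_val _ _ _ _ _ _ _ d1).
Qed.

End Chain.

Section Smooth.
Context {R : realType} {V : normedModType R}.
Variable U : set V.
Hypothesis oU : open U.

Lemma open_near_eq (W : normedModType R) (f g : V -> W) (x : V) :
  (forall y, U y -> f y = g y) -> U x -> \forall y \near x, f y = g y.
Proof.
move=> fg Ux; have : nbhs x U by exact: open_nbhs_nbhs.
exact: filterS.
Qed.

(* A class of real functions whose members are continuous and derivable in every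
   direction on [U], and which is stable under derivation. *)
Inductive elementary : (V -> R) -> Prop :=
| elem_cst c : elementary (fun _ => c)
| elem_lin (l : V -> R) : continuous l -> (forall x v, is_derive x v l (l v)) ->
    elementary l
| elem_add f g : elementary f -> elementary g -> elementary (fun x => f x + g x)
| elem_mul f g : elementary f -> elementary g -> elementary (fun x => f x * g x)
| elem_exp f : elementary f -> elementary (fun x => expR (f x))
| elem_inv f : elementary f -> (forall x, U x -> f x != 0) ->
    elementary (fun x => (f x)^-1)
| elem_sqrt f : elementary f -> (forall x, U x -> 0 < f x) ->
    elementary (fun x => Num.sqrt (f x))
| elem_ext f g : elementary f -> (forall x, U x -> f x = g x) -> elementary g.

Lemma elementary_continuous f : elementary f ->
  forall x, U x -> {for x, continuous f}.
Proof.
elim=> {f}.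
- by move=> c x _; exact: cvg_cst.
- by move=> l cl _ x _; exact: cl.
- by move=> f g _ cf _ cg x Ux; exact: cvgD (cf _ Ux) (cg _ Ux).
- by move=> f g _ cf _ cg x Ux; exact: cvgM (cf _ Ux) (cg _ Ux).
- move=> f _ cf x Ux; apply: (@continuous_comp _ _ _ f expR); first exact: cf.
  exact: continuous_expR.
- by move=> f _ cf f0 x Ux; exact: cvgV (f0 _ Ux) (cf _ Ux).
- move=> f _ cf f0 x Ux; apply: (@continuous_comp _ _ _ f Num.sqrt); first exact: cf.
  exact: sqrt_continuous.
- move=> f g _ cf fg x Ux; rewrite /prop_for /continuous_at -(fg _ Ux).
  apply: cvg_trans (cf x Ux); apply: near_eq_cvg.
  exact: open_near_eq.
Qed.

Lemma elementary_derive f : elementary f -> forall v,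
  exists2 df, elementary df & forall x, U x -> is_derive x v f (df x).
Proof.
elim=> {f}.
- move=> c v; exists (fun _ => 0); first exact: elem_cst.
  by move=> x _; exact: is_derive_cst.
- by move=> l cl dl v; exists (fun _ => l v); [exact: elem_cst|move=> x _; exact: dl].
- move=> f g _ Hf _ Hg v.
  have [df edf dfE] := Hf v; have [dg edg dgE] := Hg v.
  exists (fun x => df x + dg x); first exact: elem_add.
  by move=> x Ux; exact: is_deriveD (dfE _ Ux) (dgE _ Ux).
- move=> f g ef Hf eg Hg v.
  have [df edf dfE] := Hf v; have [dg edg dgE] := Hg v.
  exists (fun x => f x * dg x + g x * df x); first by apply: elem_add; exact: elem_mul.
  by move=> x Ux; exact: is_deriveM (dfE _ Ux) (dgE _ Ux).
- move=> f ef Hf v; have [df edf dfE] := Hf v.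
  exists (fun x => expR (f x) * df x); first by apply: elem_mul => //; exact: elem_exp.
  by move=> x Ux; exact: is_derive_comp1 (dfE _ Ux) (is_derive_expR _).
- move=> f ef Hf f0 v; have [df edf dfE] := Hf v.
  exists (fun x => (-1) * ((f x)^-1 * (f x)^-1) * df x).
    apply: elem_mul => //; apply: elem_mul; first exact: elem_cst.
    by apply: elem_mul; exact: elem_inv.
  move=> x Ux; have dx := dfE _ Ux.
  split; first by apply: derivableV; [exact: f0|exact: (@ex_derive _ _ _ _ _ _ _ dx)].
  have [dfx dxE] := dx.
  rewrite (deriveV (f0 _ Ux) dfx).
  by rewrite dxE -exprVn expr2 mulN1r.
- move=> f ef Hf f0 v; have [df edf dfE] := Hf v.
  exists (fun x => (2 * Num.sqrt (f x))^-1 * df x).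
    apply: elem_mul => //; apply: elem_inv.
      by apply: elem_mul; [exact: elem_cst|exact: elem_sqrt].
    by move=> x Ux; rewrite mulf_neq0// gt_eqF// sqrtr_gt0 f0.
  by move=> x Ux; exact: is_derive_comp1 (dfE _ Ux) (is_derive1_sqrt (f0 _ Ux)).
- move=> f g _ Hf fg v; have [df edf dfE] := Hf v.
  exists df => // x Ux; apply: near_eq_is_derive (dfE _ Ux).
  exact: open_near_eq.
Qed.

(** Agreement on [U] alone survives derivation because [U] is open and a derivative depends only on
    the germ. *)
Lemma elementary_iter_derive f (vs : seq V) : elementary f ->
  exists2 g, elementary g & forall x, U x -> iter_derive vs f x = g x.
Proof.
elim: vs => [|v vs IH] ef /=; first by exists f.
have [g eg fg] := IH ef.
have [dg edg dgE] := elementary_derive eg v.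
exists dg => // x Ux.
rewrite (@near_eq_derive _ _ _ _ g); last exact: open_near_eq.
exact: (@derive_val _ _ _ _ _ _ _ (dgE _ Ux)).
Qed.

Lemma elementary_smooth f : elementary f -> smooth_on U f.
Proof.
move=> ef vs x Ux.
have [g eg fg] := elementary_iter_derive vs ef.
have fgx := open_near_eq fg Ux.
split.
  have cg := elementary_continuous eg Ux.
  rewrite /prop_for /continuous_at (fg _ Ux).
  apply: cvg_trans cg; apply: near_eq_cvg.
  by apply: open_near_eq Ux => y Uy; rewrite fg.
move=> v; have [dg _ dgE] := elementary_derive eg v.
apply: (@near_eq_derivable _ _ _ g); last exact: (@ex_derive _ _ _ _ _ _ _ (dgE _ Ux)).
by apply: open_near_eq Ux => y Uy; rewrite fg.
Qed.

Lemma is_derive_scale (W : normedModType R) (f : V -> R) (w : W) (x v : V) (d : R) :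
  is_derive x v f d -> is_derive x v (fun y => f y *: w) (d *: w).
Proof.
move=> [df dE].
have H : h^-1 *: ((f (h *: v + x)) *: w - f x *: w) @[h --> 0^'] --> d *: w.
  rewrite -dE; under eq_fun do rewrite -scalerBl scalerA.
  by apply: cvgZl; exact: df.
by split; [apply/cvg_ex; exists (d *: w)|exact: cvg_lim].
Qed.

(** The tensors below are scalar functions times the identity matrix, so their smoothness reduces to
    that of elementary scalar functions. *)
Lemma smooth_on_scale (W : normedModType R) (f : V -> R) (w : W) :
  smooth_on U f -> smooth_on U (fun y => f y *: w).
Proof.
move=> sf.
have E vs x : U x -> iter_derive vs (fun y => f y *: w) x = iter_derive vs f x *: w.
  elim: vs x => [|v vs IH] x Ux //=.
  rewrite (@near_eq_derive _ _ _ _ (fun y => iter_derive vs f y *: w)); last first.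
    exact: open_near_eq Ux.
  have := is_derive_scale w (derivableP ((sf vs x Ux).2 v)).
  by case.
move=> vs x Ux; have [cf df] := sf vs x Ux.
have near_E : \forall y \near x, iter_derive vs f y *: w = iter_derive vs (fun y => f y *: w) y.
  by apply: open_near_eq Ux => y Uy; rewrite E.
split.
  rewrite /prop_for /continuous_at E//.
  apply: cvg_trans (_ : iter_derive vs f y *: w @[y --> x] --> iter_derive vs f x *: w).
    exact: near_eq_cvg.
  by apply: cvgZl; exact: cf.
move=> v; apply: near_eq_derivable near_E _.
by have [] := is_derive_scale w (derivableP (df v)).
Qed.

Lemma smooth_on_cst (W : normedModType R) (w : W) : smooth_on U (fun _ : V => w).
Proof.
have := @smooth_on_scale W (fun=> 1) w (elementary_smooth (elem_cst 1)).
by under eq_fun do rewrite scale1r.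
Qed.

(** One derivation makes the map constant, hence the dichotomy on [vs]. This serves both the
    embedding of the sphere and its normal field. *)
Lemma smooth_on_homothety (c : R) : smooth_on U (fun x : V => c *: x).
Proof.
have E vs : exists w, iter_derive vs (fun x : V => c *: x) = cst w \/ vs = [::].
  elim: vs => [|v vs [w [E|->]]] /=; first by exists 0; right.
    by exists 0; left; rewrite E; apply/funext => x; rewrite derive_cst.
  exists (c *: v); left; apply/funext => x /=.
  by have [_ ->] := is_deriveZ c (@is_derive_id _ _ x v).
move=> vs x Ux; have [w [->|->]] := E vs.
  by split => [|v]; [exact: cvg_cst|exact: derivable_cst].
split => /= [|v]; first by apply: cvgZr; exact: cvg_id.
by have [] := is_deriveZ c (@is_derive_id _ _ x v).
Qed.

End Smooth.

(** * Conformally flat metrics and centred spheres *)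

Section Conformal.
Context {R : realType}.
Notation E3 := 'rV[R]_3.

Definition kron (i j : 'I_3) : R := (i == j)%:R.

Lemma kronC i j : kron i j = kron j i.
Proof. by rewrite /kron eq_sym. Qed.

Lemma sum_kron (f : 'I_3 -> R) c : \sum_(d < 3) f d * kron d c = f c.
Proof.
rewrite (bigD1 c)//= /kron eqxx mulr1 big1 ?addr0// => d /negbTE ->.
by rewrite mulr0.
Qed.

Lemma sum3 (f : 'I_3 -> R) : \sum_(d < 3) f d = f 0 + f 1 + f 2%:R.
Proof.
rewrite !big_ord_recl big_ord0 addr0 addrA; congr (f _ + f _ + f _);
exact: val_inj.
Qed.

Lemma dotE (u v : E3) : dot u v = u 0 0 * v 0 0 + u 0 1 * v 0 1 + u 0 2%:R * v 0 2%:R.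
Proof. exact: sum3. Qed.

Lemma is_derive_coord (i : 'I_3) (x v : E3) :
  is_derive x v (fun y : E3 => y 0 i) (v 0 i).
Proof.
have H : h^-1 *: (((h *: v + x) 0 i) - x 0 i) @[h --> (0 : R)^'] --> v 0 i.
  apply: cvg_near_cst; near=> h.
  rewrite !mxE addrK /GRing.scale/= mulKf//; near: h; exact: nbhs_dnbhs_neq.
by split; [apply/cvg_ex; exists (v 0 i)|exact: cvg_lim].
Unshelve. all: by end_near. Qed.

Lemma continuous_coord (i : 'I_3) : continuous (fun y : E3 => y 0 i).
Proof. by move=> x; exact: coord_continuous. Qed.

Lemma elementary_coord (U : set E3) i : elementary U (fun y : E3 => y 0 i).
Proof. by apply: elem_lin; [exact: continuous_coord|move=> x v; exact: is_derive_coord]. Qed.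

Lemma elementary_dot (U : set E3) : elementary U (fun y : E3 => dot y y).
Proof.
apply: (@elem_ext _ _ _ (fun y : E3 => y 0 0 * y 0 0 + y 0 1 * y 0 1 + y 0 2%:R * y 0 2%:R)).
  by apply: elem_add; [apply: elem_add|]; apply: elem_mul; exact: elementary_coord.
by move=> x _; rewrite dotE.
Qed.

Lemma is_derive_dot (x v : E3) : is_derive x v (fun y => dot y y) (2 * dot x v).
Proof.
have d i := is_deriveM (is_derive_coord i x v) (is_derive_coord i x v).
have D := is_deriveD (is_deriveD (d 0) (d 1)) (d 2%:R).
have -> : (fun y : E3 => dot y y) = (fun y : E3 => y 0 0 * y 0 0 + y 0 1 * y 0 1 + y 0 2%:R * y 0 2%:R).
  by apply/funext => y; rewrite dotE.
apply: (@is_derive_eq _ _ _ _ _ _ _ _ D).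
by rewrite dotE /GRing.scale/=; ring.
Qed.

Lemma dot_delta (x : E3) i : dot x (delta_mx 0 i) = x 0 i.
Proof.
rewrite /dot -[RHS](sum_kron (fun d => x 0 d)); apply: eq_bigr => d _.
by rewrite !mxE eqxx.
Qed.

Lemma is_derive_radial (phi : R -> R) (d : R) (i : 'I_3) (x : E3) :
  is_derive (dot x x) 1 phi d ->
  is_derive x (delta_mx 0 i : E3) (fun y => phi (dot y y)) (d * (2 * x 0 i)).
Proof.
move=> dphi; rewrite -[in X in _ * X]dot_delta.
exact: is_derive_comp1 (is_derive_dot _ _) dphi.
Qed.

Lemma is_derive_coord_delta (i j : 'I_3) (x : E3) :
  is_derive x (delta_mx 0 j : E3) (fun y => y 0 i) (kron i j).
Proof.
have := is_derive_coord i x (delta_mx 0 j).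
by rewrite mxE eqxx /= /kron.
Qed.

Lemma scalar_mx3E (c : R) (i j : 'I_3) : (c%:M : 'M[R]_3) i j = c * kron i j.
Proof. by rewrite mxE /kron mulr_natr. Qed.

Variables (V V1 V2 : R -> R).
Hypothesis dV : forall s : R, is_derive s 1 V (V1 s).
Hypothesis dV1 : forall s : R, is_derive s 1 V1 (V2 s).

(** The constant [c] lets one definition cover the metric ([c = 1]) and the tensor [k]
    ([c = - de]). *)
Definition radial_metric (c : R) (x : E3) : 'M[R]_3 := (c * V (dot x x))%:M.
Notation g := (radial_metric 1).
Notation F := (fun s => V1 s / V s).
Notation F1 := (fun s => V2 s / V s - (V1 s / V s) ^+ 2).

Lemma partial_radial_metric (c : R) (i a b : 'I_3) (x : E3) :
  partial i (fun y => radial_metric c y a b) x =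
  c * V1 (dot x x) * (2 * x 0 i) * kron a b.
Proof.
have D := is_deriveM (is_derive_radial i (is_deriveZ c (dV (dot x x))))
  (is_derive_cst (kron a b) x (delta_mx 0 i)).
rewrite /partial.
have -> : (fun y : E3 => radial_metric c y a b) =
    (fun y : E3 => (c * V (dot y y)) * kron a b).
  by apply/funext => y; rewrite /radial_metric scalar_mx3E.
rewrite (@derive_val _ _ _ _ _ _ _ D) /GRing.scale/=; ring.
Qed.

Lemma inv_radial_metric (c : R) (x : E3) a b :
  invmx (radial_metric c x) a b = (c * V (dot x x))^-1 * kron a b.
Proof. by rewrite invmx_scalar scalar_mx3E. Qed.

(** The usual formula for [exp (2 phi) e] with [grad phi = F x]: since [dV = 2 V' x], the factor one
    half disappears. *)
Lemma christoffel_radial (a b c : 'I_3) (x : E3) :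
  christoffel g a b c x =
  F (dot x x) * (kron a c * x 0 b + kron a b * x 0 c - kron b c * x 0 a).
Proof.
rewrite /christoffel.
under eq_bigr => d _.
  rewrite !partial_radial_metric inv_radial_metric mulrAC (kronC a d).
  over.
by rewrite sum_kron !mul1r; move: (V _)^-1 => w; field.
Qed.

Lemma is_derive_logderiv s : V s != 0 -> is_derive s 1 F (F1 s).
Proof.
move=> Vs.
have dVi : is_derive s 1 (fun t => (V t)^-1) (- (V s) ^- 2 *: V1 s).
  by split; [exact: derivableV|rewrite deriveV// derive_val].
apply: (@is_derive_eq _ _ _ _ _ _ _ _ (is_deriveM (dV1 s) dVi)).
by rewrite /GRing.scale/=; field.
Qed.

Lemma partial_christoffel (d a b c : 'I_3) (x : E3) : V (dot x x) != 0 ->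
  partial d (christoffel g a b c) x =
  F1 (dot x x) * (2 * x 0 d) * (kron a c * x 0 b + kron a b * x 0 c - kron b c * x 0 a)
  + F (dot x x) * (kron a c * kron b d + kron a b * kron c d - kron b c * kron a d).
Proof.
move=> Vx.
have -> : christoffel g a b c = (fun y => F (dot y y) *
   (kron a c * y 0 b + kron a b * y 0 c - kron b c * y 0 a)).
  by apply/funext => y; exact: christoffel_radial.
have dF := is_derive_radial d (is_derive_logderiv Vx).
have dc i j k := is_deriveZ (kron i j) (is_derive_coord_delta k d x).
have dG : is_derive x (delta_mx 0 d : E3)
    (fun y => kron a c * y 0 b + kron a b * y 0 c - kron b c * y 0 a)
    (kron a c * kron b d + kron a b * kron c d - kron b c * kron a d).
  exact: is_deriveB (is_deriveD (dc a c b) (dc a b c)) (dc b c a).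
have D := is_deriveM dF dG.
rewrite /partial (@derive_val _ _ _ _ _ _ _ D) /GRing.scale/=; ring.
Qed.

(** For [g = exp (2 phi) e] in dimension three, [R = - exp (- 2 phi) (4 Lap phi + 2 |grad phi|^2)].
    Here [grad phi = F x], so [Lap phi = 3 F + 2 s F'] with [s = |x|^2]. *)
Lemma scalar_curvature_radial (x : E3) : V (dot x x) != 0 ->
  scalar_curvature g x =
  - 2 / V (dot x x) * (6 * F (dot x x) + 4 * dot x x * F1 (dot x x)
                     + dot x x * F (dot x x) ^+ 2).
Proof.
move=> Vx; rewrite /scalar_curvature.
transitivity ((V (dot x x))^-1 * \sum_(b < 3) ricci g b b x).
  rewrite mulr_sumr; apply: eq_bigr => b _.
  rewrite -(sum_kron (fun d => (V (dot x x))^-1 * ricci g b d x)).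
  by apply: eq_bigr => d _; rewrite inv_radial_metric mul1r (kronC d b) mulrAC.
transitivity ((V (dot x x))^-1 * (- 2 * (6 * F (dot x x) + 4 * dot x x * F1 (dot x x)
                     + dot x x * F (dot x x) ^+ 2))); last by ring.
congr (_ * _).
rewrite /ricci /riemann.
under eq_bigr => b _.
  under eq_bigr => a _.
    rewrite !partial_christoffel//.
    under eq_bigr => e _ do rewrite !christoffel_radial.
    over.
  over.
rewrite /=; set f1 := (V2 _ / _ - _ ^+ 2); set f := V1 _ / _.
(* With [F], [F'] and the three coordinates as free variables, the identity is polynomial. *)
move: f1 f => f1 f; rewrite dotE !sum3 /kron /=.
move: (x 0 0) (x 0 1) (x 0 2%:R) => x0 x1 x2 /=.
rewrite mulr1n mulr0n; ring.
Qed.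

Lemma trace_radial (c : R) (x : E3) : V (dot x x) != 0 ->
  trace_g g (radial_metric c) x = 3 * c.
Proof.
move=> Vx; rewrite /trace_g.
transitivity (\sum_(a < 3) c); last by rewrite sumr_const card_ord mulr_natl.
apply: eq_bigr => a _; rewrite -[RHS](sum_kron (fun=> c) a); apply: eq_bigr => b _.
rewrite inv_radial_metric mul1r /radial_metric scalar_mx3E (kronC b a) /kron.
by case: (a == b); rewrite ?mulr1n ?mulr0n; field.
Qed.

Lemma tensor_norm2_radial (c : R) (x : E3) : V (dot x x) != 0 ->
  tensor_norm2 g (radial_metric c) x = 3 * c ^+ 2.
Proof.
move=> Vx; rewrite /tensor_norm2.
transitivity (\sum_(a < 3) c ^+ 2); last by rewrite sumr_const card_ord mulr_natl.
apply: eq_bigr => a _; rewrite -(sum_kron (fun=> c ^+ 2) a); apply: eq_bigr => b _.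
rewrite -(sum_kron (fun d => c ^+ 2 * kron d a) b); apply: eq_bigr => d _.
rewrite -(sum_kron (fun e => c ^+ 2 * kron d a * kron e b) d); apply: eq_bigr => e _.
rewrite !inv_radial_metric /radial_metric !scalar_mx3E mul1r.
rewrite (kronC a d) (kronC a b) (kronC b e) (kronC d e) /kron.
have [->|] := eqVneq d a; last by rewrite /= !(mulr0, mul0r).
have [->|] := eqVneq e b; last by rewrite /= !(mulr0, mul0r).
rewrite (eq_sym b a).
by case: (a == b); rewrite ?mulr1n ?mulr0n; field.
Qed.

(** Metric compatibility of the connection, the tensor being a constant multiple of the metric. *)
Lemma cov_tensor_radial (de : R) (a b c : 'I_3) (x : E3) : V (dot x x) != 0 ->
  cov_tensor g (radial_metric de) a b c x = 0.
Proof.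
move=> Vx; rewrite /cov_tensor partial_radial_metric.
under eq_bigr => d _.
  rewrite /radial_metric !scalar_mx3E !christoffel_radial (kronC b d) !mulrA.
  over.
rewrite big_split/= !sum_kron (kronC c b) (kronC c a) (kronC b a).
by field.
Qed.

Lemma div_radial (de : R) (b : 'I_3) (x : E3) : V (dot x x) != 0 ->
  div_g g (radial_metric de) b x = 0.
Proof.
move=> Vx; rewrite /div_g big1// => a _; rewrite big1// => c _.
by rewrite cov_tensor_radial// mulr0.
Qed.

End Conformal.

(** * Centred spheres: tangent planes, exterior, second fundamental form *)

Section Sphere.
Context {R : realType}.
Notation E3 := 'rV[R]_3.
Implicit Types (p u v x : E3) (s : R).

(** The parameter is the squared radius, in line with functions of [|x|^2]. *)
Definition centred_sphere s : set E3 := [set x | dot x x = s].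

Lemma dot_ge0 x : 0 <= dot x x.
Proof. by apply: sumr_ge0 => i _; rewrite -expr2 sqr_ge0. Qed.

Lemma dot_eq0 x : dot x x = 0 -> x = 0.
Proof.
move=> /eqP; rewrite psumr_eq0 => [/allP H|i _]; last by rewrite -expr2 sqr_ge0.
apply/rowP => i; rewrite mxE; apply/eqP.
by have := H i (mem_index_enum _); rewrite /= -expr2 sqrf_eq0.
Qed.

Lemma dotZZ (a b : R) u v : dot (a *: u) (b *: v) = a * b * dot u v.
Proof. by rewrite /dot mulr_sumr; apply: eq_bigr => i _; rewrite !mxE; ring. Qed.

Lemma bilin_scalar (c : R) u v : bilin c%:M u v = c * dot u v.
Proof.
rewrite /bilin mul_mx_scalar -scalemxAl mxE; congr (_ * _).
by rewrite mxE; apply: eq_bigr => i _; rewrite mxE.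
Qed.

Lemma tangent_centred_sphere s p v : tangent (centred_sphere s) p v -> dot p v = 0.
Proof.
move=> [e [c [e0 sc Sc c0 c'0]]].
have b0 : ball (0 : R) e 0 by exact: ballxx.
have dc : derivable c 0 1 by have [_] := sc [::] 0 b0; apply.
have dci i : is_derive (0 : R) 1 (fun t => c t 0 i) (v 0 i).
  have := dc => /derivable_mxP/(_ 0 i) di; split => //.
  by rewrite -c'0 derive_mx// mxE.
have dd i := is_deriveM (dci i) (dci i).
have D := is_deriveD (is_deriveD (dd 0) (dd 1)) (dd 2%:R).
have : is_derive (0 : R) 1 (fun t => dot (c t) (c t)) (2 * dot p v).
  have -> : (fun t => dot (c t) (c t)) =
      (fun t => c t 0 0 * c t 0 0 + c t 0 1 * c t 0 1 + c t 0 2%:R * c t 0 2%:R).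
    by apply/funext => t; rewrite dotE.
  apply: (@is_derive_eq _ _ _ _ _ _ _ _ D).
  by rewrite c0 dotE /GRing.scale/=; ring.
move=> [_ dE].
have : 'D_1 (fun t => dot (c t) (c t)) (0 : R) = 'D_1 (cst s : R -> R) (0 : R).
  apply: near_eq_derive; near=> t; apply: Sc; near: t.
  exact: nbhsx_ballx.
rewrite dE derive_cst => /eqP; rewrite mulf_eq0 pnatr_eq0/= => /eqP//.
Unshelve. all: by end_near. Qed.

Lemma embedded_centred_sphere s : 0 < s -> embedded_sphere (centred_sphere s).
Proof.
move=> s0; set r := Num.sqrt s.
have r0 : 0 < r by rewrite sqrtr_gt0.
have r2 : r * r = s by rewrite -expr2 sqr_sqrtr// ltW.
exists setT, (fun x => r *: x); split.
- by split; [exact: openT|].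
- exact: smooth_on_homothety.
- by move=> x y _ _; apply: scalerI; rewrite gt_eqF.
- move=> p v _ _ v0.
  have [_ ->] := is_deriveZ r (@is_derive_id _ _ p v).
  by rewrite scaler_eq0 negb_or v0 andbT gt_eqF.
- apply/seteqP; split => x /=.
    rewrite /centred_sphere /= => xs; exists (r^-1 *: x).
      by rewrite /unit_sphere/= dotZZ xs -r2; field; rewrite gt_eqF.
    by rewrite scalerA mulfV ?gt_eqF// scale1r.
  by move=> [y y1 <-]; rewrite /centred_sphere/= dotZZ y1 mulr1.
Qed.

(** The outward ray from [x] is connected, unbounded and misses the sphere. *)
Lemma exterior_centred_sphere s x : 0 < s -> s < dot x x ->
  exterior (centred_sphere s) x.
Proof.
move=> s0 sx.
have x0 : x != 0.
  apply: contraTneq sx => ->; rewrite -leNgt /dot big1 ?ltW// => i _.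
  by rewrite mxE mul0r.
rewrite /exterior/=.
pose ray := (fun m : R => m *: x) @` `[1, +oo[%classic.
have rayC : ray `<=` connected_component (~` centred_sphere s) x.
  apply: connected_component_max.
  - by exists 1; rewrite /= ?in_itv/= ?lexx// scale1r.
  - move=> _ [m /= m1 <-]; move: m1; rewrite in_itv/= andbT => m1.
    rewrite /centred_sphere/= dotZZ => E.
    have : 1 * dot x x <= m * m * dot x x.
      by rewrite ler_wpM2r ?dot_ge0// -expr2 expr_ge1// (le_trans ler01).
    by rewrite mul1r E leNgt sx.
  - apply: connected_continuous_connected; first exact/connected_intervalP/interval_is_interval.
    by apply: continuous_subspaceT => m; apply: cvgZl; exact: cvg_id.
move=> [M [Mr HM]].
have {}HM y : ray y -> M < `|M| + 1 -> `|y| <= `|M| + 1.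
  by move=> /rayC ry /HM; exact.
have nx0 : 0 < `|x| by rewrite normr_gt0.
have pos : 0 <= (`|M| + 1) / `|x| by rewrite divr_ge0// addr_ge0.
(* This point has norm [|x| + |M| + 1], beyond the presumed bound. *)
have Hin : ray ((1 + (`|M| + 1) / `|x|) *: x).
  by exists (1 + (`|M| + 1) / `|x|) => //=; rewrite in_itv/= andbT lerDl.
have := HM _ Hin; rewrite normrZ ger0_norm ?addr_ge0//.
have Mlt : M < `|M| + 1 by rewrite (le_lt_trans (ler_norm _))// ltrDl.
move=> /(_ Mlt).
by rewrite mulrDl mul1r divfK ?gt_eqF// gerDr leNgt nx0.
Qed.

Variables (V V1 : R -> R) (s0 de : R).
Hypothesis dV : forall s : R, is_derive s 1 V (V1 s).
Hypotheses (s0_gt0 : 0 < s0) (s0_lt1 : s0 < 1) (de0 : 0 < de).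
Hypotheses (Vs0 : 0 < V s0) (minimal : V s0 + s0 * V1 s0 = 0).
Notation g := (radial_metric V 1).
Notation S := (centred_sphere s0).

(** The inverse of the [g]-length of the position vector on the sphere. *)
Let kappa := (Num.sqrt (V s0 * s0))^-1.
Let N (x : E3) := kappa *: x.

Let kappa_gt0 : 0 < kappa.
Proof. by rewrite invr_gt0 sqrtr_gt0 mulr_gt0. Qed.

Let kappa2 : kappa * kappa * (V s0 * s0) = 1.
Proof.
rewrite -expr2 exprVn sqr_sqrtr; last by rewrite mulr_ge0 ?ltW.
by rewrite mulVf// gt_eqF// mulr_gt0.
Qed.

(** For tangent [v] the covariant derivative is [kappa (1 + s0 F) v]. The hypothesis [minimal] is
    [(s V)' = 0] at [s0], that is, a stationary area radius, and gives [F = - 1 / s0]. *)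
Lemma cov_vector_normal p v : S p -> dot p v = 0 -> cov_vector g N p v = 0.
Proof.
rewrite /centred_sphere/= => Sp pv; apply/rowP => a.
rewrite /cov_vector; have [_ ->] := is_deriveZ kappa (@is_derive_id _ _ p v).
rewrite !mxE.
under eq_bigr => b _ do under eq_bigr => c _ do
  rewrite (christoffel_radial dV) Sp /N mxE.
have F0 : V1 s0 / V s0 = - s0^-1.
  have := minimal => /eqP; rewrite addrC addr_eq0 => /eqP H.
  have {}H : V1 s0 = - V s0 / s0 by rewrite -H; field; rewrite gt_eqF.
  by rewrite H; field; rewrite !gt_eqF.
rewrite F0.
have -> : \sum_(b < 3) \sum_(c < 3)
     - s0^-1 * (kron a c * p 0 b + kron a b * p 0 c - kron b c * p 0 a) * v 0 b * (kappa * p 0 c)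
   = - s0^-1 * kappa * (p 0 a * dot p v + v 0 a * dot p p - p 0 a * dot p v).
  have [->|[->|->]] : a = 0 \/ a = 1 \/ a = 2%:R.
    by case: a => [[|[|[|//]]] H]; [left|right; left|right; right]; exact: val_inj.
  - by rewrite !sum3 !dotE /kron /= mulr1n mulr0n; ring.
  - by rewrite !sum3 !dotE /kron /= mulr1n mulr0n; ring.
  - by rewrite !sum3 !dotE /kron /= mulr1n mulr0n; ring.
by rewrite pv Sp; field; rewrite gt_eqF.
Qed.

Lemma outward_normal_sphere : outward_unit_normal g S N.
Proof.
split; first by exists setT; split => //; [exact: openT|exact: smooth_on_homothety].
move=> p Sp; split.
- by rewrite /radial_metric bilin_scalar mul1r Sp /N dotZZ Sp -[RHS]kappa2; ring.
- move=> v /tangent_centred_sphere pv.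
  by rewrite /radial_metric bilin_scalar /N -[v]scale1r dotZZ pv !mulr0.
- near=> t; apply: exterior_centred_sphere => //.
  have t0 : 0 < t by near: t; exact: nbhs_right_gt.
  have -> : p + t *: N p = (1 + t * kappa) *: p by rewrite /N scalerA scalerDl scale1r.
  rewrite dotZZ Sp ltr_pMl// -expr2 expr_gt1// ?ltrDl ?mulr_gt0//.
  by rewrite addr_ge0// mulr_ge0// ltW.
Unshelve. all: by end_near. Qed.

Lemma surface_trace_multiple p (q : E3 -> E3 -> R) (c : R) (X : 'M[R]_(2, 3)) :
  S p -> row_free X -> (forall a b, q (row a X) (row b X) = c * bilin (g p) (row a X) (row b X)) ->
  surface_trace (g p) q X = 2 * c.
Proof.
move=> Sp fX qE; rewrite /surface_trace.
have -> : gram q X = c *: gram (bilin (g p)) X.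
  by apply/matrixP => a b; rewrite !mxE qE.
(* A vector [w] in the kernel of the Gram matrix satisfies [|w X|^2 = 0], so [w X = 0], and [w = 0]
   because the rows of [X] are free. *)
have uG : gram (bilin (g p)) X \in unitmx.
  have -> : gram (bilin (g p)) X = V s0 *: (X *m X^T).
    apply/matrixP => a b; rewrite !mxE /radial_metric bilin_scalar mul1r Sp.
    by congr (_ * _); apply: eq_bigr => i _; rewrite !mxE.
  rewrite unitmxZ ?unitfE ?gt_eqF// -row_free_unit -kermx_eq0.
  apply/rowV0P => w /sub_kermxP; rewrite mulmxA => H.
  have : dot (w *m X) (w *m X) = 0.
    have : (w *m X *m X^T *m w^T) 0 0 = 0 by rewrite H mul0mx mxE.
    rewrite -mulmxA -trmx_mul mxE => E; rewrite -[RHS]E.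
    by apply: eq_bigr => i _; rewrite [_^T _ _]mxE.
  move/dot_eq0 => /(congr1 (mulmx^~ (pinvmx X))) .
  by rewrite mul0mx mulmxKp.
by rewrite -scalemxAr mulVmx// linearZ/= mxtrace1 mulrC.
Qed.

(** The second fundamental form of the sphere vanishes, so both traces equal that of [- de g] on a
    plane, [- 2 de]. *)
Lemma trapped_centred_sphere : trapped (@unit_ball R) g (radial_metric V (- de)) S.
Proof.
split; first by move=> x; rewrite /centred_sphere /unit_ball/= => ->.
exists N; first exact: outward_normal_sphere.
move=> p Sp X [fX tX].
have pX a : dot p (row a X) = 0 by exact: tangent_centred_sphere (tX a).
have h0 a b : second_form g N p (row a X) (row b X) = 0.
  by rewrite /second_form cov_vector_normal// /bilin !mul0mx mxE.
have kE a b : bilin (radial_metric V (- de) p) (row a X) (row b X) =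
    - de * bilin (g p) (row a X) (row b X).
  by rewrite /radial_metric !bilin_scalar mul1r mulrA.
rewrite !(surface_trace_multiple (c := - de) Sp fX).
- by rewrite mulrN oppr_lt0 mulr_gt0.
- by move=> a b; rewrite h0 subr0 kE.
- by move=> a b; rewrite h0 addr0 kE.
Qed.

End Sphere.

(** * Cosine integrals of the extension profile *)

Section Oscillatory.
Context {R : realType}.
Notation leb := (@lebesgue_measure R).
Implicit Types (f F : R -> R) (a b t : R).

Lemma is_derive_continuous f f' :
  (forall t : R, is_derive t 1 f (f' t)) -> continuous f.
Proof.
move=> df t; apply: (@differentiable_continuous R R R t f); apply/derivable1_diffP.
exact: (@ex_derive _ _ _ _ _ _ _ (df t)).
Qed.

Lemma continuous_integrable_itv f a b : continuous f ->
  leb.-integrable `[a, b] (EFin \o f).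
Proof.
move=> cf; apply: continuous_compact_integrable; first exact: segment_compact.
exact: continuous_subspaceT.
Qed.

Lemma Rintegral_FTC f F a b : a < b -> (forall t : R, is_derive t 1 F (f t)) ->
  continuous f -> \int[leb]_(t in `[a, b]) f t = F b - F a.
Proof.
move=> ab dF cf; have cF := is_derive_continuous dF.
rewrite /Rintegral (@continuous_FTC2 _ f F)//.
- exact: continuous_subspaceT.
- split.
  + by move=> t _; exact: (@ex_derive _ _ _ _ _ _ _ (dF t)).
  + by apply: cvg_at_right_filter; exact: cF.
  + by apply: cvg_at_left_filter; exact: cF.
- by move=> t _; rewrite derive1E (@derive_val _ _ _ _ _ _ _ (dF t)).
Qed.

Lemma le_normr_Rintegral_bound f a b (M : R) : a <= b -> continuous f ->
  (forall t, a <= t <= b -> `|f t| <= M) ->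
  `|\int[leb]_(t in `[a, b]) f t| <= M * (b - a).
Proof.
move=> ab cf fM.
apply: (le_trans (le_normr_Rintegral _ _)) => //; first exact: continuous_integrable_itv.
have -> : M * (b - a) = \int[leb]_(t in `[a, b]) M.
  rewrite Rintegral_cst//= lebesgue_measure_itv/= lte_fin.
  move: ab; rewrite le_eqVlt => /predU1P[->|->]; first by rewrite ltxx subrr.
  by rewrite -EFinB.
apply: le_Rintegral => //.
- apply: continuous_integrable_itv => t.
  by apply: cvg_norm; exact: cf.
- by apply: continuous_integrable_itv => t; exact: cvg_cst.
Qed.

(** For exponentials concentrated in a layer of width [1 / lam], the supremum times the length would
    lose a factor [lam]; a majorant with a known primitive does not. *)
Lemma le_normr_Rintegral_FTC f g F a b : a < b ->
  (forall t : R, is_derive t 1 F (f t)) -> continuous f -> continuous g ->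
  (forall t, a <= t <= b -> `|g t| <= f t) ->
  `|\int[leb]_(t in `[a, b]) g t| <= F b - F a.
Proof.
move=> ab dF cf cg gf.
apply: (le_trans (le_normr_Rintegral _ _)) => //; first exact: continuous_integrable_itv.
rewrite -(Rintegral_FTC ab dF cf); apply: le_Rintegral => //.
- apply: continuous_integrable_itv => t.
  by apply: cvg_norm; exact: cg.
- exact: continuous_integrable_itv.
Qed.

Lemma is_deriveMl f (df c t : R) : is_derive t 1 f df ->
  is_derive t 1 (fun t : R => c * f t) (c * df).
Proof. exact: is_deriveZ. Qed.

Lemma is_derive_sin_mul (rho t : R) :
  is_derive t 1 (fun t : R => sin (rho * t)) (rho * cos (rho * t)).
Proof.
have d : is_derive t 1 (fun t : R => rho * t) rho.
  by apply: is_derive_eq; rewrite /GRing.scale/= mulr1.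
have := @is_derive1_comp R (@sin R) _ t _ _ (is_derive_sin _) d.
by rewrite mulrC; apply.
Qed.

Lemma is_derive_cos_mul (rho t : R) :
  is_derive t 1 (fun t : R => cos (rho * t)) (- (rho * sin (rho * t))).
Proof.
have d : is_derive t 1 (fun t : R => rho * t) rho.
  by apply: is_derive_eq; rewrite /GRing.scale/= mulr1.
have := @is_derive1_comp R (@cos R) _ t _ _ (is_derive_cos _) d.
by rewrite mulrC mulrN; apply.
Qed.

Lemma continuous_cos_mul (rho : R) : continuous (fun t => cos (rho * t)).
Proof. exact: is_derive_continuous (is_derive_cos_mul rho). Qed.

Lemma continuous_mul_cos f (rho : R) : continuous f ->
  continuous (fun t => f t * cos (rho * t)).
Proof. by move=> cf t; apply: cvgM; [exact: cf|exact: continuous_cos_mul]. Qed.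

Section Parts.
Variables (f0 f1 f2 f3 f4 : R -> R) (a b rho : R).
Hypothesis ab : a < b.
Hypothesis d0 : forall t : R, is_derive t 1 f0 (f1 t).
Hypothesis d1 : forall t : R, is_derive t 1 f1 (f2 t).

(** Both integrations by parts are done at once, by differentiating the complete boundary term;
    [cos_parts4] proceeds likewise. *)
Lemma cos_parts2 : continuous f2 ->
  rho ^+ 2 * (\int[leb]_(t in `[a, b]) (f0 t * cos (rho * t))) =
  (rho * f0 b * sin (rho * b) + f1 b * cos (rho * b))
  - (rho * f0 a * sin (rho * a) + f1 a * cos (rho * a))
  - \int[leb]_(t in `[a, b]) (f2 t * cos (rho * t)).
Proof.
move=> cf2; have cf0 := is_derive_continuous d0.
pose F t := rho * f0 t * sin (rho * t) + f1 t * cos (rho * t).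
have dF (t : R) : is_derive t 1 F (rho ^+ 2 * (f0 t * cos (rho * t)) + f2 t * cos (rho * t)).
  have D := is_deriveD
    (is_deriveM (is_deriveMl rho (d0 t)) (is_derive_sin_mul rho t))
    (is_deriveM (d1 t) (is_derive_cos_mul rho t)).
  by apply: (@is_derive_eq _ _ _ _ _ _ _ _ D); rewrite /GRing.scale/=; ring.
have c1 := continuous_mul_cos (rho := rho) cf0.
have c2 := continuous_mul_cos (rho := rho) cf2.
have c3 : continuous (fun t => rho ^+ 2 * (f0 t * cos (rho * t))).
  by move=> t; apply: cvgM; [exact: cvg_cst|exact: c1].
have := Rintegral_FTC ab dF _.
rewrite RintegralD//; [|exact: continuous_integrable_itv..].
rewrite RintegralZl//; last exact: continuous_integrable_itv.
rewrite /F => <-; first by rewrite addrK.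
by move=> t; apply: cvgD; [exact: c3|exact: c2].
Qed.

Hypothesis d2 : forall t : R, is_derive t 1 f2 (f3 t).
Hypothesis d3 : forall t : R, is_derive t 1 f3 (f4 t).

Lemma cos_parts4 : continuous f4 ->
  rho ^+ 4 * (\int[leb]_(t in `[a, b]) (f0 t * cos (rho * t))) =
  (rho ^+ 3 * f0 b * sin (rho * b) + rho ^+ 2 * f1 b * cos (rho * b)
    - rho * f2 b * sin (rho * b) - f3 b * cos (rho * b))
  - (rho ^+ 3 * f0 a * sin (rho * a) + rho ^+ 2 * f1 a * cos (rho * a)
    - rho * f2 a * sin (rho * a) - f3 a * cos (rho * a))
  + \int[leb]_(t in `[a, b]) (f4 t * cos (rho * t)).
Proof.
move=> cf4; have cf0 := is_derive_continuous d0.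
pose F t := rho ^+ 3 * f0 t * sin (rho * t) + rho ^+ 2 * f1 t * cos (rho * t)
    - rho * f2 t * sin (rho * t) - f3 t * cos (rho * t).
have dF (t : R) : is_derive t 1 F (rho ^+ 4 * (f0 t * cos (rho * t)) - f4 t * cos (rho * t)).
  have D := is_deriveB (is_deriveB (is_deriveD
    (is_deriveM (is_deriveMl (rho ^+ 3) (d0 t)) (is_derive_sin_mul rho t))
    (is_deriveM (is_deriveMl (rho ^+ 2) (d1 t)) (is_derive_cos_mul rho t)))
    (is_deriveM (is_deriveMl rho (d2 t)) (is_derive_sin_mul rho t)))
    (is_deriveM (d3 t) (is_derive_cos_mul rho t)).
  by apply: (@is_derive_eq _ _ _ _ _ _ _ _ D); rewrite /GRing.scale/=; ring.
have c1 := continuous_mul_cos (rho := rho) cf0.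
have c2 := continuous_mul_cos (rho := rho) cf4.
have c3 : continuous (fun t => rho ^+ 4 * (f0 t * cos (rho * t))).
  by move=> t; apply: cvgM; [exact: cvg_cst|exact: c1].
have := Rintegral_FTC ab dF _.
rewrite RintegralB//; [|exact: continuous_integrable_itv..].
rewrite RintegralZl//; last exact: continuous_integrable_itv.
rewrite /F => <-; first by rewrite subrK.
by move=> t; apply: cvgB; [exact: c3|exact: c2].
Qed.

End Parts.

Lemma Rintegral_itv_split f a b c : a <= b -> b <= c -> continuous f ->
  \int[leb]_(t in `[a, c]) f t =
  \int[leb]_(t in `[a, b]) f t + \int[leb]_(t in `[b, c]) f t.
Proof.
move=> ab bc cf; have i := @continuous_integrable_itv f a c cf.
have := @Rintegral_itvB R f (BLeft a) (BRight c) b i.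
rewrite !bnd_simp => /(_ ab bc) E.
have := @Rintegral_itv_obnd_cbnd R b (BRight c) f.
move=> <-; first by rewrite -E addrC subrK.
by apply: integrableS i => //; exact: subset_itvr.
Qed.

Lemma ler_normM_cos (x y : R) : `|x * cos y| <= `|x|.
Proof. by rewrite normrM ler_piMr// cos_max. Qed.

(** At [c] each difference quotient is that of [f] or of [g], and both tend to the same limit. *)
Lemma is_derive_glue (f g f' g' : R -> R) (c : R) : f c = g c -> f' c = g' c ->
  (forall t : R, is_derive t 1 f (f' t)) -> (forall t : R, is_derive t 1 g (g' t)) ->
  forall t : R, is_derive t 1 (fun x => if x <= c then f x else g x)
                (if t <= c then f' t else g' t).
Proof.
move=> fg fg' df dg t.
have [tc|ct|->] := ltgtP t c.
- apply: near_eq_is_derive (df t); near=> x.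
  by rewrite ltW//; near: x; exact: lt_nbhsl.
- apply: near_eq_is_derive (dg t); near=> x.
  by rewrite leNgt (_ : c < x)//; near: x; exact: lt_nbhsr.
set G := fun x => _.
have H : h^-1 *: (G (h *: 1 + c) - G c) @[h --> (0 : R)^'] --> f' c.
  have [Df Ef] := df c; have [Dg Eg] := dg c.
  move: Df Dg; rewrite /derivable; rewrite /derive in Ef Eg.
  move=> /cvgrPdist_le Df /cvgrPdist_le Dg.
  apply/cvgrPdist_le => e e0; near=> h.
  rewrite /G lexx; case: ifP => _.
    by rewrite -Ef; near: h; exact: Df.
  by rewrite fg fg' -Eg; near: h; exact: Dg.
by split; [apply/cvg_ex; exists (f' c)|exact: cvg_lim].
Unshelve. all: by end_near. Qed.

End Oscillatory.

Lemma is_derive_pow (R : realType) n (x : R) : is_derive x 1 (fun x : R => x ^+ n.+1) (n.+1%:R * x ^+ n).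
Proof. by split; [exact: exprn_derivable|rewrite exp_derive /GRing.scale/= mulr1]. Qed.

(** * Compactly supported continuation of one exponential *)

Section Profile.
Context {R : realType}.
Notation leb := (@lebesgue_measure R).
Variables (kap lam : R).
Hypotheses (kap0 : 0 <= kap) (kap1 : kap <= 1) (lam1 : 1 <= lam).

Let lam0 : 0 < lam. Proof. exact: lt_le_trans lam1. Qed.

(* With [x = lam * (s - 1)]: [in1] is an exponential for [kap = 1] and a constant for [kap = 0]; it is
   continued to the right of 0 by the cubic [out1] which vanishes to second order
   at 1 and matches value and slope at 0.  [in0] and [out0] are antiderivatives. *)
Let c0 := - (2^-1 + kap / 12).
Definition in0 x := kap * (expR x - 1) + (1 - kap) * x + c0.
Definition in1 x := kap * expR x + (1 - kap).
Definition in2 x := kap * expR x.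
Definition out0 x := c0 + x + kap / 2 * x ^+ 2 - (3 + 2 * kap) / 3 * x ^+ 3 + (2 + kap) / 4 * x ^+ 4.
Definition out1 x := 1 + kap * x - (3 + 2 * kap) * x ^+ 2 + (2 + kap) * x ^+ 3.
Definition out2 x := kap - 2 * (3 + 2 * kap) * x + 3 * (2 + kap) * x ^+ 2.
Definition out3 x := - (2 * (3 + 2 * kap)) + 6 * (2 + kap) * x.
Definition out4 (x : R) : R := 6 * (2 + kap).

Lemma is_derive_in0 (x : R) : is_derive x 1 in0 (in1 x).
Proof.
have D := is_deriveD (is_deriveD (is_deriveMl kap (is_deriveB (is_derive_expR x) (is_derive_cst (1 : R) x 1)))
  (is_deriveMl (1 - kap) (is_derive_id x 1))) (is_derive_cst c0 x 1).
apply: (@is_derive_eq _ _ _ _ _ _ _ _ D); rewrite /in1; ring.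
Qed.

Lemma is_derive_in1 (x : R) : is_derive x 1 in1 (in2 x).
Proof.
have D := is_deriveD (is_deriveMl kap (is_derive_expR x)) (is_derive_cst (1 - kap) x 1).
by apply: (@is_derive_eq _ _ _ _ _ _ _ _ D); rewrite addr0.
Qed.

Lemma is_derive_in2 (x : R) : is_derive x 1 in2 (in2 x).
Proof. exact: is_deriveMl (is_derive_expR x). Qed.

Lemma is_derive_out0 (x : R) : is_derive x 1 out0 (out1 x).
Proof.
have D := is_deriveD (is_deriveB (is_deriveD (is_deriveD (is_derive_cst c0 x 1) (is_derive_id x 1))
  (is_deriveMl (kap / 2) (is_derive_pow 1 x)))
  (is_deriveMl ((3 + 2 * kap) / 3) (is_derive_pow 2 x)))
  (is_deriveMl ((2 + kap) / 4) (is_derive_pow 3 x)).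
by apply: (@is_derive_eq _ _ _ _ _ _ _ _ D); rewrite /out1; field.
Qed.

Lemma is_derive_out1 (x : R) : is_derive x 1 out1 (out2 x).
Proof.
have D := is_deriveD (is_deriveB (is_deriveD (is_derive_cst (1 : R) x 1)
  (is_deriveMl kap (is_derive_id x 1)))
  (is_deriveMl (3 + 2 * kap) (is_derive_pow 1 x)))
  (is_deriveMl (2 + kap) (is_derive_pow 2 x)).
by apply: (@is_derive_eq _ _ _ _ _ _ _ _ D); rewrite /out2; ring.
Qed.

Lemma is_derive_out2 (x : R) : is_derive x 1 out2 (out3 x).
Proof.
have D := is_deriveD (is_deriveB (is_derive_cst kap x 1)
  (is_deriveMl (2 * (3 + 2 * kap)) (is_derive_id x 1)))
  (is_deriveMl (3 * (2 + kap)) (is_derive_pow 1 x)).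
by apply: (@is_derive_eq _ _ _ _ _ _ _ _ D); rewrite /out3; ring.
Qed.

Lemma is_derive_out3 (x : R) : is_derive x 1 out3 (out4 x).
Proof.
have D := is_deriveD (is_derive_cst (- (2 * (3 + 2 * kap))) x 1)
  (is_deriveMl (6 * (2 + kap)) (is_derive_id x 1)).
by apply: (@is_derive_eq _ _ _ _ _ _ _ _ D); rewrite /out4; ring.
Qed.

Definition glued (f g : R -> R) x := if x <= 0 then f x else if x <= 1 then g x else 0.

Lemma is_derive_glued (f g f' g' : R -> R) :
  (forall x : R, is_derive x 1 f (f' x)) -> (forall x : R, is_derive x 1 g (g' x)) ->
  f 0 = g 0 -> f' 0 = g' 0 -> g 1 = 0 -> g' 1 = 0 ->
  forall x : R, is_derive x 1 (glued f g) (glued f' g' x).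
Proof.
move=> df dg fg fg' g1 g'1.
apply: is_derive_glue => //; rewrite ?ler01//.
by apply: (@is_derive_glue _ g (fun=> 0) g' (fun=> 0)) => // t; exact: is_derive_cst.
Qed.

(** On [s <= 1], [kap = 1] and [lam = 2^n] give the [n]-th exponential of [V], while [kap = 0] and
    [lam = 1] give the constant [1]. The continuation occupies a layer of width [1 / lam], the
    natural scale of the exponential. *)
Definition profile s := lam^-1 * glued in1 out1 (lam * (s - 1)).
Definition antiprofile s := lam ^- 2 * glued in0 out0 (lam * (s - 1)).

Let is_derive_arg (s : R) : is_derive s 1 (fun s : R => lam * (s - 1)) lam.
Proof.
have D := is_deriveMl lam (is_deriveB (is_derive_id s 1) (is_derive_cst (1 : R) s 1)).
by apply: (@is_derive_eq _ _ _ _ _ _ _ _ D); rewrite subr0 mulr1.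
Qed.

Lemma is_derive_antiprofile (s : R) : is_derive s 1 antiprofile (profile s).
Proof.
have D : is_derive (lam * (s - 1)) 1 (glued in0 out0) (glued in1 out1 (lam * (s - 1))).
  apply: (is_derive_glued is_derive_in0 is_derive_out0);
    rewrite /in0 /in1 /out0 /out1 /c0 ?expR0; by field.
have D2 := is_deriveMl (lam ^- 2) (is_derive_comp1 (is_derive_arg s) D).
apply: (@is_derive_eq _ _ _ _ _ _ _ _ D2); rewrite /profile; field; exact: lt0r_neq0.
Qed.

Lemma continuous_profile : continuous profile.
Proof.
apply: (@is_derive_continuous _ _ (fun s => lam^-1 * (glued in2 out2 (lam * (s - 1)) * lam))) => s.
have D : is_derive (lam * (s - 1)) 1 (glued in1 out1) (glued in2 out2 (lam * (s - 1))).
  apply: (is_derive_glued is_derive_in1 is_derive_out1);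
    rewrite /in2 /in1 /out2 /out1 ?expR0; ring.
exact: is_deriveMl (is_derive_comp1 (is_derive_arg s) D).
Qed.

(** The factorisation displays the sign on [[0, 1]] and the double zero at [1]. *)
Lemma out1E (x : R) : out1 x = (1 - x) ^+ 2 * (1 + (2 + kap) * x).
Proof. rewrite /out1; ring. Qed.

Lemma glued1_ge0 (x : R) : 0 <= glued in1 out1 x <= 4.
Proof.
rewrite /glued; case: ifPn => [x0|]; [|rewrite -ltNge => x0; case: ifPn => [x1|_]].
- have e0 := expR_ge0 x; have e1 : expR x <= 1 by rewrite expR_le1.
  rewrite /in1; apply/andP; split.
    by rewrite addr_ge0 ?mulr_ge0// subr_ge0.
  have : kap * expR x <= kap by rewrite ler_piMr.
  lra.
- have b0 : 0 <= 1 + (2 + kap) * x by rewrite addr_ge0// mulr_ge0 ?addr_ge0// ltW.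
  have b4 : 1 + (2 + kap) * x <= 4.
    have : (2 + kap) * x <= 2 + kap by rewrite ler_piMr// addr_ge0.
    move: kap1; lra.
  have a0 : 0 <= (1 - x) ^+ 2 by rewrite sqr_ge0.
  have a1 : (1 - x) ^+ 2 <= 1 by rewrite expr_le1//; lra.
  rewrite out1E mulr_ge0//= -[4]mul1r; exact: ler_pM.
- by rewrite lexx /=; lra.
Qed.

Lemma profile_ge0 (s : R) : 0 <= profile s.
Proof. by have /andP[H _] := glued1_ge0 (lam * (s - 1)); rewrite mulr_ge0// invr_ge0 ltW. Qed.

Lemma profile_le (s : R) : profile s <= 4.
Proof.
have /andP[H0 H4] := glued1_ge0 (lam * (s - 1)).
rewrite -[4]mul1r; apply: ler_pM => //; first by rewrite invr_ge0 ltW.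
by rewrite invf_le1.
Qed.

Let arg_gt1 (s : R) : 2 < s -> 1 < lam * (s - 1).
Proof.
move=> s2; have : 1 * (s - 1) <= lam * (s - 1) by rewrite ler_wpM2r//; lra.
lra.
Qed.

Lemma profile_out (s : R) : 2 < s -> profile s = 0.
Proof.
move=> /arg_gt1 x1; rewrite /profile /glued leNgt (lt_trans ltr01 x1)/=.
by rewrite leNgt x1 mulr0.
Qed.

Lemma antiprofile_out (s : R) : 1 <= lam * (s - 1) -> antiprofile s = 0.
Proof.
move=> x1; rewrite /antiprofile /glued leNgt (lt_le_trans ltr01 x1)/=.
case: ifP => [x1'|]; last by rewrite mulr0.
have -> : lam * (s - 1) = 1 by apply/eqP; rewrite eq_le x1 x1'.
(* The integration constant [c0] is chosen for this. *)
suff -> : out0 1 = 0 by rewrite mulr0.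
by rewrite /out0 /c0; field.
Qed.

Lemma profile_in (s : R) : s <= 1 -> profile s = lam^-1 * (kap * expR (lam * (s - 1)) + (1 - kap)).
Proof. by move=> s1; rewrite /profile /glued pmulr_rle0// subr_le0 s1. Qed.

End Profile.

Section Chain4.
Context {R : realType}.
Variables (lam : R) (q0 q1 q2 q3 q4 : R -> R).
Hypothesis lam_neq0 : lam != 0.
Hypotheses (d0 : forall x : R, is_derive x 1 q0 (q1 x))
  (d1 : forall x : R, is_derive x 1 q1 (q2 x))
  (d2 : forall x : R, is_derive x 1 q2 (q3 x))
  (d3 : forall x : R, is_derive x 1 q3 (q4 x)) (c4 : continuous q4).

(* [chain0] is [t |-> lam^-2 q0 (lam (t^2 - 1))], the shape of an antiprofile at
   [t^2]; [chain1], [chain2], [chain3] and [chain4] are its derivatives. *)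
Definition squeeze (t : R) := lam * (t ^+ 2 - 1).
Definition chain0 t := lam ^- 2 * q0 (squeeze t).
Definition chain1 t := 2 / lam * (t * q1 (squeeze t)).
Definition chain2 t := 2 / lam * q1 (squeeze t) + 4 * (t ^+ 2 * q2 (squeeze t)).
Definition chain3 t := 12 * (t * q2 (squeeze t)) + 8 * lam * (t ^+ 3 * q3 (squeeze t)).
Definition chain4 t := 12 * q2 (squeeze t) + 48 * lam * (t ^+ 2 * q3 (squeeze t))
  + 16 * lam ^+ 2 * (t ^+ 4 * q4 (squeeze t)).

Lemma is_derive_squeeze (t : R) : is_derive t 1 squeeze (2 * lam * t).
Proof.
have D := is_deriveMl lam (is_deriveB (is_derive_pow 1 t) (is_derive_cst (1 : R) t 1)).
by apply: (@is_derive_eq _ _ _ _ _ _ _ _ D); rewrite subr0; ring.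
Qed.

Let dcomp (q q' : R -> R) (t : R) : (forall x : R, is_derive x 1 q (q' x)) ->
  is_derive t 1 (fun t => q (squeeze t)) (2 * lam * (t * q' (squeeze t))).
Proof.
move=> dq; have D := is_derive_comp1 (is_derive_squeeze t) (dq _).
by apply: (@is_derive_eq _ _ _ _ _ _ _ _ D); ring.
Qed.

Lemma is_derive_chain0 (t : R) : is_derive t 1 chain0 (chain1 t).
Proof.
have D := is_deriveMl (lam ^- 2) (dcomp t d0).
by apply: (@is_derive_eq _ _ _ _ _ _ _ _ D); rewrite /chain1; field.
Qed.

Lemma is_derive_chain1 (t : R) : is_derive t 1 chain1 (chain2 t).
Proof.
have D := is_deriveMl (2 / lam) (is_deriveM (is_derive_id t 1) (dcomp t d1)).
by apply: (@is_derive_eq _ _ _ _ _ _ _ _ D); rewrite /chain2 /GRing.scale/=; field.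
Qed.

Lemma is_derive_chain2 (t : R) : is_derive t 1 chain2 (chain3 t).
Proof.
have D := is_deriveD (is_deriveMl (2 / lam) (dcomp t d1))
  (is_deriveMl 4 (is_deriveM (is_derive_pow 1 t) (dcomp t d2))).
by apply: (@is_derive_eq _ _ _ _ _ _ _ _ D); rewrite /chain3 /GRing.scale/=; field.
Qed.

Lemma is_derive_chain3 (t : R) : is_derive t 1 chain3 (chain4 t).
Proof.
have D := is_deriveD (is_deriveMl 12 (is_deriveM (is_derive_id t 1) (dcomp t d2)))
  (is_deriveMl (8 * lam) (is_deriveM (is_derive_pow 2 t) (dcomp t d3))).
by apply: (@is_derive_eq _ _ _ _ _ _ _ _ D); rewrite /chain4 /GRing.scale/=; ring.
Qed.

Lemma continuous_chain4 : continuous chain4.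
Proof.
have csq : continuous squeeze := is_derive_continuous is_derive_squeeze.
have cq (q : R -> R) : continuous q -> continuous (fun t : R => q (squeeze t)).
  by move=> c t; apply: (@continuous_comp _ _ _ squeeze q); [exact: csq|exact: c].
have cm (c : R) (n : nat) (q : R -> R) : continuous q -> continuous (fun t : R => c * (t ^+ n * q (squeeze t))).
  move=> cc t; apply: cvgM; first exact: cvg_cst.
  by apply: cvgM; [exact: exprn_continuous|exact: cq].
move=> t; apply: cvgD; last exact: cm.
apply: cvgD; last exact: (cm _ _ _ (is_derive_continuous d3)).
by apply: cvgM; [exact: cvg_cst|exact: (cq _ (is_derive_continuous d2))].
Qed.

End Chain4.

Lemma ler_normD4 (R : realType) (a b c d e : R) :
  `|a - b - c + (d + e)| <= `|a| + `|b| + `|c| + `|d| + `|e|.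
Proof.
rewrite (le_trans (ler_normD _ _))// -[leRHS]addrA.
rewrite lerD ?ler_normD// (le_trans (ler_normB _ _))// lerD// ler_normB//.
Qed.

(** Expanding the denominator gives [lam^2 J], [lam^2 rho^2 J], [rho^2 J] and [rho^4 J], each
    [O(lam)]. The constants sum to [9 + 174 + 174 + 7000], below [7400]. *)
Lemma decay_interpolation (R : realType) (lam rho J : R) : 1 <= lam ->
  `|J| <= 9 * lam^-1 -> `|rho ^+ 2 * J| <= 174 * lam^-1 ->
  `|rho ^+ 4 * J| <= (70 * 100) * lam ->
  `|J| <= (74 * 100) * lam / ((1 + rho ^+ 2) * (lam ^+ 2 + rho ^+ 2)).
Proof.
move=> lam1 b0.
have lam0 : 0 < lam by exact: lt_le_trans lam1.
have lamn0 : lam != 0 by exact: lt0r_neq0.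
have r2 := sqr_ge0 rho.
have r4 : 0 <= rho ^+ 4 by rewrite (exprM rho 2 2) sqr_ge0.
have d0 : 0 < (1 + rho ^+ 2) * (lam ^+ 2 + rho ^+ 2).
  by rewrite mulr_gt0 ?ltr_pwDl// exprn_gt0.
rewrite [`|_ ^+ 2 * _|]normrM [`|_ ^+ 4 * _|]normrM (ger0_norm r2) (ger0_norm r4) => b2 b4.
rewrite ler_pdivlMr//.
have l2 : 0 <= lam ^+ 2 by rewrite sqr_ge0.
have c0 : lam ^+ 2 * `|J| <= 9 * lam.
  rewrite (_ : 9 * lam = lam ^+ 2 * (9 * lam^-1)); last by field.
  by rewrite ler_wpM2l.
have c2 : lam ^+ 2 * (rho ^+ 2 * `|J|) <= 174 * lam.
  rewrite (_ : 174 * lam = lam ^+ 2 * (174 * lam^-1)); last by field.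
  by rewrite ler_wpM2l.
have laml1 : lam^-1 <= 1 by rewrite invf_le1.
have c2' : rho ^+ 2 * `|J| <= 174 * lam.
  apply: (le_trans b2); rewrite ler_pM2l//; lra.
rewrite (_ : `|J| * _ = lam ^+ 2 * `|J| + lam ^+ 2 * (rho ^+ 2 * `|J|) + rho ^+ 2 * `|J| + rho ^+ 4 * `|J|); last by ring.
lra.
Qed.

(** * Decay of the cosine transform of one profile *)

Section ProfileTransform.
Context {R : realType}.
Notation leb := (@lebesgue_measure R).
Variables (kap lam : R).
Hypotheses (kap0 : 0 <= kap) (kap1 : kap <= 1) (lam1 : 1 <= lam).

Let lam0 : 0 < lam. Proof. exact: lt_le_trans lam1. Qed.
Let lamn0 : lam != 0. Proof. exact: lt0r_neq0. Qed.

(* [antiprofile] vanishes for [t^2 >= T^2]. *)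
Let T := Num.sqrt (1 + lam^-1).
Let T2 : T ^+ 2 = 1 + lam^-1.
Proof. by rewrite sqr_sqrtr// addr_ge0// invr_ge0 ltW. Qed.
Let laml1 : lam^-1 <= 1. Proof. by rewrite invf_le1. Qed.
Let laml0 : 0 < lam^-1. Proof. by rewrite invr_gt0. Qed.
Let T1 : 1 < T.
Proof. by rewrite -[ltLHS]sqrtr1 ltr_sqrt ?ltrDl// addr_gt0. Qed.
Let T_le : T - 1 <= lam^-1.
Proof.
have : (T - 1) * (T + 1) = lam^-1 by rewrite -subr_sqr T2 expr1n addrC addKr.
move=> <-; rewrite ler_peMr// ?subr_ge0 ?ltW//; move: T1; lra.
Qed.

Let T_lt2 : T < 2. Proof. move: T_le laml1 T2 T1 => ? ? E ?; nra. Qed.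

Let I0 := chain0 lam (in0 kap).
Let I1 := chain1 lam (in1 kap).
Let I2 := chain2 lam (in1 kap) (in2 kap).
Let I3 := chain3 lam (in2 kap) (in2 kap).
Let I4 := chain4 lam (in2 kap) (in2 kap) (in2 kap).
Let O0 := chain0 lam (out0 kap).
Let O1 := chain1 lam (out1 kap).
Let O2 := chain2 lam (out1 kap) (out2 kap).
Let O3 := chain3 lam (out2 kap) (out3 kap).
Let O4 := chain4 lam (out2 kap) (out3 kap) (out4 kap).

Let dI0 := is_derive_chain0 lamn0 (is_derive_in0 kap).
Let dI1 := is_derive_chain1 lamn0 (is_derive_in1 kap).
Let dI2 := is_derive_chain2 lamn0 (is_derive_in1 kap) (is_derive_in2 kap).
Let dI3 := is_derive_chain3 lam (is_derive_in2 kap) (is_derive_in2 kap).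
Let dO0 := is_derive_chain0 lamn0 (is_derive_out0 kap).
Let dO1 := is_derive_chain1 lamn0 (is_derive_out1 kap).
Let dO2 := is_derive_chain2 lamn0 (is_derive_out1 kap) (is_derive_out2 kap).
Let dO3 := is_derive_chain3 lam (is_derive_out2 kap) (is_derive_out3 kap).

Let cI4 : continuous I4.
Proof.
exact: continuous_chain4 (is_derive_in2 kap) (is_derive_in2 kap)
  (is_derive_continuous (is_derive_in2 kap)).
Qed.

Let cO4 : continuous O4.
Proof.
apply: continuous_chain4 (is_derive_out2 kap) (is_derive_out3 kap) _.
by move=> x; exact: cvg_cst.
Qed.

Let sq_in (t : R) : 0 <= t <= 1 -> squeeze lam t <= 0.
Proof.
move=> /andP[t0 t1]; rewrite /squeeze pmulr_rle0// subr_le0.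
by rewrite expr_le1.
Qed.

Let sq_out (t : R) : 1 <= t <= T -> 0 <= squeeze lam t <= 1.
Proof.
move=> /andP[t1 tT]; rewrite /squeeze mulr_ge0 ?(ltW lam0)//=; last first.
  by rewrite subr_ge0 expr_ge1// (le_trans ler01).
have : t ^+ 2 <= 1 + lam^-1.
  by rewrite -T2 ler_pXn2r// nnegrE; [apply: le_trans t1|apply: le_trans (ltW T1)].
move=> H; rewrite mulrC -ler_pdivlMr// mul1r; lra.
Qed.

Let antiprofile_in (t : R) : 0 <= t <= 1 -> antiprofile kap lam (t ^+ 2) = I0 t.
Proof. by move=> /sq_in H; rewrite /antiprofile /glued -/(squeeze lam t) H. Qed.

Let antiprofile_mid (t : R) : 1 <= t <= T -> antiprofile kap lam (t ^+ 2) = O0 t.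
Proof.
move=> /sq_out/andP[H0 H1]; rewrite /antiprofile /glued -/(squeeze lam t) H1.
case: ifPn => // H; have -> : squeeze lam t = 0 by apply/eqP; rewrite eq_le H H0.
rewrite /O0 /chain0 /squeeze.
have -> : lam * (t ^+ 2 - 1) = 0 by apply/eqP; rewrite eq_le H H0.
by rewrite /in0 /out0 expR0; congr (_ * _); ring.
Qed.

Let antiprofile_far (t : R) : T <= t -> antiprofile kap lam (t ^+ 2) = 0.
Proof.
move=> Tt; apply: antiprofile_out => //.
have : T ^+ 2 <= t ^+ 2.
  by rewrite ler_pXn2r// nnegrE; [apply: le_trans (ltW T1)|apply: le_trans Tt; apply: le_trans (ltW T1)].
rewrite T2 => H; rewrite mulrC -ler_pdivrMr// mul1r; lra.
Qed.

(** Up to the factor [- 2 pi], the Fourier integral of [profile (|x|^2)] at frequency [rho], after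
    slicing; [T < 2] puts the whole support into [[0, 2]]. *)
Definition profile_transform (rho : R) :=
  \int[leb]_(t in `[0, 2]) (antiprofile kap lam (t ^+ 2) * cos (rho * t)).

Lemma continuous_antiprofile : continuous (antiprofile kap lam).
Proof. exact: is_derive_continuous (is_derive_antiprofile kap lam1). Qed.

Let transformE rho : profile_transform rho =
  \int[leb]_(t in `[0, 1]) (I0 t * cos (rho * t)) +
  \int[leb]_(t in `[1, T]) (O0 t * cos (rho * t)).
Proof.
rewrite /profile_transform.
have cf : continuous (fun t : R => antiprofile kap lam (t ^+ 2) * cos (rho * t)).
  apply: continuous_mul_cos => t.
  apply: (@continuous_comp R R R (fun t : R => t ^+ 2) (antiprofile kap lam)).
    exact: exprn_continuous.
  exact: continuous_antiprofile.
rewrite (@Rintegral_itv_split _ _ 0 1 2)//; last by rewrite ler1n.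
rewrite (@Rintegral_itv_split _ _ 1 T 2)//; [|exact: ltW..].
rewrite [X in _ + (_ + X)](_ : _ = 0) ?addr0; last first.
  rewrite (@eq_Rintegral _ _ _ leb _ (fun=> 0)); first by rewrite Rintegral_cst// mul0r.
  move=> t; rewrite inE/= in_itv/= => /andP[Tt _].
  by rewrite antiprofile_far// mul0r.
congr (_ + _); apply: eq_Rintegral => t; rewrite inE/= in_itv/= => H.
  by rewrite antiprofile_in.
by rewrite antiprofile_mid.
Qed.

Let sq0 : squeeze lam 1 = 0. Proof. by rewrite /squeeze expr1n subrr mulr0. Qed.
Let sqT : squeeze lam T = 1.
Proof. by rewrite /squeeze T2 addrC addKr mulfV. Qed.

(** The pieces meet at [1], and the outer one ends at [T], to second order. Together with the
    vanishing of odd derivatives at [0], this leaves only third derivatives at [1] and [T] as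
    boundary terms of the fourfold integration by parts. *)
Let match0 : O0 1 = I0 1.
Proof. rewrite /O0 /I0 /chain0 sq0 /in0 /out0 expR0; ring. Qed.
Let match1 : O1 1 = I1 1.
Proof. rewrite /O1 /I1 /chain1 sq0 /in1 /out1 expR0; ring. Qed.
Let match2 : O2 1 = I2 1.
Proof. rewrite /O2 /I2 /chain2 sq0 /in1 /in2 /out1 /out2 expR0; ring. Qed.
Let end0 : O0 T = 0.
Proof. rewrite /O0 /chain0 sqT /out0; by field. Qed.
Let end1 : O1 T = 0.
Proof. rewrite /O1 /chain1 sqT /out1; by field. Qed.
Let end2 : O2 T = 0.
Proof. rewrite /O2 /chain2 sqT /out1 /out2; by field. Qed.
Let start1 : I1 0 = 0.
Proof. by rewrite /I1 /chain1 mul0r mulr0. Qed.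
Let start3 : I3 0 = 0.
Proof. by rewrite /I3 /chain3 expr0n/= !mul0r !mulr0 addr0. Qed.

Let in1_ge0 x : 0 <= in1 kap x.
Proof. by rewrite /in1 addr_ge0 ?mulr_ge0 ?expR_ge0// subr_ge0. Qed.
Let in2_ge0 x : 0 <= in2 kap x.
Proof. by rewrite /in2 mulr_ge0 ?expR_ge0. Qed.

(** Positivity of [I2] and [I4] lets each serve as its own majorant in [le_normr_Rintegral_FTC]. *)
Let I2_ge0 t : 0 <= I2 t.
Proof.
rewrite /I2 /chain2; apply: addr_ge0; apply: mulr_ge0 => //.
  by rewrite divr_ge0// ltW.
by apply: mulr_ge0; [exact: sqr_ge0|exact: in2_ge0].
Qed.
Let I4_ge0 t : 0 <= I4 t.
Proof.
have t4 : 0 <= t ^+ 4 by rewrite (exprM t 2 2) sqr_ge0.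
have l0 := ltW lam0.
rewrite /I4 /chain4; apply: addr_ge0; [apply: addr_ge0|]; apply: mulr_ge0.
- by [].
- exact: in2_ge0.
- by rewrite mulr_ge0.
- by apply: mulr_ge0; [exact: sqr_ge0|exact: in2_ge0].
- by rewrite mulr_ge0 ?sqr_ge0.
- by apply: mulr_ge0 => //; exact: in2_ge0.
Qed.

Let out_bounds (x : R) : 0 <= x <= 1 ->
  [/\ `|out0 kap x| <= 6, `|out1 kap x| <= 6, `|out2 kap x| <= 20,
      `|out3 kap x| <= 28 & `|out4 kap x| <= 18].
Proof.
move=> /andP[x0 x1]; have k0 := kap0; have k1 := kap1.
have x2 : 0 <= x ^+ 2 <= 1 by rewrite sqr_ge0 expr_le1.
have x3 : 0 <= x ^+ 3 <= 1 by rewrite exprn_ge0 ?expr_le1.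
have x4 : 0 <= x ^+ 4 <= 1 by rewrite exprn_ge0 ?expr_le1.
have P (y : R) : 0 <= y <= 1 -> 0 <= kap * y <= 1.
  by move=> /andP[y0 y1]; rewrite mulr_ge0// mulr_ile1.
have px : 0 <= kap * x <= 1 by apply: P; rewrite x0 x1.
have [p2 p3 p4] := And3 (P _ x2) (P _ x3) (P _ x4).
move: x2 x3 x4 px p2 p3 p4 => /andP[? ?] /andP[? ?] /andP[? ?] /andP[? ?] /andP[? ?] /andP[? ?] /andP[? ?].
split; rewrite ler_norml /out0 /out1 /out2 /out3 /out4; apply/andP; split; lra.
Qed.

Let cI2 := is_derive_continuous dI2.
Let cO2 := is_derive_continuous dO2.

Let int_ItV (f : R -> R) (rho M a b : R) : a <= b -> continuous f ->
  (forall t, a <= t <= b -> `|f t| <= M) ->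
  `|\int[leb]_(t in `[a, b]) (f t * cos (rho * t))| <= M * (b - a).
Proof.
move=> ab cf fM; apply: le_normr_Rintegral_bound => //.
  exact: continuous_mul_cos.
by move=> t tab; rewrite (le_trans (ler_normM_cos _ _))// fM.
Qed.

(** Inside the ball the integral of [I4] is [I3 1 = O(lam)]. In the layer [|O4| <= 4100 lam^2] over
    a length at most [1 / lam]. With the boundary terms the total is [464 + 20 + 2300 + 20 + 4100],
    below [7000], times [lam]. *)
Let bound4 rho : `|rho ^+ 4 * profile_transform rho| <= (70 * 100) * lam.
Proof.
rewrite transformE mulrDr (cos_parts4 rho ltr01 dI0 dI1 dI2 dI3 cI4).
rewrite (cos_parts4 rho T1 dO0 dO1 dO2 dO3 cO4).
rewrite -/I0 -/I1 -/I2 -/I3 -/I4 -/O0 -/O1 -/O2 -/O3 -/O4.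
rewrite match0 match1 match2 end0 end1 end2 start1 start3 !mulr0 sin0 !mulr1.
set A := \int[leb]_(t in _) _; set B := \int[leb]_(t in _) _.
rewrite [X in `|X|](_ : _ = O3 1 * cos rho - I3 1 * cos rho - O3 T * cos (rho * T) + (A + B));
  last by ring.
have IA : `|A| <= I3 1 - I3 0.
  apply: (le_normr_Rintegral_FTC ltr01 dI3 cI4); first exact: continuous_mul_cos.
  move=> t _; rewrite (le_trans (ler_normM_cos _ _))// ger0_norm//; exact: I4_ge0.
have IB : `|B| <= (41 * 100) * lam ^+ 2 * (T - 1).
  apply: int_ItV => //; first exact: ltW.
  move=> t tT; have [_ _ b2 b3 b4] := out_bounds (sq_out tT).
  move: tT => /andP[t1 tT].
  have t2 : `|t ^+ 2| <= 2.
    rewrite ger0_norm ?sqr_ge0//; have : t ^+ 2 <= T ^+ 2.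
      by rewrite ler_pXn2r// nnegrE ?(le_trans ler01)// ltW// (lt_trans ltr01).
    rewrite T2; move: laml1; lra.
  have t4 : `|t ^+ 4| <= 4.
    rewrite (exprM t 2 2) normrX -[4](_ : 2 * 2 = _); last by rewrite -natrM.
    by rewrite expr2 ler_pM.
  have l2 : 1 <= lam ^+ 2 by rewrite expr_ge1// ltW.
  have l12 : lam <= lam ^+ 2 by rewrite expr2 ler_peMl// ltW.
  rewrite /O4 /chain4 (le_trans (ler_normD _ _))//.
  apply: (@le_trans _ _ ((12 * 20 + 48 * lam * (2 * 28)) + 16 * lam ^+ 2 * (4 * 18))); last by lra.
  apply: lerD.
    rewrite (le_trans (ler_normD _ _))// lerD//.
      by rewrite normrM ger0_norm// ler_pM2l.
    rewrite normrM ger0_norm ?mulr_ge0 ?(ltW lam0)// ler_wpM2l ?mulr_ge0 ?(ltW lam0)//.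
    by rewrite normrM ler_pM.
  have c16 : 0 <= 16 * lam ^+ 2 by rewrite mulr_ge0 ?sqr_ge0.
  rewrite normrM (ger0_norm c16) ler_wpM2l//.
  by rewrite normrM ler_pM.
have IB' : `|B| <= (41 * 100) * lam.
  apply: (le_trans IB); have : lam ^+ 2 * (T - 1) <= lam ^+ 2 * lam^-1.
    by rewrite ler_wpM2l ?sqr_ge0.
  have -> : lam ^+ 2 * lam^-1 = lam by field.
  lra.
have k0 := kap0; have k1 := kap1; have l1 := lam1.
have kl : kap * lam <= lam by rewrite ler_piMl// ltW.
have kl0 : 0 <= kap * lam by rewrite mulr_ge0// ltW.
have i31 : I3 1 = 12 * kap + 8 * (kap * lam).
  by rewrite /I3 /chain3 sq0 /in2 expR0; ring.
have o31 : O3 1 = 12 * kap - 8 * lam * (2 * (3 + 2 * kap)).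
  by rewrite /O3 /chain3 sq0 /out2 /out3; ring.
have no31 : `|O3 1| <= 464 * lam.
  rewrite o31 ler_norml; apply/andP; split; lra.
have no3T : `|O3 T| <= (23 * 100) * lam.
  have [//|_ _ b2 b3 _] := out_bounds (x := 1); first by rewrite ler01 lexx.
  rewrite /O3 /chain3 sqT (le_trans (ler_normD _ _))//.
  apply: (@le_trans _ _ (12 * (2 * 20) + 8 * lam * (8 * 28))); last by lra.
  have nT : `|T| <= 2 by rewrite ger0_norm ltW// (lt_trans ltr01).
  apply: lerD.
    by rewrite normrM ger0_norm// ler_pM2l// normrM ler_pM.
  rewrite normrM ger0_norm ?mulr_ge0 ?(ltW lam0)// ler_wpM2l ?mulr_ge0 ?(ltW lam0)//.
  rewrite normrM ler_pM// normrX (_ : 8 = 2 ^+ 3) ?lerXn2r ?nnegrE//.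
  by rewrite -natrX.
rewrite (le_trans (ler_normD4 _ _ _ _ _))//.
have := ler_normM_cos (I3 1) rho; have := ler_normM_cos (O3 1) rho.
have := ler_normM_cos (O3 T) (rho * T).
have : `|I3 1| <= 20 * lam by rewrite i31 ler_norml; apply/andP; split; lra.
move: IA IB' no31 no3T; rewrite start3 subr0 i31; lra.
Qed.

(** All boundary terms cancel. The inner integral is at most [I1 1 = 2 / lam], and the layer adds
    [172 / lam]. *)
Let bound2 rho : `|rho ^+ 2 * profile_transform rho| <= 174 * lam^-1.
Proof.
rewrite transformE mulrDr (cos_parts2 rho ltr01 dI0 dI1 cI2).
rewrite (cos_parts2 rho T1 dO0 dO1 cO2).
rewrite -/I0 -/I1 -/I2 -/O0 -/O1 -/O2.
rewrite match0 match1 end0 end1 start1 !mulr0 sin0 !mulr1.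
set A := \int[leb]_(t in _) _; set B := \int[leb]_(t in _) _.
rewrite [X in `|X|](_ : _ = - (A + B)); last by ring.
have IA : `|A| <= I1 1 - I1 0.
  apply: (le_normr_Rintegral_FTC ltr01 dI1 cI2); first exact: continuous_mul_cos.
  move=> t _; rewrite (le_trans (ler_normM_cos _ _))// ger0_norm//; exact: I2_ge0.
have IB : `|B| <= 172 * (T - 1).
  apply: int_ItV => //; first exact: ltW.
  move=> t tT; have [_ b1 b2 _ _] := out_bounds (sq_out tT).
  move: tT => /andP[t1 tT].
  have t2 : `|t ^+ 2| <= 2.
    rewrite ger0_norm ?sqr_ge0//; have : t ^+ 2 <= T ^+ 2.
      by rewrite ler_pXn2r// nnegrE ?(le_trans ler01)// ltW// (lt_trans ltr01).
    rewrite T2; move: laml1; lra.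
  rewrite /O2 /chain2 (le_trans (ler_normD _ _))//.
  apply: (@le_trans _ _ (2 * 6 + 4 * (2 * 20))); last by lra.
  have c2 : 0 <= 2 / lam by rewrite divr_ge0// ltW.
  have c2' : 2 / lam <= 2 by rewrite ler_piMr.
  apply: lerD; first by rewrite normrM (ger0_norm c2) ler_pM.
  by rewrite normrM ger0_norm// ler_wpM2l// normrM ler_pM.
have i1 : I1 1 = 2 * lam^-1.
  by rewrite /I1 /chain1 sq0 /in1 expR0; ring.
rewrite normrN (le_trans (ler_normD _ _))//.
move: IA IB T_le; rewrite start1 i1; lra.
Qed.

(** The prefactor [lam^-2] meets [|in0| <= 3 lam], whose linear term can reach [- lam], and
    [|out0| <= 6]. *)
Let bound0 rho : `|profile_transform rho| <= 9 * lam^-1.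
Proof.
rewrite transformE (le_trans (ler_normD _ _))//.
have k0 := kap0; have k1 := kap1; have l1 := lam1.
have ll : lam^-1 * lam^-1 <= lam^-1 by rewrite ler_piMr// ltW.
have ll0 : 0 <= lam ^- 2 by rewrite invr_ge0 sqr_ge0.
have A : `|\int[leb]_(t in `[0, 1]) (I0 t * cos (rho * t))| <= 3 * lam^-1 * (1 - 0).
  apply: int_ItV => //; first exact: is_derive_continuous dI0.
  move=> t t01; have x0 := sq_in t01.
  have xl : - lam <= squeeze lam t.
    rewrite /squeeze -[- lam]mulrN1 ler_wpM2l ?(ltW lam0)// lerBrDr addrC subrr sqr_ge0//.
  have e0 := expR_ge0 (squeeze lam t).
  have e1 : expR (squeeze lam t) <= 1 by rewrite expR_le1.
  have ke0 : 0 <= kap * expR (squeeze lam t) by rewrite mulr_ge0.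
  have ke1 : kap * expR (squeeze lam t) <= 1 by rewrite mulr_ile1.
  have kx : (1 - kap) * squeeze lam t <= 0 by rewrite mulr_ge0_le0// subr_ge0.
  have kx' : (1 - kap) * (- lam) <= (1 - kap) * squeeze lam t by rewrite ler_wpM2l// subr_ge0.
  have kl : 0 <= kap * lam by rewrite mulr_ge0// ltW.
  have : `|in0 kap (squeeze lam t)| <= 3 * lam.
    rewrite /in0 ler_norml; apply/andP; split; lra.
  rewrite /I0 /chain0 normrM (ger0_norm ll0) => H.
  have -> : 3 * lam^-1 = lam ^- 2 * (3 * lam) by field.
  by rewrite ler_wpM2l.
have B : `|\int[leb]_(t in `[1, T]) (O0 t * cos (rho * t))| <= 6 * lam^-1 * (T - 1).
  apply: int_ItV; [exact: ltW|exact: is_derive_continuous dO0|].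
  move=> t tT; have [b0 _ _ _ _] := out_bounds (sq_out tT).
  rewrite /O0 /chain0 normrM (ger0_norm ll0) mulrC ler_pM// expr2 invfM//.
have : 6 * lam^-1 * (T - 1) <= 6 * lam^-1 * 1.
  rewrite ler_wpM2l ?mulr_ge0 ?(ltW laml0)//; move: T_le laml1; lra.
move: A B; lra.
Qed.

Lemma profile_transform_le rho : `|profile_transform rho| <=
  (74 * 100) * lam / ((1 + rho ^+ 2) * (lam ^+ 2 + rho ^+ 2)).
Proof.
exact: decay_interpolation lam1 (bound0 rho) (bound2 rho) (bound4 rho).
Qed.

End ProfileTransform.

(** * Fourier transforms of radial functions *)

Section RadialFourier.
Context {R : realType}.
Notation mR := (measurableTypeR R).
Notation leb := (@lebesgue_measure R).
Notation mu := (@mu3 R).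
Implicit Types (h f phi : R -> R) (x xi : R3 R).

Lemma dot3E x xi : dot3 x xi = x.1.1 * xi.1.1 + x.1.2 * xi.1.2 + x.2 * xi.2.
Proof. by rewrite /dot3 /dot !big_ord_recl big_ord0 /row3 !mxE/= addr0 addrA. Qed.

Lemma dot3_ge0 x : 0 <= dot3 x x.
Proof. exact: dot_ge0. Qed.

Lemma measurable_dot3 xi : measurable_fun setT (fun x : R3 R => dot3 x xi).
Proof. by under eq_fun do rewrite dot3E; meas. Qed.

Lemma measurable_dot3_diag : measurable_fun setT (fun x : R3 R => dot3 x x).
Proof. by under eq_fun do rewrite dot3E; meas. Qed.

(** Cubes stand in for balls because the product measure gives their volume at once. *)
Definition box (r : R) : set (R3 R) := (`[- r, r] `*` `[- r, r]) `*` `[- r, r].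

Lemma measurable_box r : measurable (box r).
Proof. by apply: measurableX => //; apply: measurableX. Qed.

Lemma mu3_box r : 0 <= r -> mu (box r) = ((2 * r) ^+ 3)%:E.
Proof.
move=> r0.
have I : leb `[- r, r] = (2 * r)%:E.
  rewrite lebesgue_measure_itv/= lte_fin.
  case: ifPn => [_|]; first by rewrite opprK -mulr2n mulr_natl.
  rewrite -leNgt => H; have -> : r = 0 by apply/eqP; rewrite eq_le r0 andbT; lra.
  by rewrite mulr0.
rewrite /mu3 [LHS](@product_measure1E _ _ (mR * mR)%type mR R (@leb2 R) leb)//; last first.
  exact: measurableX.
rewrite [X in (X * _)%E](@product_measure1E _ _ mR mR)//.
transitivity ((2 * r)%:E * (2 * r)%:E * (2 * r)%:E)%E.
  by congr (_ * _ * _)%E; exact: I.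
by rewrite -!EFinM; congr _%:E; ring.
Qed.

Lemma sub_box x r : 0 <= r -> dot3 x x <= r ^+ 2 -> box r x.
Proof.
move=> r0; rewrite dot3E => H.
have b (y : R) : y * y <= r ^+ 2 -> - r <= y <= r.
  by move=> yr; rewrite -ler_norml -(ler_pXn2r (n := 2))// ?nnegrE// real_normK ?num_real// expr2.
have [s1 s2 s3] := And3 (sqr_ge0 x.1.1) (sqr_ge0 x.1.2) (sqr_ge0 x.2).
rewrite !expr2 in s1 s2 s3.
by split; [split|]; rewrite /= in_itv/=; apply: b; lra.
Qed.

Lemma integrable_compact_support (u : R3 R -> R) (M : R) :
  measurable_fun setT u -> (forall x, `|u x| <= M) ->
  (forall x, 4 < dot3 x x -> u x = 0) -> mu.-integrable setT (EFin \o u).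
Proof.
move=> mu_ uM u0.
have -> : EFin \o u = EFin \o (u \_ (box 2)).
  apply/funext => x /=; rewrite patchE; case: ifPn => //; rewrite notin_setE => nb.
  rewrite u0// ltNge; apply/negP => H; apply: nb; apply: sub_box => //.
  by rewrite expr2 -natrM.
rewrite -restrict_EFin; apply/(integrable_mkcond _ (measurable_box 2)).
apply: measurable_bounded_integrable.
- exact: measurable_box.
- by rewrite [X in (X < _)%E](@mu3_box 2)// ltry.
- exact: measurable_funS mu_.
- exists M; split; first exact: num_real.
  by move=> N MN x _ /=; rewrite (le_trans (uM x))// ltW.
Qed.

Lemma integrable_radial h (M : R) (v : R3 R -> R) :
  measurable_fun setT h -> (forall s, `|h s| <= M) -> (forall s, 4 < s -> h s = 0) ->
  measurable_fun setT v -> (forall x, `|v x| <= 2) ->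
  mu.-integrable setT (EFin \o (fun x => h (dot3 x x) * v x)).
Proof.
move=> mh hM h4 mv v2; apply: (@integrable_compact_support _ (M * 2)).
- apply: measurable_funM => //.
  by apply: (@measurableT_comp _ _ _ _ _ _ h) => //; exact: measurable_dot3_diag.
- by move=> x; rewrite normrM ler_pM.
- by move=> x x4; rewrite h4// mul0r.
Qed.

Lemma Rintegral_even_split f : continuous f -> (forall t, 2 <= `|t| -> f t = 0) ->
  \int[leb]_t f t = \int[leb]_(t in `[0, 2]) (f t + f (- t)).
Proof.
move=> cf f2.
have -> : \int[leb]_t f t = \int[leb]_(t in `[- 2, 2]) f t.
  rewrite [RHS]Rintegral_mkcond; apply: eq_Rintegral => t _; rewrite patchE.
  case: ifPn => //; rewrite notin_setE/= in_itv/= -ler_norml => /negP; rewrite -ltNge => H.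
  by rewrite f2// ltW.
rewrite (@Rintegral_itv_split _ _ (- 2) 0 2)//.
rewrite RintegralD//; last 2 first.
- exact: continuous_integrable_itv.
- apply: (@continuous_integrable_itv _ (fun t : R => f (- t))) => t.
  by apply: (@continuous_comp R R R -%R f); [exact: opp_continuous|exact: cf].
rewrite addrC; congr (_ + _).
rewrite /Rintegral -{1}[0]oppr0 integration_by_substitution_oppr//.
exact: continuous_subspaceT.
Qed.

(** [slice_integral] wants a nonnegative wave, so it is applied to [1] and to [1 + phi] and the
    results are subtracted; [|phi| <= 1] makes the latter nonnegative. *)
Lemma radial_fourier_integral h (H : R -> R) phi (M : R) xi :
  (forall s, 0 <= h s) -> continuous h -> (forall s, h s <= M) ->
  (forall s, 4 < s -> h s = 0) ->
  (forall s : R, is_derive s 1 H (h s)) -> (forall s, 4 <= s -> H s = 0) ->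
  continuous phi -> (forall t, `|phi t| <= 1) -> xi.2 != 0 ->
  let rho := Num.sqrt (dot3 xi xi) in
  \int[mu]_x (h (dot3 x x) * phi (dot3 x xi)) =
  \int[leb]_(t in `[0, 2]) (- pi * (H (t ^+ 2) * (phi (rho * t) + phi (- (rho * t))))).
Proof.
move=> h0 ch hM h4 dH H4 cphi phi1 xi2 rho.
have mh : measurable_fun setT h := continuous_measurable_fun ch.
have mphi : measurable_fun setT phi := continuous_measurable_fun cphi.
have cH := is_derive_continuous dH.
have hM' s : `|h s| <= M by rewrite ger0_norm.
pose F (t : R) := pi * - H (t ^+ 2).
have cF : continuous F.
  move=> t; apply: cvgM; first exact: cvg_cst.
  apply: cvgN; apply: (@continuous_comp R R R (fun t : R => t ^+ 2) H); last exact: cH.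
  exact: exprn_continuous.
have F2 (t : R) : 2 <= `|t| -> F t = 0.
  move=> t2; rewrite /F H4 ?oppr0 ?mulr0//.
  have : 2 ^+ 2 <= `|t| ^+ 2 by rewrite ler_pXn2r// nnegrE.
  by rewrite real_normK ?num_real//; apply: le_trans; rewrite expr2 -natrM.
have cphir : continuous (fun t : R => phi (rho * t)).
  move=> t; apply: (@continuous_comp R R R (fun t : R => rho * t) phi); last exact: cphi.
  by apply: cvgM; [exact: cvg_cst|exact: cvg_id].
have slice (psi : R -> R) : continuous psi -> (forall t, 0 <= psi t) ->
    \int[mu]_x (h (dot3 x x) * psi (dot3 x xi)) = \int[leb]_t (F t * psi (rho * t)).
  move=> cpsi psi0; rewrite /Rintegral; congr fine.
  have := slice_integral h0 ch dH H4 xi.1.1 xi.1.2 xi2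
    (continuous_measurable_fun cpsi) psi0.
  have -> : Num.sqrt (xi.1.1 ^+ 2 + xi.1.2 ^+ 2 + xi.2 ^+ 2) = rho.
    by rewrite /rho dot3E !expr2.
  move=> <-; apply: eq_integral => x _; rewrite (dot3E x xi); congr (_ * psi _)%:E; ring.
have mdot : measurable_fun setT (fun x : R3 R => phi (dot3 x xi)).
  by apply: (@measurableT_comp _ _ _ _ _ _ phi) => //; exact: measurable_dot3.
have icphi : mu.-integrable setT (EFin \o (fun x => h (dot3 x x) * phi (dot3 x xi))).
  by apply: (integrable_radial mh hM' h4 mdot) => x; rewrite (le_trans (phi1 _))// ler1n.
have i1 : mu.-integrable setT (EFin \o (fun x => h (dot3 x x) * 1)).
  apply: (integrable_radial (v := fun=> 1) mh hM' h4) => [|x]; first exact: measurable_cst.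
  by rewrite normr1 ler1n.
have E1 : \int[mu]_x (h (dot3 x x) * (1 + phi (dot3 x xi))) =
    \int[mu]_x (h (dot3 x x) * 1) + \int[mu]_x (h (dot3 x x) * phi (dot3 x xi)).
  by rewrite -RintegralD//; apply: eq_Rintegral => x _; rewrite mulrDr.
have leb_int (f : R -> R) : continuous f -> leb.-integrable setT (EFin \o (fun t => F t * f t)).
  move=> cf.
  have -> : EFin \o (fun t => F t * f t) = EFin \o ((fun t => F t * f t) \_ `[- 2, 2]).
    apply/funext => t /=; rewrite patchE; case: ifPn => //.
    rewrite notin_setE/= in_itv/= -ler_norml => /negP; rewrite -ltNge => t2.
    by rewrite F2 ?mul0r// ltW.
  have mI : measurable (`[- 2, 2]%classic : set mR) by exact: measurable_itv.
  rewrite -restrict_EFin; apply/(@integrable_mkcond _ mR R leb _ _ mI).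
  by apply: continuous_integrable_itv => t; apply: cvgM; [exact: cF|exact: cf].
have E2 : \int[leb]_t (F t * (1 + phi (rho * t))) =
    \int[leb]_t (F t * 1) + \int[leb]_t (F t * phi (rho * t)).
  rewrite -RintegralD//; last 2 first.
  - by apply: (leb_int (fun=> 1)) => t; exact: cvg_cst.
  - exact: (leb_int (fun t => phi (rho * t))).
  by apply: eq_Rintegral => x _; rewrite mulrDr.
have S1 : \int[mu]_x (h (dot3 x x) * 1) = \int[leb]_t (F t * 1).
  by apply: (slice (fun=> 1)) => // t; exact: cvg_cst.
have := slice (fun t => 1 + phi t) _ _.
rewrite E1 E2 S1 => /(_ _ _)/addrI ->.
- rewrite (@Rintegral_even_split (fun t => F t * phi (rho * t))).
  + apply: eq_Rintegral => t _; rewrite /F sqrrN (mulrN rho t); ring.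
  + by move=> t; apply: cvgM; [exact: cF|exact: cphir].
  + by move=> t t2; rewrite F2// mul0r.
- by move=> t; apply: cvgD; [exact: cvg_cst|exact: cphi].
- by move=> t; have := phi1 t; rewrite ler_norml => /andP[]; lra.
Qed.

End RadialFourier.

(** * Radial functions with a prescribed Fourier majorant *)

Section Admissible.
Context {R : realType}.
Notation mR := (measurableTypeR R).
Notation leb := (@lebesgue_measure R).
Notation mu := (@mu3 R).
Implicit Types (h K : R -> R) (x xi : R3 R).

Definition freq (xi : R3 R) : R := Num.sqrt (dot3 xi xi).

Lemma freq_ge0 xi : 0 <= freq xi.
Proof. exact: sqrtr_ge0. Qed.

Definition cos_integral h xi := \int[mu]_x (h (dot3 x x) * cos (dot3 x xi)).
Definition sin_integral h xi := \int[mu]_x (h (dot3 x x) * sin (dot3 x xi)).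

(* [K] bounds the Fourier transform of [h (|x|^2)] off the null plane on which
   [slice_integral] says nothing. *)
Definition admissible h K :=
  [/\ continuous h, exists M, forall s, `|h s| <= M, forall s, 4 < s -> h s = 0
    & forall xi, xi.2 != 0 ->
      `|cos_integral h xi| <= K (freq xi) /\ `|sin_integral h xi| <= K (freq xi)].

Lemma measurable_cos_dot3 xi : measurable_fun setT (fun x : R3 R => cos (dot3 x xi)).
Proof.
apply: (@measurableT_comp _ _ _ _ _ _ (@cos R)); last exact: measurable_dot3.
exact: continuous_measurable_fun (@continuous_cos R).
Qed.

Lemma measurable_sin_dot3 xi : measurable_fun setT (fun x : R3 R => sin (dot3 x xi)).
Proof.
apply: (@measurableT_comp _ _ _ _ _ _ (@sin R)); last exact: measurable_dot3.
exact: continuous_measurable_fun (@continuous_sin R).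
Qed.

Lemma admissible_integrable h K xi : admissible h K ->
  mu.-integrable setT (EFin \o (fun x => h (dot3 x x) * cos (dot3 x xi))) /\
  mu.-integrable setT (EFin \o (fun x => h (dot3 x x) * sin (dot3 x xi))).
Proof.
move=> [ch [M hM] h4 _]; have mh := continuous_measurable_fun ch.
split; apply: (integrable_radial mh hM h4).
- exact: measurable_cos_dot3.
- by move=> x; rewrite (le_trans (cos_max _))// ler1n.
- exact: measurable_sin_dot3.
- by move=> x; rewrite (le_trans (sin_max _))// ler1n.
Qed.

Lemma admissible_le h K K' : (forall r, 0 <= r -> K r <= K' r) ->
  admissible h K -> admissible h K'.
Proof.
move=> KK' [ch hM h4 Kh]; split => // xi /Kh[c s].
by split; [apply: (le_trans c)|apply: (le_trans s)]; apply: KK'; exact: freq_ge0.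
Qed.

Lemma admissibleD h1 K1 h2 K2 : admissible h1 K1 -> admissible h2 K2 ->
  admissible (fun s => h1 s + h2 s) (fun r => K1 r + K2 r).
Proof.
move=> A1 A2; have [c1 [M1 hM1] z1 b1] := A1; have [c2 [M2 hM2] z2 b2] := A2.
split.
- by move=> s; exact: cvgD (c1 s) (c2 s).
- exists (M1 + M2) => s; rewrite (le_trans (ler_normD _ _))//; exact: lerD.
- by move=> s s4; rewrite z1// z2// addr0.
move=> xi x0; have [ic1 is1] := admissible_integrable xi A1.
have [ic2 is2] := admissible_integrable xi A2.
have [bc1 bs1] := b1 _ x0; have [bc2 bs2] := b2 _ x0.
split.
- have -> : cos_integral (fun s => h1 s + h2 s) xi = cos_integral h1 xi + cos_integral h2 xi.
    rewrite /cos_integral -RintegralD//; apply: eq_Rintegral => x _; exact: mulrDl.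
  by rewrite (le_trans (ler_normD _ _))// lerD.
- have -> : sin_integral (fun s => h1 s + h2 s) xi = sin_integral h1 xi + sin_integral h2 xi.
    rewrite /sin_integral -RintegralD//; apply: eq_Rintegral => x _; exact: mulrDl.
  by rewrite (le_trans (ler_normD _ _))// lerD.
Qed.

Lemma admissibleZ c h K : admissible h K ->
  admissible (fun s => c * h s) (fun r => `|c| * K r).
Proof.
move=> A1; have [c1 [M1 hM1] z1 b1] := A1.
split.
- by move=> s; apply: cvgM; [exact: cvg_cst|exact: c1].
- by exists (`|c| * M1) => s; rewrite normrM ler_wpM2l.
- by move=> s s4; rewrite z1// mulr0.
move=> xi x0; have [ic1 is1] := admissible_integrable xi A1.
have [bc1 bs1] := b1 _ x0.
split.
- have -> : cos_integral (fun s => c * h s) xi = c * cos_integral h xi.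
    rewrite /cos_integral -RintegralZl//; apply: eq_Rintegral => x _; exact: esym (mulrA _ _ _).
  by rewrite normrM ler_wpM2l.
- have -> : sin_integral (fun s => c * h s) xi = c * sin_integral h xi.
    rewrite /sin_integral -RintegralZl//; apply: eq_Rintegral => x _; exact: esym (mulrA _ _ _).
  by rewrite normrM ler_wpM2l.
Qed.

Lemma admissible_sum (N : nat) (h : nat -> R -> R) (K : nat -> R -> R) :
  (forall n, admissible (h n) (K n)) ->
  admissible (fun s => \sum_(n < N) h n s) (fun r => \sum_(n < N) K n r).
Proof.
move=> A; elim: N => [|N IH].
  (* The empty sum is treated as [0 * h 0], with bound [|0| * K 0]. *)
  have [c1 [M1 hM1] z1 b1] := A 0%N.
  apply: (@admissible_le _ (fun r => `|0| * K 0%N r)).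
    by move=> r _; rewrite big_ord0 normr0 mul0r.
  rewrite (_ : (fun s => \sum_(n < 0) h n s) = (fun s => 0 * h 0%N s)); first exact: admissibleZ.
  by apply/funext => s; rewrite big_ord0 mul0r.
rewrite (_ : (fun s => \sum_(n < N.+1) h n s) = (fun s => \sum_(n < N) h n s + h N s)); last first.
  by apply/funext => s; rewrite big_ord_recr.
rewrite (_ : (fun s => \sum_(n < N.+1) K n s) = (fun s => \sum_(n < N) K n s + K N s)); last first.
  by apply/funext => s; rewrite big_ord_recr.
exact: admissibleD IH (A N).
Qed.

Lemma admissible_profile (kap lam : R) : 0 <= kap -> kap <= 1 -> 1 <= lam ->
  admissible (profile kap lam)
    (fun r => 2 * pi * (74 * 100 * lam / ((1 + r ^+ 2) * (lam ^+ 2 + r ^+ 2)))).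
Proof.
move=> k0 k1 l1.
have h0 := profile_ge0 k0 k1 l1.
have h4 (s : R) : 4 < s -> profile kap lam s = 0.
  by move=> s4; apply: profile_out => //; lra.
have H4 (s : R) : 4 <= s -> antiprofile kap lam s = 0.
  move=> s4; apply: antiprofile_out.
  have : 1 * (s - 1) <= lam * (s - 1) by rewrite ler_wpM2r//; lra.
  lra.
split => //.
- exact: continuous_profile.
- by exists 4 => s; rewrite ger0_norm// profile_le.
move=> xi x0.
have FI phi := @radial_fourier_integral R _ _ phi 4 xi h0 (@continuous_profile R kap lam)
  (profile_le k0 k1 l1) h4 (is_derive_antiprofile kap l1) H4.
have cH : continuous (fun t : R => antiprofile kap lam (t ^+ 2)).
  move=> t; apply: (@continuous_comp R R R (fun t : R => t ^+ 2) (antiprofile kap lam)).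
    exact: exprn_continuous.
  exact: continuous_antiprofile.
have b0 : 0 <= 74 * 100 * lam / ((1 + freq xi ^+ 2) * (lam ^+ 2 + freq xi ^+ 2)).
  have l0 : 0 <= lam by exact: le_trans l1.
  by rewrite divr_ge0 ?mulr_ge0 ?addr_ge0 ?sqr_ge0.
have p0 := pi_ge0 R.
split.
- rewrite /cos_integral FI//; [|exact: continuous_cos|exact: cos_max].
  rewrite (@eq_Rintegral _ _ _ leb _ (fun t => - (2 * pi) * (antiprofile kap lam (t ^+ 2) * cos (freq xi * t)))); last first.
    by move=> t _; rewrite cosN /freq; ring.
  rewrite RintegralZl//; last first.
    apply: (@continuous_integrable_itv _ (fun t : R => antiprofile kap lam (t ^+ 2) * cos (freq xi * t))).
    exact: continuous_mul_cos.
  have p2 : 0 <= 2 * pi :> R by rewrite mulr_ge0.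
  rewrite normrM normrN (ger0_norm p2) ler_wpM2l//.
  exact: profile_transform_le.
- rewrite /sin_integral FI//; [|exact: continuous_sin|exact: sin_max].
  rewrite (@eq_Rintegral _ _ _ leb _ (fun=> 0)); last first.
    by move=> t _; rewrite sinN subrr !mulr0.
  by rewrite Rintegral_cst// mul0r normr0; apply: mulr_ge0 => //; apply: mulr_ge0.
Qed.

(* [a / (a + r + 1)] telescopes along [a = 2 ^ n] and its increments dominate the summands. *)
Lemma sum_dyadic_le (N : nat) (r : R) : 0 <= r ->
  \sum_(n < N) (2 ^+ n / ((2 ^+ n) ^+ 2 + r ^+ 2)) <=
  9 / ((1 + r) * (1 + r / 2 ^+ N)).
Proof.
move=> r0.
have step (a : R) : 1 <= a ->
    (1 + r) * (a / (a ^+ 2 + r ^+ 2)) <= 9 * (2 * a / (2 * a + r + 1) - a / (a + r + 1)).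
  move=> a1.
  have d1 : 0 < a ^+ 2 + r ^+ 2 by rewrite ltr_pwDl ?sqr_ge0// exprn_gt0//; lra.
  have d2 : 0 < 2 * a + r + 1 by lra.
  have d3 : 0 < a + r + 1 by lra.
  have -> : 9 * (2 * a / (2 * a + r + 1) - a / (a + r + 1)) =
      (1 + r) * (9 * a / ((2 * a + r + 1) * (a + r + 1))).
    by field; rewrite !gt_eqF.
  rewrite ler_wpM2l//; first lra.
  rewrite ler_pdivrMr// mulrAC ler_pdivlMr; last by rewrite mulr_gt0.
  rewrite [9 * a]mulrC -mulrA ler_wpM2l//; first lra.
  (* Here [1 <= a] absorbs the units. With [2 a r <= a^2 + r^2] the product is at most
     [8.5 a^2 + 3.5 r^2], whence the constant [9]. *)
  have H1 : (2 * a + r + 1) * (a + r + 1) <= (3 * a + r) * (2 * a + r) by apply: ler_pM; lra.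
  have H2 : 2 * (a * r) <= a ^+ 2 + r ^+ 2.
    by have := sqr_ge0 (a - r); rewrite sqrrB; lra.
  apply: (le_trans H1); rewrite (_ : _ * _ = 6 * a ^+ 2 + 5 * (a * r) + r ^+ 2); last by ring.
  have := sqr_ge0 a; have := sqr_ge0 r; lra.
have tel : (1 + r) * \sum_(n < N) (2 ^+ n / ((2 ^+ n) ^+ 2 + r ^+ 2)) <=
    9 * (2 ^+ N / (2 ^+ N + r + 1)).
  elim: N => [|N IH].
    by rewrite big_ord0 mulr0 expr0 mulr_ge0// divr_ge0//; lra.
  rewrite big_ord_recr/= mulrDr (exprS 2 N).
  have := step (2 ^+ N) _; rewrite exprn_ege1 ?ler1n// => /(_ isT); lra.
have L0 : 0 < 2 ^+ N :> R by rewrite exprn_gt0.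
have d : 0 < (1 + r) * (1 + r / 2 ^+ N).
  by rewrite mulr_gt0 ?ltr_pwDl ?divr_ge0// ltW.
have d' : 0 < 1 + r / 2 ^+ N by rewrite ltr_pwDl ?divr_ge0// ltW.
move: tel; set S := \sum_(n < N) _ => tel.
rewrite ler_pdivlMr// (_ : S * _ = (1 + r) * S * (1 + r / 2 ^+ N)); last by ring.
rewrite -ler_pdivlMr//.
apply: (le_trans tel); rewrite ler_pM2l//.
rewrite ler_pdivrMr; last lra.
rewrite mulrC ler_pdivlMr//.
rewrite mulrDr mulr1 mulrC divfK ?gt_eqF//; lra.
Qed.

End Admissible.

(** * Sobolev norms of radial functions *)

Section SobolevBound.
Context {R : realType}.
Notation mR := (measurableTypeR R).
Notation mu := (@mu3 R).
Implicit Types (h K : R -> R) (x xi : R3 R).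

Lemma freq_sqr xi : freq xi ^+ 2 = dot3 xi xi.
Proof. by rewrite sqr_sqrtr// dot3_ge0. Qed.

(** On [2^(k-1) <= r <= 2^k], [(1 + r)^3 >= 8^k / 8] and [1 + r / 2^N >= (1 + 2^k / 2^N) / 2], which
    explains [16]. The factor [8^-k] is compensated by the volume [8 * 8^k] of the cube. *)
Definition dyadic_weight (B : R) (N k : nat) : R :=
  16 * B * ((8 ^+ k)^-1 / (1 + 2 ^+ k / 2 ^+ N)).

(** The terms below scale [2^N] are at most [1] each, and the later ones are dominated by a
    geometric series of sum [2]. This is where the count [N] of contributing shells enters. *)
Lemma sum_dyadic_tail (N n : nat) :
  \sum_(k < n) (1 + 2 ^+ k / 2 ^+ N : R)^-1 <= N%:R + 2.
Proof.
have L0 m : 0 < 2 ^+ m :> R by rewrite exprn_gt0.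
have t1 k : (1 + 2 ^+ k / 2 ^+ N : R)^-1 <= 1.
  by rewrite invf_le1 ?lerDl ?divr_ge0 ?ltW// ltr_pwDl// divr_ge0// ltW.
have small m : \sum_(k < m) (1 + 2 ^+ k / 2 ^+ N : R)^-1 <= m%:R.
  elim: m => [|m IH]; first by rewrite big_ord0.
  by rewrite big_ord_recr/= -(natr1 m) lerD.
have big m : \sum_(k < N + m) (1 + 2 ^+ k / 2 ^+ N : R)^-1 <= N%:R + 2 - 2 / 2 ^+ m.
  elim: m => [|m IH].
    by rewrite addn0 expr0 divr1 addrK.
  rewrite addnS big_ord_recr/= (le_trans (lerD IH (_ : _ <= (2 ^+ m)^-1)))//.
    rewrite lef_pV2 ?posrE ?ltr_pwDl ?divr_ge0 ?ltW//.
    by rewrite exprD [2 ^+ N * _]mulrC mulfK ?gt_eqF// ltrDr.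
  rewrite exprS invfM; have := L0 m; rewrite -invr_gt0; lra.
have [nN|Nn] := leqP n N.
  by rewrite (le_trans (small n))// -[leLHS]addr0 lerD// ler_nat.
rewrite -(subnKC (ltnW Nn)) (le_trans (big _))// gerDl oppr_le0 divr_ge0// ltW//.
Qed.

(** A single term suffices, the one for the least [k] with [freq xi <= 2^k]; nested cubes with
    nonnegative weights avoid cutting space into disjoint shells. *)
Lemma dyadic_majorant (B : R) (N : nat) xi : 0 <= B ->
  ((B / ((1 + freq xi) ^+ 3 * (1 + freq xi / 2 ^+ N)))%:E <=
   \sum_(k <oo) (dyadic_weight B N k * \1_(box (2 ^+ k)) xi)%:E)%E.
Proof.
move=> B0; set r := freq xi.
have r0 : 0 <= r := freq_ge0 xi.
have L0 m : 0 < 2 ^+ m :> R by rewrite exprn_gt0.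
have L1 m : 1 <= 2 ^+ m :> R by rewrite exprn_ege1// ler1n.
have w0 k : 0 <= dyadic_weight B N k.
  by rewrite !mulr_ge0// ?invr_ge0 ?exprn_ge0 ?addr_ge0 ?divr_ge0 ?ltW.
have exk : exists k, r <= 2 ^+ k.
  exists (Num.truncn r).+1.
  rewrite (le_trans (ltW (truncnS_gt _)))//.
  by rewrite -natrX ler_nat ltnW// ltn_expl.
case: (ex_minnP exk) => k rk kmin.
have inbox : box (2 ^+ k) xi.
  apply: sub_box; first exact: ltW.
  by rewrite -freq_sqr ler_pXn2r// nnegrE ltW.
apply: (@le_trans _ _ (dyadic_weight B N k)%:E).
  rewrite lee_fin /dyadic_weight.
  have d0 : 0 < 1 + r / 2 ^+ N by rewrite ltr_pwDl// divr_ge0// ltW.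
  have e0 : 0 < 1 + 2 ^+ k / 2 ^+ N :> R by rewrite ltr_pwDl// divr_ge0// ltW.
  case: k rk kmin inbox e0 => [|k] rk kmin inbox e0.
    rewrite !expr0 invr1 mul1r div1r.
    have a1 : 1 <= (1 + r) ^+ 3 * (1 + r / 2 ^+ N).
      rewrite mulr_ege1// ?exprn_ege1// ?lerDl// divr_ge0// ltW//.
    have b1 : 2^-1 <= (1 + (2 ^+ N)^-1 : R)^-1.
      rewrite lef_pV2 ?posrE// ?ltr_pwDl ?invr_ge0 ?(ltW (L0 N))//.
      have : (2 ^+ N : R)^-1 <= 1 by rewrite invf_le1.
      lra.
    apply: (@le_trans _ _ B); first by rewrite ler_pdivrMr ?ler_peMr// (lt_le_trans ltr01).
    have : 16 * B * 2^-1 <= 16 * B * (1 + (2 ^+ N)^-1)^-1 by rewrite ler_wpM2l// mulr_ge0.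
    lra.
  have kr : 2 ^+ k <= r.
    rewrite leNgt; apply/negP => H; have := kmin k (ltW H); by rewrite ltnn.
  have f0 : 0 < 1 + 2 ^+ k / 2 ^+ N :> R by rewrite ltr_pwDl// divr_ge0// ltW.
  have c3 : (2 ^+ k) ^+ 3 <= (1 + r) ^+ 3.
    by apply: lerXn2r; rewrite ?nnegrE; [exact: ltW|lra|lra].
  have cl : 1 + 2 ^+ k / 2 ^+ N <= 1 + r / 2 ^+ N by rewrite lerD2l ler_pM2r// invr_gt0.
  apply: (@le_trans _ _ (B / ((2 ^+ k) ^+ 3 * (1 + 2 ^+ k / 2 ^+ N)))).
    have r1 : 0 < 1 + r by lra.
    rewrite ler_wpM2l// lef_pV2 ?posrE ?mulr_gt0 ?exprn_gt0//.
    by rewrite ler_pM// ?exprn_ge0 ltW.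
  have -> : (8 : R) ^+ k.+1 = 8 * (2 ^+ k) ^+ 3.
    by rewrite exprS -exprM mulnC exprM; congr (8 * _ ^+ k); rewrite -natrX.
  rewrite (_ : 16 * B * _ = B / ((2 ^+ k) ^+ 3 * ((1 + 2 ^+ k.+1 / 2 ^+ N) / 2))); last first.
    by field; rewrite !gt_eqF//= gt_eqF.
  rewrite ler_wpM2l// lef_pV2 ?posrE ?mulr_gt0 ?exprn_gt0// ?divr_gt0//.
  rewrite ler_pM2l ?exprn_gt0//.
  rewrite ler_pdivrMr// exprS; lra.
have t0 n : (0 <= (dyadic_weight B N n * \1_(box (2 ^+ n)) xi)%:E)%E.
  by rewrite lee_fin mulr_ge0.
apply: le_trans (nneseries_lim_ge k.+1 (fun n _ _ => t0 n)).
rewrite big_mkord big_ord_recr/=.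
rewrite [X in (_ <= _ + X)%E](_ : _ = (dyadic_weight B N k)%:E); last first.
  by rewrite indicE mem_set// mulr1.
rewrite leeDr//; exact: sume_ge0.
Qed.

Lemma dyadic_integral (B : R) (N : nat) (f : R3 R -> \bar R) : 0 <= B ->
  measurable_fun setT f -> (forall xi, (0 <= f xi)%E) ->
  (forall xi, xi.2 != 0 ->
     (f xi <= (B / ((1 + freq xi) ^+ 3 * (1 + freq xi / 2 ^+ N)))%:E)%E) ->
  (\int[mu]_xi f xi <= (128 * B * (N%:R + 2))%:E)%E.
Proof.
move=> B0 mf f0 fB.
have w0 k : 0 <= dyadic_weight B N k.
  by rewrite !mulr_ge0// ?invr_ge0 ?exprn_ge0 ?addr_ge0 ?divr_ge0 ?exprn_ge0.
pose g k xi := (dyadic_weight B N k * \1_(box (2 ^+ k)) xi)%:E.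
have mg k : measurable_fun setT (g k).
  apply/measurable_EFinP; apply: measurable_funM; first exact: measurable_cst.
  by apply: measurable_indic; exact: measurable_box.
have g0 k xi : (0 <= g k xi)%E by rewrite lee_fin mulr_ge0.
apply: (@le_trans _ _ (\int[mu]_xi \sum_(k <oo) g k xi)%E).
  apply: ae_ge0_le_integral => //.
  - by move=> xi _; apply: nneseries_ge0 => k _ _; exact: g0.
  - by apply: ge0_emeasurable_sum => //.
  (* The plane of frequencies with vanishing third coordinate, left out by slicing, is null. *)
  - exists (setT `*` [set 0]); split.
    + by apply: measurableX => //; exact: measurable_set1.
    + rewrite [LHS](@product_measure1E _ _ (mR * mR)%type mR R (@leb2 R) (@lebesgue_measure R))//.
      rewrite [X in (_ * X)%E](_ : _ = 0%E) ?mule0//; exact: lebesgue_measure_set1.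
    + move=> xi /= nxi; split => //=; apply: contrapT => /eqP x0; apply: nxi => _.
      exact: le_trans (fB _ x0) (dyadic_majorant N xi B0).
rewrite integral_nneseries//.
have E k : (\int[mu]_xi g k xi = (128 * B * (1 + 2 ^+ k / 2 ^+ N)^-1)%:E)%E.
  rewrite /g; under eq_integral do rewrite EFinM.
  rewrite ge0_integralZl_EFin//; last first.
    by apply/measurable_EFinP; apply: measurable_indic; exact: measurable_box.
  rewrite integral_indic//; last exact: measurable_box.
  rewrite setIT [X in (_ * X)%E]mu3_box ?exprn_ge0// -EFinM; congr _%:E.
  have e0 : 0 < 1 + 2 ^+ k / 2 ^+ N :> R by rewrite ltr_pwDl// divr_ge0 ?exprn_ge0.
  have -> : (2 * 2 ^+ k : R) ^+ 3 = 8 * 8 ^+ k.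
    rewrite exprMn -exprM mulnC exprM; congr (_ * _ ^+ k); by rewrite -natrX.
  have e8 : (8 : R) ^+ k != 0 by rewrite expf_neq0.
  rewrite /dyadic_weight.
  have -> : forall y : R, 16 * B * (((8 : R) ^+ k)^-1 / y) * (8 * 8 ^+ k) = 128 * B / y.
    move=> y; rewrite (_ : 16 * B * _ * _ = 128 * B * y^-1 * ((8 ^+ k)^-1 * 8 ^+ k)); last by ring.
    by rewrite mulVf// mulr1.
  by [].
under eq_eseriesr do rewrite E.
apply: lime_le.
  apply: is_cvg_nneseries => k _ _; rewrite lee_fin mulr_ge0 ?mulr_ge0//.
apply: nearW => n.
rewrite sumEFin lee_fin -mulr_sumr big_mkord ler_wpM2l ?mulr_ge0//.
exact: sum_dyadic_tail.
Qed.

End SobolevBound.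

(** As with [leb2], the alias carries sigma-finiteness, here for Tonelli on pairs of a frequency and
    a position. *)
Definition leb3 {R : realType} : set (R3 R) -> \bar R := @mu3 R.

HB.instance Definition _ (R : realType) := Measure.on (@leb3 R).

Lemma sigma_finite_leb3 (R : realType) : sigma_finite setT (@leb3 R).
Proof.
exists (fun n => box n%:R).
  apply/esym; rewrite -subTset => -[[x y] z] _.
  exists (Num.truncn (`|x| + `|y| + `|z|)).+1 => //=.
  have n0 : 0 <= `|x| + `|y| + `|z| by rewrite !addr_ge0.
  have := truncnS_gt (`|x| + `|y| + `|z|).
  have := normr_ge0 x; have := normr_ge0 y; have := normr_ge0 z.
  move: (_.+1%:R) => n z0 y0 x0 lt.
  by rewrite /box/= !in_itv/= -!ler_norml; lra.
move=> n; split; first exact: measurable_box.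
by rewrite [X in (X < _)%E]mu3_box// ltry.
Qed.

HB.instance Definition _ (R : realType) :=
  @Measure_isSigmaFinite.Build _ _ _ (@leb3 R) (@sigma_finite_leb3 R).

(** * From Fourier decay to Sobolev norms *)

Section SobolevNorm.
Context {R : realType}.
Notation mR := (measurableTypeR R).
Notation mu := (@mu3 R).
Implicit Types (h K : R -> R) (x xi : R3 R).

Let c0 : R := (2 * pi) `^ (- (3 / 2)).

Let c0_ge0 : 0 <= c0. Proof. exact: powR_ge0. Qed.

Let c0_le1 : c0 <= 1.
Proof.
rewrite -[leRHS](powRr0 (2 * pi)); apply: ler_powR; last by rewrite oppr_le0 divr_ge0.
by have := pi_ge2 R; lra.
Qed.

(** The support lies in the ball of radius [2], so truncation changes nothing from [n = 2] on and
    the limit in the Plancherel definition is eventually constant. *)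
Lemma fourier_radial h (n : nat) : (forall s, 4 < s -> h s = 0) -> (2 <= n)%N ->
  fourier_re n (fun x => h (dot3 x x)) = (fun xi => c0 * cos_integral h xi) /\
  fourier_im n (fun x => h (dot3 x x)) = (fun xi => - (c0 * sin_integral h xi)).
Proof.
move=> h4 n2.
have n4 : 4 <= n%:R ^+ 2 :> R by rewrite -natrX ler_nat (leq_trans (_ : 4 <= 2 ^ 2)%N)// leq_exp2r.
have E (phi : R3 R -> R) : \int[mu]_(x in [set x | dot3 x x <= n%:R ^+ 2]) (h (dot3 x x) * phi x)
    = \int[mu]_x (h (dot3 x x) * phi x).
  rewrite Rintegral_mkcond; apply: eq_Rintegral => x _; rewrite patchE.
  case: ifPn => //; rewrite notin_setE/= => /negP; rewrite -ltNge => H.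
  by rewrite h4 ?mul0r// (le_lt_trans n4).
by split; apply/funext => xi; rewrite /fourier_re /fourier_im E.
Qed.

(** Adding [|h|] makes the integrand nonnegative, so Tonelli yields measurability in [xi]; the
    integral of [|h|] is a constant and is subtracted afterwards. *)
Lemma measurable_fourier_radial h (phi : R -> R) :
  continuous h -> (exists M, forall s, `|h s| <= M) -> (forall s, 4 < s -> h s = 0) ->
  continuous phi -> (forall t, `|phi t| <= 1) ->
  measurable_fun setT (fun xi : R3 R => \int[mu]_x (h (dot3 x x) * phi (dot3 x xi))).
Proof.
move=> ch [M hM] h4 cphi phi1.
have mh := continuous_measurable_fun ch.
have mphi := continuous_measurable_fun cphi.
have cah : continuous (fun s => `|h s|) by move=> s; apply: cvg_norm; exact: ch.
pose f (z : R3 R * R3 R) := (h (dot3 z.2 z.2) * phi (dot3 z.2 z.1) + `|h (dot3 z.2 z.2)|)%:E.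
have m1 : measurable_fun setT (fun z : R3 R * R3 R => dot3 z.2 z.2).
  by apply: (@measurableT_comp _ _ _ _ _ _ (fun x : R3 R => dot3 x x)) => //; exact: measurable_dot3_diag.
have c11 : measurable_fun setT (fun x : R3 R => x.1.1) by exact: measurable_fst_fst.
have c12 : measurable_fun setT (fun x : R3 R => x.1.2) by exact: measurable_snd_fst.
have m2 : measurable_fun setT (fun z : R3 R * R3 R => dot3 z.2 z.1).
  under eq_fun do rewrite dot3E.
  apply: measurable_funD; first apply: measurable_funD; apply: measurable_funM.
  - exact: (measurableT_comp c11).
  - exact: (measurableT_comp c11).
  - exact: (measurableT_comp c12).
  - exact: (measurableT_comp c12).
  - exact: measurableT_comp.
  - exact: measurableT_comp.
have mf : measurable_fun setT f.
  apply/measurable_EFinP; apply: measurable_funD.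
    by apply: measurable_funM; [exact: measurableT_comp mh m1|exact: measurableT_comp mphi m2].
  exact: measurableT_comp (continuous_measurable_fun cah) m1.
have f0 z : (0 <= f z)%E.
  rewrite lee_fin -lerBlDr sub0r lerNl (le_trans (ler_norm _))// normrN normrM.
  exact: ler_piMr.
have mF := @measurable_fun_fubini_tonelli_F _ _ (R3 R) (R3 R) R (@leb3 R) f mf f0.
pose I := \int[mu]_x `|h (dot3 x x)|.
have -> : (fun xi => \int[mu]_x (h (dot3 x x) * phi (dot3 x xi))) =
    (fun xi => fine (fubini_F mu f xi) - I).
  apply/funext => xi.
  rewrite -[fine _]/(\int[mu]_x (h (dot3 x x) * phi (dot3 x xi) + `|h (dot3 x x)|)).
  have ma : measurable_fun setT (fun x : R3 R => phi (dot3 x xi)).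
    by apply: (@measurableT_comp _ _ _ _ _ _ phi) => //; exact: measurable_dot3.
  have i1 : mu.-integrable setT (EFin \o (fun x => h (dot3 x x) * phi (dot3 x xi))).
    by apply: (integrable_radial mh hM h4 ma) => x; rewrite (le_trans (phi1 _))// ler1n.
  have i2 : mu.-integrable setT (EFin \o (fun x => `|h (dot3 x x)|)).
    have := @integrable_radial R (fun s => `|h s|) M (fun=> 1) (continuous_measurable_fun cah) _ _ _ _.
    have -> : (fun x : R3 R => `|h (dot3 x x)| * 1) = (fun x => `|h (dot3 x x)|).
      by apply/funext => x; rewrite mulr1.
    apply => [s|s s4||x]; rewrite ?normr_id//; first by rewrite h4// normr0.
    by rewrite normr1 ler1n.
  by rewrite RintegralD// /I addrK.
apply: measurable_funB; last exact: measurable_cst.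
by apply: (@measurableT_comp _ _ _ _ _ _ fine) => //; exact: fine_measurable.
Qed.

Lemma Lfun2P (f : R3 R -> R) (B : R) : measurable_fun setT f ->
  (\int[mu]_x (f x ^+ 2)%:E <= B%:E)%E -> f \in Lfun mu 2%:E.
Proof.
move=> mf fB; rewrite inE; apply/andP; split; rewrite inE//=.
rewrite /finite_norm unlock poweR_lty//.
apply: le_lt_trans (ltry B); apply: le_trans fB.
rewrite le_eqVlt; apply/orP; left; apply/eqP.
by apply: eq_integral => x _; rewrite -[LHS]/((`|f x|%:E `^ 2)%E) poweR_EFin powR_mulrn// real_normK ?num_real.
Qed.

(** The size of a sum of [N] scales. With the [H^(3/2)] weight its square behaves like [r^-3], whose
    integral over space diverges logarithmically until the last factor cuts it off at [2^N]. *)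
Definition decay (eta : R) (N : nat) (r : R) : R :=
  eta / ((1 + r ^+ 2) * ((1 + r) * (1 + r / 2 ^+ N))).

(** Two comparisons suffice: [(1 + r^2)^s <= (1 + r)^3], and [(1 + r)^2 <= 2 (1 + r^2)], whose
    square gives the [4]. *)
Lemma weighted_decay (s eta r k : R) (N : nat) : s <= 3 / 2 -> 0 <= eta -> 0 <= r ->
  `|k| <= decay eta N r ->
  (1 + r ^+ 2) `^ s * k ^+ 2 <= 4 * eta ^+ 2 / ((1 + r) ^+ 3 * (1 + r / 2 ^+ N)).
Proof.
move=> s32 eta0 r0 kd.
have q0 : 0 <= r / 2 ^+ N by rewrite divr_ge0// exprn_ge0.
set q := r / 2 ^+ N in kd q0 *.
have a1 : 1 <= 1 + r ^+ 2 by rewrite lerDl sqr_ge0.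
have a0 : 0 < 1 + r ^+ 2 by exact: lt_le_trans a1.
have r1 : 0 < 1 + r by lra.
have q1 : 0 < 1 + q by lra.
have w3 : (1 + r ^+ 2) `^ s <= (1 + r) ^+ 3.
  apply: (le_trans (ler_powR a1 s32)).
  apply: (@le_trans _ _ (((1 + r) ^+ 2) `^ (3 / 2))).
    apply: ge0_ler_powR; rewrite ?nnegrE ?sqr_ge0 ?(ltW a0)//.
    by rewrite sqrrD expr1n mul1r; lra.
  rewrite -[(1 + r) ^+ 2]powR_mulrn ?(ltW r1)// -powRrM.
  rewrite (_ : 2%:R * (3 / 2) = 3%:R); last by field.
  by rewrite powR_mulrn ?(ltW r1).
have k2 : k ^+ 2 <= (decay eta N r) ^+ 2.
  by rewrite -[k ^+ 2]real_normK ?num_real// lerXn2r// nnegrE (le_trans _ kd).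
apply: (le_trans (ler_pM (powR_ge0 _ _) (sqr_ge0 _) w3 k2)).
rewrite /decay -/q.
rewrite (_ : (1 + r) ^+ 3 * _ ^+ 2 = eta ^+ 2 * ((1 + r) / ((1 + r ^+ 2) ^+ 2 * (1 + q) ^+ 2))); last first.
  by field; rewrite !gt_eqF.
have -> : 4 * eta ^+ 2 / ((1 + r) ^+ 3 * (1 + q)) = eta ^+ 2 * (4 / ((1 + r) ^+ 3 * (1 + q))).
  by field; rewrite !gt_eqF.
rewrite ler_wpM2l ?sqr_ge0//.
rewrite ler_pdivrMr; last by rewrite mulr_gt0// exprn_gt0.
rewrite mulrAC ler_pdivlMr; last by rewrite mulr_gt0// exprn_gt0.
have -> : (1 + r) * ((1 + r) ^+ 3 * (1 + q)) = ((1 + r) ^+ 2) ^+ 2 * (1 + q) by ring.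
rewrite (_ : 4 * _ = (2 * (1 + r ^+ 2)) ^+ 2 * (1 + q) ^+ 2); last by ring.
apply: ler_pM; rewrite ?sqr_ge0 ?(ltW q1)//.
  rewrite lerXn2r ?nnegrE ?sqr_ge0 ?mulr_ge0 ?(ltW a0)//.
  by have := sqr_ge0 (1 - r); rewrite !sqrrD sqrrN expr1n !mul1r mulNrn; lra.
by rewrite expr2 ler_peMl ?(ltW q1)//; lra.
Qed.

Lemma sobolev_radial (s : R) h (eta : R) (N : nat) (f : 'rV[R]_3 -> R) :
  s <= 3 / 2 -> 0 <= eta -> admissible h (decay eta N) ->
  (forall x : 'rV[R]_3, unit_ball x -> f x = h (dot x x)) ->
  (sobolev_norm s (@unit_ball R) f <= (32 * eta * Num.sqrt (N%:R + 2))%:E)%E.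
Proof.
move=> s32 eta0 [ch [M hM] h4 Kh] fh.
pose u x := h (dot3 x x).
pose a xi := c0 * cos_integral h xi.
pose b xi := - (c0 * sin_integral h xi).
have ma : measurable_fun setT a.
  apply: measurable_funM; first exact: measurable_cst.
  apply: (measurable_fourier_radial ch _ h4 (@continuous_cos R)); first by exists M.
  by move=> t; exact: cos_max.
have mb : measurable_fun setT b.
  apply: measurableT_comp => //; apply: measurable_funM; first exact: measurable_cst.
  apply: (measurable_fourier_radial ch _ h4 (@continuous_sin R)); first by exists M.
  by move=> t; exact: sin_max.
have le1 (y k : R) : `|y| <= k -> `|c0 * y| <= k.
  move=> yk; rewrite normrM (ger0_norm c0_ge0) (le_trans _ yk)// ler_piMl//.
have ab xi : xi.2 != 0 -> `|a xi| <= decay eta N (freq xi) /\ `|b xi| <= decay eta N (freq xi).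
  by move=> /Kh[c d]; rewrite /b normrN; split; apply: le1.
have md : measurable_fun setT (fun xi : R3 R => dot3 xi xi) by exact: measurable_dot3_diag.
have mw (t : R) : measurable_fun setT (fun xi : R3 R => (1 + dot3 xi xi) `^ t).
  apply: (@measurableT_comp _ _ _ _ _ _ (fun y : R => y `^ t)); first exact: measurable_powR.
  by apply: measurable_funD => //; exact: measurable_cst.
have m2 (k : R3 R -> R) : measurable_fun setT k -> measurable_fun setT (fun x => k x ^+ 2).
  by move=> mk; apply: measurable_funX.
have l2 (k : R3 R -> R) : measurable_fun setT k ->
    (forall xi, xi.2 != 0 -> `|k xi| <= decay eta N (freq xi)) -> k \in Lfun mu 2%:E.
  move=> mk kd; apply: (@Lfun2P _ (128 * (4 * eta ^+ 2) * (N%:R + 2)) mk).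
  apply: dyadic_integral; rewrite ?mulr_ge0 ?sqr_ge0//.
  - by apply/measurable_EFinP; exact: m2.
  - by move=> xi; rewrite lee_fin sqr_ge0.
  move=> xi /kd kxi; rewrite lee_fin.
  rewrite -[leLHS]mul1r -[X in X * _ <= _](powRr0 (1 + freq xi ^+ 2)).
  by apply: weighted_decay => //; exact: freq_ge0.
have uL : u \in Lfun mu 2%:E.
  have mh2 : measurable_fun setT (fun s : R => h s ^+ 2).
    by apply: continuous_measurable_fun => t; apply: (@continuous_comp R R R h (fun y => y ^+ 2)); [exact: ch|exact: exprn_continuous].
  have i2 : mu.-integrable setT (EFin \o (fun x => h (dot3 x x) ^+ 2 * 1)).
    apply: (@integrable_radial R (fun s => h s ^+ 2) (M ^+ 2) (fun=> 1) mh2).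
    - move=> t; rewrite normrX lerXn2r ?nnegrE//; exact: le_trans (hM t).
    - by move=> t /h4 ->; rewrite expr0n.
    - exact: measurable_cst.
    - by move=> x; rewrite normr1 ler1n.
  apply: (@Lfun2P _ (fine (\int[mu]_x (h (dot3 x x) ^+ 2 * 1)%:E))).
    apply: (@measurableT_comp _ _ _ _ _ _ h) => //; exact: continuous_measurable_fun.
  rewrite fineK; last exact: integrable_fin_num.
  by rewrite le_eqVlt; apply/orP; left; apply/eqP/eq_integral => x _; rewrite mulr1.
have F : is_fourier u a b.
  split => //.
  - by apply: l2 => // xi /ab[].
  - by apply: l2 => // xi /ab[].
  apply: cvg_near_cst; near=> n.
  have n2 : (2 <= n)%N by near: n; exact: nbhs_infty_ge.
  have [E1 E2] := fourier_radial h4 n2.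
  under eq_integral do rewrite E1 E2 /a /b !subrr expr0n addr0.
  exact: integral0.
have W : (weighted_norm s a b <= (32 * eta * Num.sqrt (N%:R + 2))%:E)%E.
  (* The real and imaginary parts contribute [4 eta^2] each, and [128 * 8 = 32^2]. *)
  have -> : 32 * eta * Num.sqrt (N%:R + 2) = (128 * (8 * eta ^+ 2) * (N%:R + 2)) `^ 2^-1.
    have N2 : 0 <= N%:R + 2 :> R by rewrite addr_ge0.
    have -> : 128 * (8 * eta ^+ 2) * (N%:R + 2) = (32 * eta) ^+ 2 * (N%:R + 2) by ring.
    by rewrite powR12_sqrt ?mulr_ge0 ?sqr_ge0// sqrtrM ?sqr_ge0// sqrtr_sqr ger0_norm// mulr_ge0.
  rewrite -poweR_EFin /weighted_norm; apply: gt0_ler_poweR; rewrite ?invr_ge0//.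
  - rewrite in_itv/= leey andbT; apply: integral_ge0 => xi _.
    by rewrite lee_fin mulr_ge0 ?powR_ge0// addr_ge0 ?sqr_ge0.
  - by rewrite in_itv/= leey andbT lee_fin !mulr_ge0 ?sqr_ge0// addr_ge0.
  apply: dyadic_integral.
  - by rewrite mulr_ge0 ?sqr_ge0.
  - by apply/measurable_EFinP; apply: measurable_funM => //; apply: measurable_funD; exact: m2.
  - by move=> xi; rewrite lee_fin mulr_ge0 ?powR_ge0// addr_ge0 ?sqr_ge0.
  move=> xi /ab[ax bx]; rewrite lee_fin mulrDr -freq_sqr.
  have fx := freq_ge0 xi.
  have A1 := weighted_decay s32 eta0 fx ax.
  have B1 := weighted_decay s32 eta0 fx bx.
  apply: (le_trans (lerD A1 B1)).
  by rewrite -mulrDl -mulrDl le_eqVlt; apply/orP; left; apply/eqP; congr (_ * _ / _); ring.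
apply: le_trans W; apply: ereal_inf_lbound; exists u, a, b; split => //.
by apply: aeW => x /fh ->.
Unshelve. all: by end_near.
Qed.

(** Serves the off-diagonal components. *)
Lemma sobolev_zero (s : R) (U : set 'rV[R]_3) :
  (sobolev_norm s U (fun=> 0%R) <= 0)%E.
Proof.
have z : (fun=> 0 : R) \in Lfun mu 2%:E.
  apply: (@Lfun2P _ 0); first exact: measurable_cst.
  by rewrite (eq_integral (fun=> 0%E)) ?integral0// => x _; rewrite expr0n.
apply: ereal_inf_lbound; exists (fun=> 0), (fun=> 0), (fun=> 0); split.
- by apply: aeW.
- split => //.
  rewrite (_ : (fun n => _) = (fun=> 0%E)); first exact: cvg_cst.
  apply/funext => n; rewrite (eq_integral (fun=> 0%E)) ?integral0// => x _.
  have z0 (phi : R3 R -> R) : \int[mu]_(x in [set x | dot3 x x <= n%:R ^+ 2]) (0 * phi x) = 0.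
    by rewrite /Rintegral (eq_integral (fun=> 0%E)) ?integral0// => y _; rewrite mul0r.
  by rewrite /fourier_re /fourier_im !z0 mulr0 !oppr0 !addr0 expr0n addr0.
rewrite /weighted_norm (eq_integral (fun=> 0%E)) ?integral0 ?poweR0r ?invr_eq0//.
by move=> x _; rewrite expr0n addr0 mulr0.
Qed.

End SobolevNorm.

(** * The initial data *)

Section ConformalFactor.
Context {R : realType}.
Implicit Types (c : nat -> R) (N : nat) (al s : R).

(** Free coefficients keep the family closed under derivation, which multiplies the [n]-th one by
    [2^n]. *)
Definition expsum c N s : R := \sum_(n < N) c n * expR (2 ^+ n * (s - 1)).

Lemma is_derive_expsum c N s :
  is_derive s 1 (expsum c N) (expsum (fun n => c n * 2 ^+ n) N s).
Proof.
rewrite /expsum; elim: N => [|N IH].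
  rewrite big_ord0 (_ : (fun s : R => _) = (fun=> 0)); first exact: is_derive_cst.
  by apply/funext => t; rewrite big_ord0.
rewrite (_ : (fun s : R => _) =
    (fun s => \sum_(n < N) c n * expR (2 ^+ n * (s - 1)) + c N * expR (2 ^+ N * (s - 1)))); last first.
  by apply/funext => t; rewrite big_ord_recr.
rewrite big_ord_recr/=; apply: is_deriveD.
have d1 : is_derive s 1 (fun t : R => 2 ^+ N * (t - 1)) (2 ^+ N).
  have := is_deriveMl (2 ^+ N) (is_deriveB (is_derive_id s (1 : R)) (is_derive_cst (1 : R) s (1 : R))).
  by rewrite subr0 mulr1.
have := is_deriveMl (c N) (is_derive_comp1 d1 (is_derive_expR (2 ^+ N * (s - 1)))).
by rewrite mulrA [c N * _ * 2 ^+ N]mulrAC.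
Qed.

Lemma elementary_expsum (U : set 'rV[R]_3) c N :
  elementary U (fun x => expsum c N (dot x x)).
Proof.
elim: N => [|N IH].
  apply: (elem_ext (elem_cst _ 0)) => x _; by rewrite /expsum big_ord0.
apply: (@elem_ext _ _ _ (fun x => expsum c N (dot x x) + c N * expR (2 ^+ N * (dot x x + -1)))).
  apply: elem_add => //; apply: elem_mul; first exact: elem_cst.
  apply: elem_exp; apply: elem_mul; first exact: elem_cst.
  by apply: elem_add; [exact: elementary_dot|exact: elem_cst].
by move=> x _; rewrite /expsum big_ord_recr.
Qed.

Lemma expsum_ge0 c N s : (forall n, 0 <= c n) -> 0 <= expsum c N s.
Proof. by move=> c0; apply: sumr_ge0 => n _; rewrite mulr_ge0// expR_ge0. Qed.

Lemma expsum_le2 N s : s <= 1 -> expsum (fun n => (2 ^+ n)^-1) N s <= 2.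
Proof.
move=> s1; apply: (@le_trans _ _ (2 - 2 / 2 ^+ N)); last first.
  by rewrite gerBl divr_ge0// exprn_ge0.
rewrite /expsum; elim: N => [|N IH]; first by rewrite big_ord0 expr0 divr1 subrr.
rewrite big_ord_recr/=.
have e1 : expR (2 ^+ N * (s - 1)) <= 1.
  by rewrite -[leRHS]expR0 ler_expR mulr_ge0_le0 ?exprn_ge0// subr_le0.
have i0 : 0 <= (2 ^+ N)^-1 :> R by rewrite invr_ge0 exprn_ge0.
have := ler_wpM2l i0 e1; rewrite mulr1 exprS invfM mulrA divff// mul1r; lra.
Qed.

Definition factor al N s : R := 1 - al * expsum (fun n => (2 ^+ n)^-1) N s.
Definition factor1 al N s : R :=
  - (al * expsum (fun n => (2 ^+ n)^-1 * 2 ^+ n) N s).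
Definition factor2 al N s : R :=
  - (al * expsum (fun n => (2 ^+ n)^-1 * 2 ^+ n * 2 ^+ n) N s).

Lemma is_derive_factor al N s : is_derive s 1 (factor al N) (factor1 al N s).
Proof.
rewrite /factor1 -[- _]add0r.
exact: is_deriveB (is_deriveMl al (is_derive_expsum _ N s)).
Qed.

Lemma is_derive_factor1 al N s : is_derive s 1 (factor1 al N) (factor2 al N s).
Proof. exact: is_deriveN (is_deriveMl al (is_derive_expsum _ N s)). Qed.

Lemma elem_opp (U : set 'rV[R]_3) f : elementary U f -> elementary U (fun x => - f x).
Proof.
move=> ef; apply: (elem_ext (elem_mul (elem_cst _ (-1)) ef)) => x _.
by rewrite mulN1r.
Qed.

Lemma elementary_factor (U : set 'rV[R]_3) al N :
  [/\ elementary U (fun x => factor al N (dot x x)),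
      elementary U (fun x => factor1 al N (dot x x)) &
      elementary U (fun x => factor2 al N (dot x x))].
Proof.
have H c : elementary U (fun x => - (al * expsum c N (dot x x))).
  by apply: elem_opp; apply: elem_mul; [exact: elem_cst|exact: elementary_expsum].
split; [|exact: H|exact: H].
by apply: elem_add (H _); exact: elem_cst.
Qed.

Lemma factor_gt0 al N s : 0 <= al -> 2 * al < 1 -> s <= 1 -> 0 < factor al N s.
Proof.
move=> al0 al1 /(expsum_le2 N) /(ler_wpM2l al0); rewrite /factor; lra.
Qed.

Lemma factor1_le0 al N s : 0 <= al -> factor1 al N s <= 0.
Proof.
move=> al0; rewrite oppr_le0; apply: mulr_ge0 => //; apply: expsum_ge0 => n.
by rewrite !mulr_ge0 ?invr_ge0 ?exprn_ge0.
Qed.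

Lemma factor2_le0 al N s : 0 <= al -> factor2 al N s <= 0.
Proof.
move=> al0; rewrite oppr_le0; apply: mulr_ge0 => //; apply: expsum_ge0 => n.
by rewrite !mulr_ge0 ?invr_ge0 ?exprn_ge0.
Qed.

(* The amplitude for which [V s + s V' s] vanishes at [s = 1 - 2 ^- N], so that
   the sphere [|x|^2 = s] is totally geodesic; all [N] exponentials contribute to
   [V' s] on equal terms, so it is of size [1 / N]. *)
Definition amplitude N : R :=
  (expsum (fun n => (2 ^+ n)^-1 + (1 - 2 ^- N)) N (1 - 2 ^- N))^-1.

Lemma amplitudeP N : (0 < N)%N ->
  [/\ 0 < amplitude N, amplitude N <= 8 / N%:R &
      factor (amplitude N) N (1 - 2 ^- N) +
      (1 - 2 ^- N) * factor1 (amplitude N) N (1 - 2 ^- N) = 0].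
Proof.
move=> N0; set s0 := 1 - 2 ^- N.
have s12 : 2^-1 <= s0.
  have : 2 ^- N <= 2^-1 :> R by rewrite lef_pV2 ?posrE ?exprn_gt0// ler_eXnr// ler1n.
  rewrite /s0; lra.
set E := (amplitude N)^-1.
(* Since [n < N], the exponent [- 2^(n - N)] is at least [-1], and
   [exp (-1) = exp (- 1/2)^2 >= 1/4]; the other factor is at least [1/2]. Hence the [8] in the bound
   on the amplitude. *)
have term (n : 'I_N) : 8^-1 <= ((2 ^+ n)^-1 + s0) * expR (2 ^+ n * (s0 - 1)).
  have e4 : 4^-1 <= expR (2 ^+ n * (s0 - 1)).
    apply: (@le_trans _ _ (expR (-1))).
      have h : 2^-1 <= expR (- 2^-1) :> R.
        by apply: le_trans (expR_ge1Dx _); lra.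
      have -> : (-1 : R) = - 2^-1 + - 2^-1 by lra.
      rewrite expRD (_ : 4^-1 = 2^-1 * 2^-1); last by lra.
      by apply: ler_pM; rewrite ?invr_ge0.
    rewrite ler_expR /s0 addrAC subrr add0r mulrN lerN2.
    rewrite ler_pdivrMr ?exprn_gt0// mul1r ler_eXn2l ?ltr1n//; exact: ltnW.
  have t0 : 0 <= (2 ^+ n)^-1 :> R by rewrite invr_ge0 exprn_ge0.
  rewrite (_ : 8^-1 = 2^-1 * 4^-1); last by lra.
  by apply: ler_pM; rewrite ?invr_ge0//; lra.
have En : N%:R / 8 <= E.
  rewrite /E /amplitude invrK /expsum mulr_natl -[N in leLHS]card_ord -sumr_const.
  by apply: ler_sum => n _; exact: term.
have Npos : 0 < N%:R :> R by rewrite ltr0n.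
have E0 : 0 < E by apply: lt_le_trans En; rewrite divr_gt0.
split.
- by rewrite -invr_gt0.
- by rewrite -[leLHS]invrK -/E -[leRHS]invf_div lef_pV2 ?posrE// divr_gt0.
- have -> : factor (amplitude N) N s0 + s0 * factor1 (amplitude N) N s0
     = 1 - amplitude N * E.
    have -> : E = expsum (fun n => (2 ^+ n)^-1) N s0 +
        s0 * expsum (fun n => (2 ^+ n)^-1 * 2 ^+ n) N s0.
      rewrite /E /amplitude invrK /expsum mulr_sumr -big_split/=; apply: eq_bigr => n _.
      by rewrite mulrDl mulVf ?mul1r// expf_neq0.
    by rewrite /factor /factor1; ring.
  by rewrite /E divff ?subrr// gt_eqF// -invr_gt0.
Qed.

End ConformalFactor.

(** * The constraint equations *)

Section InitialData.
Context {R : realType}.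
Notation E3 := 'rV[R]_3.
Notation ball1 := (@unit_ball R).
Variables (al de : R) (N : nat).
Hypotheses (al0 : 0 <= al) (al1 : 2 * al < 1) (de0 : 0 < de).
Notation V := (factor al N).
Notation V1 := (factor1 al N).
Notation V2 := (factor2 al N).

Lemma open_unit_ball : open ball1.
Proof.
have -> : ball1 = (fun x : E3 => dot x x) @^-1` [set t | t < 1] by [].
apply: open_comp; last exact: open_lt.
by move=> x _; exact: (@elementary_continuous _ _ setT openT _ (elementary_dot setT) x I).
Qed.

Let V_gt0 x : ball1 x -> 0 < V (dot x x).
Proof. by move=> /ltW; exact: factor_gt0. Qed.

Let V_neq0 x : ball1 x -> V (dot x x) != 0.
Proof. by move=> /V_gt0 V0; rewrite gt_eqF. Qed.

Let symmetric_radial c : symmetric_tensor ball1 (radial_metric V c).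
Proof.
split; last by move=> x _; rewrite /radial_metric tr_scalar_mx.
rewrite (_ : radial_metric V c = fun x : E3 => (c * V (dot x x)) *: 1%:M); last first.
  by apply/funext => x; rewrite scalemx1.
apply: smooth_on_scale; first exact: open_unit_ball.
apply: elementary_smooth; first exact: open_unit_ball.
by apply: elem_mul; [exact: elem_cst|have [] := elementary_factor ball1 al N].
Qed.

Let curvature (x : E3) : R := scalar_curvature (radial_metric V 1) x.

(** Expanding [F1] turns [- 4 s F1 - s F^2] into [- 4 s V2 / V + 3 s F^2]; every summand is then
    nonnegative when [V1] and [V2] are nonpositive. *)
Let curvatureE x : ball1 x -> curvature x =
  2 * ((V (dot x x))^-1 * (6 * (- V1 (dot x x) * (V (dot x x))^-1) +
    4 * (dot x x * (- V2 (dot x x) * (V (dot x x))^-1)) +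
    3 * (dot x x * (V1 (dot x x) * (V (dot x x))^-1 *
                    (V1 (dot x x) * (V (dot x x))^-1))))).
Proof.
move=> /V_neq0 Vx.
rewrite /curvature (scalar_curvature_radial (is_derive_factor al N) (is_derive_factor1 al N))//.
by ring.
Qed.

Let curvature_ge0 x : ball1 x -> 0 <= curvature x.
Proof.
move=> bx; have Vx := V_gt0 bx; rewrite curvatureE//.
have i0 : 0 <= (V (dot x x))^-1 by rewrite invr_ge0 ltW.
have n1 : 0 <= - V1 (dot x x) by rewrite oppr_ge0 factor1_le0.
have n2 : 0 <= - V2 (dot x x) by rewrite oppr_ge0 factor2_le0.
have d0 := dot_ge0 x.
have q2 : 0 <= V1 (dot x x) * (V (dot x x))^-1 * (V1 (dot x x) * (V (dot x x))^-1).
  by rewrite -expr2 sqr_ge0.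
by do 2![apply: mulr_ge0 => //]; apply: addr_ge0; [apply: addr_ge0|];
  do 3![apply: mulr_ge0 => //].
Qed.

(** The constant is [(tr k)^2 - |k|^2 = 9 de^2 - 3 de^2]. Being positive, it keeps the root smooth
    even where the curvature might vanish. *)
Definition matter (x : E3) : R := Num.sqrt (curvature x + 6 * de ^+ 2).

Let smooth_matter : smooth_on ball1 matter.
Proof.
apply: elementary_smooth; first exact: open_unit_ball.
apply: elem_sqrt; last first.
  by move=> x /curvature_ge0 c0; rewrite ltr_wpDl// mulr_gt0// exprn_gt0.
apply: elem_add; last exact: elem_cst.
have [e0 e1 e2] := elementary_factor ball1 al N.
have ei : elementary ball1 (fun x => (V (dot x x))^-1) by exact: elem_inv.
have ed := elementary_dot ball1.
have ec (c : R) f : elementary ball1 f -> elementary ball1 (fun x => c * f x).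
  by apply: elem_mul; exact: elem_cst.
have e1i := elem_mul e1 ei.
have e1n := elem_mul (elem_opp e1) ei.
have e2n := elem_mul (elem_opp e2) ei.
have e := ec 2 _ (elem_mul ei (elem_add (elem_add (ec 6 _ e1n) (ec 4 _ (elem_mul ed e2n)))
  (ec 3 _ (elem_mul ed (elem_mul e1i e1i))))).
by apply: (elem_ext e) => x bx; rewrite curvatureE.
Qed.

Let partial_cst b (c : R) (x : E3) : partial b (fun=> c) x = 0.
Proof. exact: derive_cst. Qed.

Lemma radial_initial_data :
  initial_data_set ball1 (radial_metric V 1) (radial_metric V (- de)) (fun=> 0) matter.
Proof.
split.
- split=> [|x bx v v0]; first exact: symmetric_radial.
  rewrite /radial_metric bilin_scalar mul1r mulr_gt0 ?V_gt0//.
  rewrite lt_neqAle dot_ge0 andbT; apply: contra_neq v0 => /esym; exact: dot_eq0.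
- exact: symmetric_radial.
- by split; [exact/smooth_on_cst/open_unit_ball|exact: smooth_matter].
- move=> x bx; rewrite trace_radial ?V_neq0// tensor_norm2_radial ?V_neq0//.
  have -> : grad_norm2 (radial_metric V 1) (fun=> 0) x = 0.
    by rewrite /grad_norm2 big1// => a _; rewrite big1// => b _; rewrite !partial_cst !mulr0.
  rewrite /matter sqr_sqrtr; last by apply: addr_ge0; [exact: curvature_ge0|apply: mulr_ge0 => //; exact: sqr_ge0].
  by rewrite /curvature add0r; ring.
- move=> x bx b; rewrite (div_radial (is_derive_factor al N))//; last exact: V_neq0.
  rewrite partial_cst mulr0 sub0r /partial.
  rewrite (@near_eq_derive _ _ _ _ (fun=> 3 * - de)) ?derive_cst ?oppr0//.
  apply: (open_near_eq open_unit_ball _ bx) => y yb.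
  by rewrite trace_radial ?V_neq0.
Qed.

End InitialData.

(** * Norms of the data and choice of the parameters *)

Section Bounds.
Context {R : realType}.
Notation E3 := 'rV[R]_3.
Notation ball1 := (@unit_ball R).

(** Collects [9] from [sum_dyadic_le], [2 pi] from slicing and [7400] from
    [profile_transform_le]. *)
Definition extension_cst : R := 9 * (2 * pi * (74 * 100)).

Lemma extension_cst_ge0 : 0 <= extension_cst.
Proof. by rewrite !mulr_ge0// pi_ge0. Qed.

Lemma admissible_expsum (al : R) (N : nat) : 0 <= al ->
  admissible (fun s => - al * \sum_(n < N) profile 1 (2 ^+ n) s)
    (decay (extension_cst * al) N).
Proof.
move=> al0.
have A := admissible_sum N (fun n => admissible_profile ler01 (lexx 1)
  (exprn_ege1 n (ler1n R 2))).
apply: admissible_le (admissibleZ (- al) A) => r r0.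
rewrite normrN ger0_norm// /decay.
have := sum_dyadic_le N r0.
set S := \sum_(n < N) _; set D := (1 + r) * _ => SD.
have -> : \sum_(n < N) 2 * pi * (74 * 100 * 2 ^+ n / ((1 + r ^+ 2) * ((2 ^+ n) ^+ 2 + r ^+ 2)))
    = 2 * pi * (74 * 100) / (1 + r ^+ 2) * S.
  rewrite /S mulr_sumr; apply: eq_bigr => n _; rewrite invfM.
  move: (_^-1) (_^-1) => i1 i2; ring.
have r1 : 0 < 1 + r ^+ 2 by rewrite ltr_pwDl ?sqr_ge0.
have D0 : 0 < D.
  by rewrite mulr_gt0 ?ltr_pwDl// divr_ge0// exprn_ge0.
have -> : extension_cst * al / ((1 + r ^+ 2) * D) =
    al * (2 * pi * (74 * 100) / (1 + r ^+ 2) * (9 / D)).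
  by rewrite /extension_cst; field; rewrite !gt_eqF.
rewrite ler_wpM2l// ler_wpM2l//.
by rewrite divr_ge0 ?(ltW r1)// !mulr_ge0// pi_ge0.
Qed.

(** Needed for [k], which contains all of [V] and not only [V - 1]. The faster decay of one smooth
    scale is weakened to the class of [admissible_expsum] so that the two can be added. *)
Lemma admissible_one (N : nat) :
  admissible (profile 0 1) (decay (extension_cst : R) N).
Proof.
apply: admissible_le (admissible_profile (lexx 0) ler01 (lexx 1)) => r r0.
rewrite /decay expr1n mulr1.
have q0 : 0 <= r / 2 ^+ N by rewrite divr_ge0// exprn_ge0.
have qr : r / 2 ^+ N <= r.
  by rewrite ler_piMr// invf_le1 ?exprn_gt0// exprn_ege1// ler1n.
have r1 : 0 < 1 + r ^+ 2 by rewrite ltr_pwDl ?sqr_ge0.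
have D0 : 0 < (1 + r) * (1 + r / 2 ^+ N) by rewrite mulr_gt0 ?ltr_pwDl.
have DE : (1 + r) * (1 + r / 2 ^+ N) <= 9 * (1 + r ^+ 2).
  apply: (@le_trans _ _ ((1 + r) * (1 + r))).
    by rewrite ler_wpM2l ?addr_ge0// lerD2l.
  have := sqr_ge0 (1 - r); rewrite (_ : (1 - r) ^+ 2 = 1 - 2 * r + r ^+ 2); last by ring.
  by rewrite (_ : (1 + r) * (1 + r) = 1 + 2 * r + r ^+ 2); [lra|ring].
move: D0 DE; set D := (1 + r) * _ => D0 DE.
have -> : 2 * pi * (74 * 100 / ((1 + r ^+ 2) * (1 + r ^+ 2))) =
    2 * pi * (74 * 100) / (1 + r ^+ 2) * (1 + r ^+ 2)^-1 by field; exact: lt0r_neq0.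
have -> : extension_cst / ((1 + r ^+ 2) * D) =
    2 * pi * (74 * 100) / (1 + r ^+ 2) * (9 / D).
  by rewrite /extension_cst; field; rewrite !gt_eqF.
rewrite ler_wpM2l//; first by rewrite divr_ge0 ?(ltW r1)// !mulr_ge0// pi_ge0.
by rewrite ler_pdivlMr// mulrC ler_pdivrMr.
Qed.

Lemma factor_extension (al s : R) N : s <= 1 ->
  - al * \sum_(n < N) profile 1 (2 ^+ n) s = factor al N s - 1.
Proof.
move=> s1; rewrite /factor addrAC subrr add0r mulNr; congr (- (_ * _)).
apply: eq_bigr => n _; rewrite profile_in ?exprn_ege1 ?ler1n//.
by rewrite subrr addr0 mul1r.
Qed.

Lemma tensor_sobolev_scalar (s B : R) (f : E3 -> R) :
  (sobolev_norm s ball1 f <= B%:E)%E ->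
  (tensor_sobolev_norm s ball1 (fun x => (f x)%:M) <= (3 * B)%:E)%E.
Proof.
move=> fB; rewrite /tensor_sobolev_norm.
have E (i j : 'I_3) : (sobolev_norm s ball1 (fun x => (f x)%:M i j) <=
    (if i == j then B else 0)%:E)%E.
  have -> : (fun x => (f x)%:M i j) = if i == j then f else fun=> 0.
    by apply/funext => x; rewrite mxE; case: eqP.
  by case: ifP => // _; exact: sobolev_zero.
apply: (le_trans (lee_sum _ (fun i _ => lee_sum _ (fun j _ => E i j)))).
have -> : (3 * B)%:E = (\sum_(i < 3) B%:E)%E.
  by rewrite sumEFin sumr_const card_ord mulr_natl.
apply: lee_sum => i _; rewrite sumEFin lee_fin -big_mkcond (big_pred1 i) => [//|j].
by rewrite /= eq_sym.
Qed.

Lemma metric_bound (al : R) N : 0 <= al ->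
  (tensor_sobolev_norm (3 / 2) ball1 (fun x => (radial_metric (factor al N) 1 x - 1%:M)%R)
   <= (3 * (32 * (extension_cst * al) * Num.sqrt (N%:R + 2)))%:E)%E.
Proof.
move=> al0.
rewrite (_ : (fun x => _) = fun x : E3 => (factor al N (dot x x) - 1)%:M); last first.
  by apply/funext => x; rewrite /radial_metric mul1r; apply/matrixP => i j; rewrite !mxE; case: eqP => _; rewrite ?mulr1n ?mulr0n ?subrr.
apply: tensor_sobolev_scalar.
apply: (sobolev_radial (lexx _) _ (admissible_expsum N al0)).
  by rewrite mulr_ge0// extension_cst_ge0.
by move=> x /ltW/factor_extension ->.
Qed.

(** The [H^(3/2)] estimate is reused for [H^(1/2)]. The growth in [N] does no harm, as [de] is
    chosen after [N]. *)
Lemma second_form_bound (al de : R) N : 0 <= al -> 0 <= de ->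
  (tensor_sobolev_norm (1 / 2) ball1 (radial_metric (factor al N) (- de))
   <= (3 * (32 * (de * (extension_cst * (1 + al))) * Num.sqrt (N%:R + 2)))%:E)%E.
Proof.
move=> al0 de0; have C0 := extension_cst_ge0.
apply: tensor_sobolev_scalar.
have A : admissible (fun s => - de * (profile 0 1 s + - al * \sum_(n < N) profile 1 (2 ^+ n) s))
    (decay (de * (extension_cst * (1 + al))) N).
  apply: admissible_le (admissibleZ (- de) (admissibleD (admissible_one N) (admissible_expsum N al0))).
  move=> r r0; rewrite normrN ger0_norm// /decay -mulrDl.
  by rewrite [extension_cst * (1 + al)]mulrDr mulr1 [leLHS]mulrA.
apply: (sobolev_radial _ _ A).
- by lra.
- by apply: mulr_ge0 => //; apply: mulr_ge0 => //; exact: addr_ge0.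
move=> x /ltW x1; rewrite factor_extension// profile_in// mul0r add0r subr0 invr1 mulr1.
by rewrite addrC subrK.
Qed.

Lemma trapped_data (e : R) : 0 < e -> exists (g k : E3 -> 'M[R]_3) (psi0 psi1 : E3 -> R),
  [/\ initial_data_set ball1 g k psi0 psi1,
      (tensor_sobolev_norm (3 / 2) ball1 (fun x => (g x - 1%:M)%R)
       + tensor_sobolev_norm (1 / 2) ball1 k <= e%:E)%E
    & exists S : set E3, embedded_sphere S /\ trapped ball1 g k S].
Proof.
move=> e0; have C0 := extension_cst_ge0.
(* Taking [N = m^2] gives [al sqrt (N + 2) <= (8 / m^2) (2 m) = 16 / m], so this lower bound on [m]
   makes the metric part at most [e / 2]; [m >= 5] ensures [2 al <= 16 / 25 < 1]. *)
pose m := (Num.truncn (3 * 32 * extension_cst * 32 / e)).+1.+4.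
pose N := (m ^ 2)%N.
have m5 : (5 <= m)%N by [].
have m5R : 5 <= m%:R :> R by rewrite (ler_nat R 5).
have m0 : 0 < m%:R :> R by lra.
have mB : 3 * 32 * extension_cst * 32 / e <= m%:R.
  have := truncnS_gt (3 * 32 * extension_cst * 32 / e) => /ltW h.
  by apply: (le_trans h); rewrite ler_nat; exact: (leq_addl 4).
have NE : N%:R = m%:R ^+ 2 :> R by rewrite natrX.
have N0 : (0 < N)%N by rewrite expn_gt0.
have [al0 alN alE] := @amplitudeP R N N0.
set al := amplitude N in al0 alN alE.
have al1 : 2 * al < 1.
  have m25 : 5 * 5 <= m%:R ^+ 2 :> R by rewrite expr2; apply: ler_pM.
  have : 8 / N%:R <= 8 / (5 * 5) :> R.
    by rewrite NE ler_pM2l// lef_pV2 ?posrE ?exprn_gt0.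
  lra.
have sq : Num.sqrt (N%:R + 2) <= 2 * m%:R :> R.
  rewrite -[leRHS]ger0_norm ?mulr_ge0 ?(ltW m0)// -sqrtr_sqr ler_sqrt ?sqr_ge0//.
  rewrite NE exprMn; have : 5 * 5 <= m%:R ^+ 2 :> R by rewrite expr2; apply: ler_pM.
  lra.
(* The denominator exceeds the norm bound of [k] per unit of [de], so [k] receives at most the other
   half of [e]. *)
pose de := e / 2 / (1 + 3 * (32 * (extension_cst * (1 + al)) * Num.sqrt (N%:R + 2))).
have d1 : 0 < 1 + 3 * (32 * (extension_cst * (1 + al)) * Num.sqrt (N%:R + 2)).
  rewrite ltr_pwDl//; apply: mulr_ge0 => //; apply: mulr_ge0; last exact: sqrtr_ge0.
  by apply: mulr_ge0 => //; apply: mulr_ge0 => //; lra.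
have de0 : 0 < de by rewrite divr_gt0// divr_gt0.
exists (radial_metric (factor al N) 1), (radial_metric (factor al N) (- de)),
  (fun=> 0), (matter al de N).
split.
- exact: radial_initial_data (ltW al0) al1 de0.
- have -> : e = e / 2 + e / 2 by lra.
  rewrite EFinD; apply: leeD.
    apply: (le_trans (metric_bound N (ltW al0))); rewrite lee_fin.
    have aS : al * Num.sqrt (N%:R + 2) <= 16 / m%:R.
      apply: (@le_trans _ _ (8 / N%:R * (2 * m%:R))).
        by apply: ler_pM => //; exact: ltW.
      rewrite NE; move: (m%:R : R) m0 => y y0.
      by rewrite le_eqVlt; apply/orP; left; apply/eqP; field; exact: lt0r_neq0.
    have : 3 * 32 * extension_cst * (al * Num.sqrt (N%:R + 2)) <=
        3 * 32 * extension_cst * (16 / m%:R).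
      by apply: ler_wpM2l aS; apply: mulr_ge0.
    have : 3 * 32 * extension_cst * (16 / m%:R) <= e / 2.
      rewrite mulrA ler_pdivrMr//; move: mB; rewrite ler_pdivrMr//; lra.
    lra.
  apply: (le_trans (second_form_bound N (ltW al0) (ltW de0))); rewrite lee_fin.
  rewrite (_ : 3 * _ = de * (3 * (32 * (extension_cst * (1 + al)) * Num.sqrt (N%:R + 2)))); last by ring.
  rewrite /de -[leRHS](divfK (lt0r_neq0 d1)) ler_wpM2l//; last by rewrite lerDr.
  exact: ltW.
exists (centred_sphere (1 - 2 ^- N)).
have h2 : 0 < 2 ^- N :> R by rewrite invr_gt0 exprn_gt0.
have s1 : 2 ^- N < 1 :> R by rewrite invf_lt1 ?exprn_gt0// exprn_egt1 ?ltr1n// -lt0n.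
have s0 : 0 < 1 - 2 ^- N :> R by lra.
have s2 : 1 - 2 ^- N < 1 :> R by lra.
split; first exact: embedded_centred_sphere.
apply: (trapped_centred_sphere (is_derive_factor al N)) => //.
by apply: factor_gt0 => //; exact: ltW.
Qed.

End Bounds.

Theorem proposition1p3 (R : realType) :
  exists (g k : nat -> 'rV[R]_3 -> 'M[R]_3)
         (psi0 psi1 : nat -> 'rV[R]_3 -> R),
  forall j : nat, (0 < j)%N ->
    [/\ initial_data_set (@unit_ball R) (g j) (k j) (psi0 j) (psi1 j),
        (tensor_sobolev_norm (3 / 2) (@unit_ball R) (fun x => (g j x - 1%:M)%R)
         + tensor_sobolev_norm (1 / 2) (@unit_ball R) (k j)
         <= (2 ^- j)%:E)%E
      & exists S : set 'rV[R]_3,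
          embedded_sphere S /\ trapped (@unit_ball R) (g j) (k j) S].
Proof.
have e0 (j : nat) : 0 < 2 ^- j :> R by rewrite invr_gt0 exprn_gt0.
have [g Hg] := choice (fun j => trapped_data (e0 j)).
have [k Hk] := choice Hg.
have [psi0 H0] := choice Hk.
have [psi1 H1] := choice H0.
by exists g, k, psi0, psi1 => j _; exact: H1.
Qed.
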